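(* Let $n$ be a positive integer, let $A$ be a basic Artin algebra, and let $\mathcal{C}=\mathrm{add}\,M$ be a finite $n$-precluster tilting subcategory of $A\text{-mod}$ with basic additive generator $M=\bigoplus_{i=1}^{t}M_i$, where each $M_i$ is indecomposable. Let $\Lambda=\mathrm{End}_A(M)^{op}$, and for each $1\le i\le t$ let $S_i$ be the top of the indecomposable projective $\Lambda$-module $\mathrm{Hom}_A(M,M_i)$. Then for each $i$: (1) if $M_i$ is a projective $A$-module, then $\mathrm{Gpd}\,S_i\le n$; (2) if $M_i$ is not a projective $A$-module, then $\mathrm{Gpd}\,S_i=n+1$.
   Context: All modules are finitely generated left modules, and $A\text{-mod}$ is the category of finitely generated left $A$-modules. $\mathrm{add}\,M$ is the full subcategory of direct summands of finite direct sums of copies of $M$. $M$ basic means that the $M_i$ are pairwise non-isomorphic. The group $\mathrm{Hom}_A(M,X)$ is a left module over $\Lambda=\mathrm{End}_A(M)^{op}$ by precomposition. $\mathrm{Gpd}$ denotes the Gorenstein projective dimension: a module is Gorenstein projective if it is a syzygy (image of a differential) of an exact complex of finitely generated projective modules that stays exact after applying $\mathrm{Hom}_\Lambda(-,\Lambda)$, and $\mathrm{Gpd}\,N$ is the minimal length of a resolution of $N$ by Gorenstein projective modules ($\infty$ if no finite one exists). The $n$-Auslander-Reiten translations are $\tau_n=\tau\,\Omega_A^{n-1}:A\text{-}\underline{\mathrm{mod}}\to A\text{-}\overline{\mathrm{mod}}$ and $\tau_n^-=\tau^-\,\Omega_A^{-(n-1)}:A\text{-}\overline{\mathrm{mod}}\to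 A\text{-}\underline{\mathrm{mod}}$, where $\tau,\tau^-$ are the usual Auslander-Reiten translations, $\Omega_A$ and $\Omega_A^{-1}$ are the syzygy and cosyzygy, and $A\text{-}\underline{\mathrm{mod}}$, $A\text{-}\overline{\mathrm{mod}}$ are the stable categories modulo projectives and modulo injectives respectively. A subcategory $\mathcal{C}$ of $A\text{-mod}$ is an $n$-precluster tilting subcategory if: (1) $\mathcal{C}$ is a generator-cogenerator for $A\text{-mod}$ (it contains all projective and all injective $A$-modules); (2) $\tau_n(\mathcal{C})\subseteq\mathcal{C}$ and $\tau_n^-(\mathcal{C})\subseteq\mathcal{C}$; (3) $\mathrm{Ext}_A^i(\mathcal{C},\mathcal{C})=0$ for $0<i<n$; (4) $\mathcal{C}$ is functorially finite in $A\text{-mod}$. It is called finite if moreover $\mathcal{C}=\mathrm{add}\,M$ for some module $M$ (an additive generator). *)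

(* Defs.v *)
(* [boolp] provides the classical choice structure on types of linear maps. *)
From HB Require Import structures.
From mathcomp Require Import all_boot all_algebra.
From mathcomp Require Import boolp.

Set Implicit Arguments.
Unset Strict Implicit.
Unset Printing Implicit Defensive.

Import GRing.Theory.
Local Open Scope ring_scope.

(** * Modules over a ring

   Submodules are boolean predicates [S : {pred U}] with [submod_closed S];
   classically these are all the submodules. *)

Section Modules.
Variable R : pzRingType.
Implicit Types (U V W X Y Z M P E N : lmodType R).

Definition surj U V (f : {linear U -> V}) : Prop := forall y, exists x, f x = y.

Definition exact_at U V W (f : {linear U -> V}) (g : {linear V -> W}) : Prop :=
  forall y, g y = 0 <-> exists x, f x = y.

Definition isomorphic U V : Prop := exists f : {linear U -> V}, bijective f.

Definition trivial_module U : Prop := forall x : U, x = 0.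

Definition finitely_generated U : Prop :=
  exists (m : nat) (g : 'I_m -> U),
    forall x, exists c : 'I_m -> R, x = \sum_i c i *: g i.

Definition artinian U : Prop :=
  forall S : nat -> {pred U},
    (forall i, submod_closed (S i)) -> (forall i, {subset S i.+1 <= S i}) ->
    exists n, forall m, (n <= m)%N -> S m =i S n.

Definition indecomposable U : Prop :=
  ~ trivial_module U /\
  forall X Y, isomorphic U (X * Y)%type -> trivial_module X \/ trivial_module Y.

(* [M] is the direct sum of the [Mi i], presented as a biproduct. *)
Definition direct_sum t M (Mi : 'I_t -> lmodType R) : Prop :=
  exists (inj : forall i, {linear Mi i -> M}) (prj : forall i, {linear M -> Mi i}),
    [/\ forall i x, prj i (inj i x) = x,
        forall i j x, i != j -> prj j (inj i x) = 0
      & forall x, x = \sum_i inj i (prj i x)].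

Definition basic_decomposition t M (Mi : 'I_t -> lmodType R) : Prop :=
  [/\ direct_sum M Mi, forall i, indecomposable (Mi i)
    & forall i j, isomorphic (Mi i) (Mi j) -> i = j].

Definition basic M : Prop :=
  exists (t : nat) (Mi : 'I_t -> lmodType R), basic_decomposition M Mi.

Definition in_add M X : Prop :=
  exists (m : nat) Y, isomorphic (X * Y)%type {ffun 'I_m -> M}.

Definition maximal_submodule U (S : {pred U}) : Prop :=
  [/\ submod_closed S, exists x, x \notin S
    & forall T : {pred U}, submod_closed T -> {subset S <= T} ->
        T =i S \/ forall x, x \in T].

Definition in_radical U (x : U) : Prop :=
  forall S : {pred U}, maximal_submodule S -> x \in S.

(* [N] is (isomorphic to) the top [U / rad U] of [U]. *)
Definition is_top U N : Prop :=
  exists2 p : {linear U -> N}, surj p & forall x, p x = 0 <-> in_radical x.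

(* Projectivity and injectivity are taken in the category of finitely generated
   modules. *)
Definition projective P : Prop :=
  finitely_generated P /\
  forall X Y (g : {linear X -> Y}) (f : {linear P -> Y}),
    finitely_generated X -> finitely_generated Y -> surj g ->
    exists h : {linear P -> X}, forall x, g (h x) = f x.

Definition injective_module E : Prop :=
  finitely_generated E /\
  forall X Y (g : {linear X -> Y}) (f : {linear X -> E}),
    finitely_generated X -> finitely_generated Y -> injective g ->
    exists h : {linear Y -> E}, forall x, h (g x) = f x.

Definition projective_cover P X (e : {linear P -> X}) : Prop :=
  [/\ projective P, surj e
    & forall S : {pred P}, submod_closed S ->
        (forall x, exists u v, [/\ u \in S, e v = 0 & x = u + v]) ->
        forall x, x \in S].

Definition injective_envelope X E (m : {linear X -> E}) : Prop :=
  [/\ injective_module E, injective m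
    & forall S : {pred E}, submod_closed S ->
        (forall x, m x \in S -> x = 0) -> forall y, y \in S -> y = 0].

Definition is_syzygy X Y : Prop :=
  exists P (e : {linear P -> X}) (m : {linear Y -> P}),
    [/\ projective_cover e, injective m & exact_at m e].

Definition is_cosyzygy X Y : Prop :=
  exists E (m : {linear X -> E}) (p : {linear E -> Y}),
    [/\ injective_envelope m, surj p & exact_at m p].

(* [iterated Om m X Y]: [Y] is an [m]-th iterate of the operation [Om] at [X],
   operations on modules being given as relations. *)
Fixpoint iterated (Om : lmodType R -> lmodType R -> Prop) (m : nat) X Y : Prop :=
  if m is m'.+1 then exists2 Z, Om X Z & iterated Om m' Z Y else isomorphic X Y.

Definition projective_resolution X (P : nat -> lmodType R)
    (d : forall i, {linear P i.+1 -> P i}) (e : {linear P 0%N -> X}) : Prop :=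
  [/\ forall i, projective (P i), surj e, exact_at (d 0%N) e
    & forall i, exact_at (d i.+1) (d i)].

(* [Ext^i(X, Y) = 0]: the complex [Hom(P, Y)] is exact in degree [i] for any
   projective resolution [P] of [X]. *)
Definition Ext_zero (i : nat) X Y : Prop :=
  if i is j.+1 then
    forall (P : nat -> lmodType R) (d : forall i, {linear P i.+1 -> P i})
           (e : {linear P 0%N -> X}),
      projective_resolution d e ->
      forall f : {linear P j.+1 -> Y}, (forall x, f (d j.+1 x) = 0) ->
      exists g : {linear P j -> Y}, forall x, f x = g (d j x)
  else forall (f : {linear X -> Y}) x, f x = 0.

Definition contravariantly_finite (C : lmodType R -> Prop) : Prop :=
  forall X, finitely_generated X ->
  exists Z (f : {linear Z -> X}), C Z /\
    forall Z' (g : {linear Z' -> X}), C Z' ->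
    exists h : {linear Z' -> Z}, forall x, f (h x) = g x.

Definition covariantly_finite (C : lmodType R -> Prop) : Prop :=
  forall X, finitely_generated X ->
  exists Z (f : {linear X -> Z}), C Z /\
    forall Z' (g : {linear X -> Z'}), C Z' ->
    exists h : {linear Z -> Z'}, forall x, h (f x) = g x.

Definition functorially_finite (C : lmodType R -> Prop) : Prop :=
  contravariantly_finite C /\ covariantly_finite C.

(** ** Gorenstein projective dimension *)

(* An exact complex [... -> P (i + 1) -> P i -> ...] of finitely generated
   projectives, indexed by all integers, which stays exact under [Hom(-, R)]. *)
Definition totally_acyclic (P : int -> lmodType R)
    (d : forall i, {linear P (i + 1) -> P i}) : Prop :=
  [/\ forall i, projective (P i),
      forall i, exact_at (d (i + 1)) (d i)
    & forall i (f : {linear P (i + 1) -> R^o}),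
        (forall x, f (d (i + 1) x) = 0) ->
        exists g : {linear P i -> R^o}, forall x, f x = g (d i x)].

Definition gorenstein_projective N : Prop :=
  exists (P : int -> lmodType R) (d : forall i, {linear P (i + 1) -> P i})
         (i : int) (m : {linear N -> P i}),
    [/\ totally_acyclic d, injective m
      & forall y, (exists x, m x = y) <-> (exists x, d i x = y)].

(* [N] has a resolution [0 -> G l -> ... -> G 0 -> N -> 0] by Gorenstein
   projective modules. *)
Definition gproj_resolution N (l : nat) : Prop :=
  exists (G : nat -> lmodType R) (d : forall i, {linear G i.+1 -> G i})
         (e : {linear G 0%N -> N}),
    [/\ forall i, gorenstein_projective (G i),
        forall i, (l < i)%N -> trivial_module (G i),
        surj e, exact_at (d 0%N) e
      & forall i, exact_at (d i.+1) (d i)].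

Definition Gpd_le N (m : nat) : Prop :=
  exists2 l, (l <= m)%N & gproj_resolution N l.

Definition Gpd_eq N (m : nat) : Prop :=
  gproj_resolution N m /\ forall l, gproj_resolution N l -> (m <= l)%N.

End Modules.

(** * Groups of homomorphisms *)

Section Hom.
Variables (R : pzRingType) (U V : lmodType R).

Definition lhom : Type := {linear U -> V}.

HB.instance Definition _ := gen_eqMixin lhom.
HB.instance Definition _ := gen_choiceMixin lhom.

Lemma lhomP (f g : lhom) : (forall x, f x = g x) -> f = g.
Proof.
case: f g => [f [[fD] [fZ]]] [g [[gD] [gZ]]] /= /funext fg; subst g.
by rewrite (Prop_irrelevance fD gD) (Prop_irrelevance fZ gZ).
Qed.

Let lhom0 : lhom := (\0 : U -> V).
Let lhomN (f : lhom) : lhom := \- f.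
Let lhomD (f g : lhom) : lhom := f \+ g.

Fact lhom_addA : associative lhomD.
Proof. by move=> f g h; apply: lhomP => x /=; rewrite addrA. Qed.
Fact lhom_addC : commutative lhomD.
Proof. by move=> f g; apply: lhomP => x /=; rewrite addrC. Qed.
Fact lhom_add0 : left_id lhom0 lhomD.
Proof. by move=> f; apply: lhomP => x /=; rewrite add0r. Qed.
Fact lhom_addN : left_inverse lhom0 lhomN lhomD.
Proof. by move=> f; apply: lhomP => x /=; rewrite addNr. Qed.

HB.instance Definition _ :=
  GRing.isZmodule.Build lhom lhom_addA lhom_addC lhom_add0 lhom_addN.

Lemma lhom_addE (f g : lhom) x : (f + g) x = f x + g x. Proof. by []. Qed.

End Hom.

(** ** The endomorphism ring, and [Hom(M, X)] as a left module over its opposite *)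

Section Endomorphisms.
Variables (R : pzRingType) (M : lmodType R).

Definition endo : Type := lhom M M.
HB.instance Definition _ := GRing.Zmodule.on endo.

Let endo1 : endo := (idfun : M -> M).
Let endoM (f g : endo) : endo := (f : {linear M -> M}) \o g.

Fact endo_mulA : associative endoM.
Proof. by move=> f g h; apply: lhomP. Qed.
Fact endo_mul1l : left_id endo1 endoM.
Proof. by move=> f; apply: lhomP. Qed.
Fact endo_mul1r : right_id endo1 endoM.
Proof. by move=> f; apply: lhomP. Qed.
Fact endo_mulDl : left_distributive endoM +%R.
Proof. by move=> f g h; apply: lhomP. Qed.
Fact endo_mulDr : right_distributive endoM +%R.
Proof. by move=> f g h; apply: lhomP => x /=; rewrite linearD. Qed.

HB.instance Definition _ := GRing.Zmodule_isPzRing.Build endo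
  endo_mulA endo_mul1l endo_mul1r endo_mulDl endo_mulDr.

Lemma endo_mulE (f g : endo) x : (f * g) x = f (g x). Proof. by []. Qed.

Variable X : lmodType R.

Let precomp (f : endo^c) (h : lhom M X) : lhom M X :=
  (h : {linear M -> X}) \o (f : {linear M -> M}).

Fact precompA f g h : precomp f (precomp g h) = precomp (f * g) h.
Proof. by apply: lhomP. Qed.
Fact precomp1 : left_id 1 precomp.
Proof. by move=> h; apply: lhomP. Qed.
Fact precompDr : right_distributive precomp +%R.
Proof. by move=> f g h; apply: lhomP. Qed.
Fact precompDl h : {morph precomp^~ h : f g / f + g}.
Proof. by move=> f g; apply: lhomP => x /=; rewrite linearD. Qed.

HB.instance Definition _ := GRing.Zmodule_isLmodule.Build endo^c (lhom M X)
  precompA precomp1 precompDr precompDl.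

Lemma lhom_scaleE (f : endo^c) (h : lhom M X) x : (f *: h) x = h ((f : endo) x).
Proof. by []. Qed.

End Endomorphisms.

(** * Auslander-Reiten translations over an Artin algebra *)

(* Restriction of scalars along [phi]. *)
Definition restr (R S : pzRingType) (phi : {rmorphism R -> S})
  (M : lmodType S) : Type := M.

Section Restriction.
Variables (R S : pzRingType) (phi : {rmorphism R -> S}) (M : lmodType S).
Local Notation restr := (restr phi M).

HB.instance Definition _ := GRing.Zmodule.on restr.

Let rscale (a : R) (x : restr) : restr := phi a *: (x : M).

Fact rscaleA a b x : rscale a (rscale b x) = rscale (a * b) x.
Proof. by rewrite /rscale scalerA rmorphM. Qed.
Fact rscale1 : left_id 1 rscale.
Proof. by move=> x; rewrite /rscale rmorph1 scale1r. Qed.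
Fact rscaleDr : right_distributive rscale +%R.
Proof. by move=> a x y; rewrite /rscale scalerDr. Qed.
Fact rscaleDl x : {morph rscale^~ x : a b / a + b}.
Proof. by move=> a b; rewrite /rscale rmorphD scalerDl. Qed.

HB.instance Definition _ := GRing.Zmodule_isLmodule.Build R restr
  rscaleA rscale1 rscaleDr rscaleDl.

Lemma restr_scaleE a (x : restr) : a *: x = phi a *: (x : M). Proof. by []. Qed.

End Restriction.

Section ConverseAlgebra.
Variables (k : comNzRingType) (B : algType k).

HB.instance Definition _ := GRing.Lmodule.copy B^c B.

Fact conv_scaleAl (a : k) (u v : B^c) :
  a *: (u * v : B^c) = (a *: u : B^c) * v :> B^c.
Proof. exact: (@scalerAr _ B a v u). Qed.
HB.instance Definition _ :=
  GRing.LSemiModule_isLSemiAlgebra.Build k B^c conv_scaleAl.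

Fact conv_scaleAr (a : k) (u v : B^c) :
  a *: (u * v : B^c) = u * (a *: v : B^c) :> B^c.
Proof. exact: (@scalerAl _ B a v u). Qed.
HB.instance Definition _ :=
  GRing.LSemiAlgebra_isSemiAlgebra.Build k B^c conv_scaleAr.

(* The identity [B -> (B^op)^op]; restricting along it turns modules over
   [B^c^c] into modules over [B]. *)
Definition conv2 (b : B) : B^c^c := b.

Fact conv2_zmod : zmod_morphism conv2. Proof. by []. Qed.
Fact conv2_monoid : monoid_morphism conv2. Proof. by []. Qed.
HB.instance Definition _ := GRing.isZmodMorphism.Build B B^c^c conv2 conv2_zmod.
HB.instance Definition _ :=
  GRing.isMonoidMorphism.Build B B^c^c conv2 conv2_monoid.

End ConverseAlgebra.

(* [Hom_B(P, B)] as a right [B]-module, right modules being left modules over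
   the converse ring [B^c]. *)
Section RegularDual.
Variables (B : pzRingType) (P : lmodType B).

Definition rdual : Type := lhom P B^o.
HB.instance Definition _ := GRing.Zmodule.on rdual.

Section Scale.
Variables (b : B^c) (f : rdual).
Definition rdual_fun (x : P) : B^o := (f x : B) * (b : B).
Fact rdual_fun_linear : linear rdual_fun.
Proof.
by move=> a x y; rewrite /rdual_fun linearP mulrDl /GRing.scale /= mulrA.
Qed.
HB.instance Definition _ := GRing.isLinear.Build B P B^o *:%R rdual_fun
  rdual_fun_linear.
Definition rdual_scale : rdual := rdual_fun.
End Scale.

Fact rdual_scaleA a b f : rdual_scale a (rdual_scale b f) = rdual_scale (a * b) f.
Proof. by apply: lhomP => x; rewrite /= /rdual_fun /= -mulrA. Qed.
Fact rdual_scale1 : left_id 1 rdual_scale.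
Proof. by move=> f; apply: lhomP => x; rewrite /= /rdual_fun mulr1. Qed.
Fact rdual_scaleDr : right_distributive rdual_scale +%R.
Proof. by move=> a f g; apply: lhomP => x; rewrite /= /rdual_fun mulrDl. Qed.
Fact rdual_scaleDl f : {morph rdual_scale^~ f : a b / a + b}.
Proof. by move=> a b; apply: lhomP => x; rewrite /= /rdual_fun mulrDr. Qed.

HB.instance Definition _ := GRing.Zmodule_isLmodule.Build B^c rdual
  rdual_scaleA rdual_scale1 rdual_scaleDr rdual_scaleDl.

Lemma rdual_scaleE (b : B^c) (f : rdual) x : (b *: f) x = (f x : B) * (b : B).
Proof. by []. Qed.

End RegularDual.

(* [Hom_k(N, J)], for a left [B]-module [N], as a right [B]-module. *)
Section BaseDual.
Variables (k : comNzRingType) (B : algType k) (J : lmodType k) (N : lmodType B).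

Definition kdual : Type := lhom (restr (in_alg B) N) J.
HB.instance Definition _ := GRing.Zmodule.on kdual.

Section Scale.
Variables (b : B^c) (f : kdual).
Definition kdual_fun (x : restr (in_alg B) N) : J := f ((b : B) *: (x : N)).
Fact kdual_fun_linear : linear kdual_fun.
Proof.
move=> a x y; rewrite /kdual_fun -linearP; congr (f _).
by rewrite scalerDr !restr_scaleE !scalerA /= -scalerAl -scalerAr mul1r mulr1.
Qed.
HB.instance Definition _ := GRing.isLinear.Build k (restr (in_alg B) N) J *:%R
  kdual_fun kdual_fun_linear.
Definition kdual_scale : kdual := kdual_fun.
End Scale.

Fact kdual_scaleA a b f : kdual_scale a (kdual_scale b f) = kdual_scale (a * b) f.
Proof. by apply: lhomP => x; rewrite /= /kdual_fun /= /kdual_fun scalerA. Qed.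
Fact kdual_scale1 : left_id 1 kdual_scale.
Proof. by move=> f; apply: lhomP => x; rewrite /= /kdual_fun scale1r. Qed.
Fact kdual_scaleDr : right_distributive kdual_scale +%R.
Proof. by move=> a f g; apply: lhomP. Qed.
Fact kdual_scaleDl f : {morph kdual_scale^~ f : a b / a + b}.
Proof.
by move=> a b; apply: lhomP => x; rewrite /= /kdual_fun scalerDl linearD.
Qed.

HB.instance Definition _ := GRing.Zmodule_isLmodule.Build B^c kdual
  kdual_scaleA kdual_scale1 kdual_scaleDr kdual_scaleDl.

Lemma kdual_scaleE (b : B^c) (f : kdual) (x : N) :
  (b *: f) x = f ((b : B) *: x).
Proof. by []. Qed.

End BaseDual.

Definition minimal_presentation (B : pzRingType) (X P1 P0 : lmodType B)
    (d : {linear P1 -> P0}) (e : {linear P0 -> X}) : Prop :=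
  projective_cover e /\
  exists (K : lmodType B) (c : {linear P1 -> K}) (m : {linear K -> P0}),
    [/\ projective_cover c, injective m, exact_at m e
      & forall x, d x = m (c x)].

(* [T = Tr X]: the cokernel of [Hom(P0, B) -> Hom(P1, B)] for a minimal
   projective presentation [P1 -> P0 -> X -> 0]. *)
Definition is_transpose (B : pzRingType) (X : lmodType B) (T : lmodType B^c) : Prop :=
  exists (P1 P0 : lmodType B) (d : {linear P1 -> P0}) (e : {linear P0 -> X})
         (p : {linear rdual P1 -> T}),
    [/\ minimal_presentation d e, surj p
      & forall f : rdual P1,
          p f = 0 <-> exists g : rdual P0, forall x, f x = g (d x)].

(* [J] is the injective envelope of [k / rad k], so that [Hom_k(-, J)] is the
   duality [D] of any Artin [k]-algebra. *)
Definition is_dualizing (k : comNzRingType) (J : lmodType k) : Prop :=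
  exists (S : lmodType k) (m : {linear S -> J}),
    is_top (k^o : lmodType k) S /\ injective_envelope m.

Section ArtinAlgebra.
Variables (k : comNzRingType) (A : algType k).
Implicit Types X Y Z : lmodType A.

Definition artin_algebra : Prop :=
  artinian (k^o : lmodType k) /\ finitely_generated (A : lmodType k).

Definition basic_algebra : Prop := basic (A^o : lmodType A).

(* [tau = D Tr] *)
Definition is_tau X Y : Prop :=
  exists (J : lmodType k) (T : lmodType A^c),
    [/\ is_dualizing J, is_transpose X T
      & isomorphic Y (restr (@conv2 k A) (kdual J T))].

(* [tau^- = Tr D] *)
Definition is_tau_inv X Y : Prop :=
  exists (J : lmodType k) (T : lmodType A^c^c),
    [/\ is_dualizing J, is_transpose (kdual J X) T
      & isomorphic Y (restr (@conv2 k A) T)].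

Definition is_taun (n : nat) X Y : Prop :=
  exists2 Z, iterated (@is_syzygy A) n.-1 X Z & is_tau Z Y.

Definition is_taun_inv (n : nat) X Y : Prop :=
  exists2 Z, iterated (@is_cosyzygy A) n.-1 X Z & is_tau_inv Z Y.

(* The translates are taken at their representatives without projective,
   respectively injective, summands coming from non-minimal choices; this is
   immaterial since [C] contains all projectives and injectives. *)
Definition precluster_tilting (n : nat) (C : lmodType A -> Prop) : Prop :=
  (forall X, C X -> finitely_generated X) /\
  [/\ (forall X, projective X -> C X) /\ (forall X, injective_module X -> C X),
      (forall X Y, C X -> is_taun n X Y -> C Y) /\
      (forall X Y, C X -> is_taun_inv n X Y -> C Y),
      forall i X Y, (0 < i < n)%N -> C X -> C Y -> Ext_zero i X Y
    & functorially_finite C].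

End ArtinAlgebra.

(* Main.v *)
Require Import Defs.
From HB Require Import structures.
From mathcomp Require Import all_boot all_algebra.
From mathcomp Require Import generic_quotient ring_quotient boolp.
From mathcomp Require classical_sets.

(* Put F = Hom_A(M, -) and let D be the duality of A.  An A-module K with
   Ext^j(M, K) = Ext^j(K, M) = 0 for 0 < j < n has an add M-resolution and an
   add M-coresolution, both exact under Hom(M, -) and Hom(-, M); their splice is
   sent by F to a totally acyclic complex, so F K is Gorenstein projective.  The
   (n-1)-st syzygy of any module X in an add M-resolution is such a K, hence
   Gpd (F X) <= n - 1.  Exactness is exchanged between Hom(-, M) and Hom(M, -) by
   one Auslander-Reiten argument: if every map X' -> tau_n M extends along
   X' -> X then every map Omega^(n-1) M -> X/X' lifts to X; it is used for M over
   A, and for D M over the opposite algebra, where tau_n (D M) = D (tau_n^- M).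

   Since End(M_i) is local, rad (F M_i) consists of the maps M -> M_i which are
   not split epimorphisms, and these are the maps factoring through some
   r : M^m -> M_i.  If M_i is projective then rad (F M_i) = F (im r).  Otherwise r
   is onto, and with K = ker r there is an exact sequence
   0 -> F K -> F M^m -> F M_i -> S_i -> 0.  If then Gpd S_i <= n, we would get
   Ext^(n+1)(S_i, Lambda) = 0, and the Auslander-Reiten argument would turn this
   into a splitting of r over M_i. *)

Set Implicit Arguments.
Unset Strict Implicit.
Unset Printing Implicit Defensive.

Import GRing.Theory.
Local Open Scope ring_scope.

(** * Linear maps, submodules and quotients *)

(** Closure under the translates is assumed for modules related by [is_taun], which asks for a
    dualizing module, minimal syzygies and a minimal presentation. It yields nothing until such data
    are exhibited, so projective covers, minimal resolutions and the injective envelope of the top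
    of [k] are constructed. Their existence rests on finite length, deduced for [k] from the
    descending chain condition.

    Ext groups never appear. Minimal resolutions of [M] and of [D M] are fixed; Ext^(j+1)(M, X) = 0
    becomes the extension of maps along the inclusion of the (j+1)-st syzygy, and Ext^(j+1)(X, M) =
    0 is read over the opposite algebra as Ext^(j+1)(D M, D X) = 0. The first argument is then fixed
    in both conditions, so the same lemmas on short exact sequences serve both sides. The bound n -
    1 is a count: each condition has n - 1 degrees, and every M-syzygy gains one degree in both. In
    the first condition this is dimension shifting; in the second the new top degree comes from the
    translates. *)

Section LinearMaps.
Variables (R : pzRingType) (U V : lmodType R) (f : U -> V).
Hypothesis f_lin : linear f.
Definition mklin : {linear U -> V} :=
  HB.pack f (GRing.isLinear.Build R U V *:%R f f_lin).
End LinearMaps.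

Section QuotientModule.
Variables (R : pzRingType) (U : lmodType R) (S : {pred U}).
Hypothesis S_submod : submod_closed S.

Let zS : zmodClosed U :=
  HB.pack S (GRing.isZmodClosed.Build U S (GRing.submod_closedB S_submod)).

Definition qmod : Type := Quotient.quot zS.
HB.instance Definition _ := GRing.Zmodule.on qmod.

Let pi (x : U) : qmod := (\pi_(Quotient.quot zS) x)%qT.

Let piP x y : pi x = pi y <-> x - y \in S.
Proof.
by rewrite -[x - y \in S]/(x - y \in zS) (Quotient.idealrBE zS x y); split=> /eqP.
Qed.

Let piD x y : pi (x + y) = pi x + pi y.
Proof. by rewrite /pi raddfD. Qed.

Let rpiK u : pi (repr (u : Quotient.quot zS)) = u.
Proof. exact: (@reprK _ (Quotient.quot zS)). Qed.

Let S_scale a x : x \in S -> a *: x \in S.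
Proof. by case: S_submod => S0 Sl xS; rewrite -[a *: x]addr0 Sl. Qed.

Let qscale (a : R) (u : qmod) : qmod := pi (a *: repr (u : Quotient.quot zS)).

Let piZ a x : qscale a (pi x) = pi (a *: x).
Proof. by apply/piP; rewrite -scalerBr; apply/S_scale/piP; rewrite rpiK. Qed.

Fact qscaleA a b u : qscale a (qscale b u) = qscale (a * b) u.
Proof. by rewrite -[u]rpiK !piZ scalerA. Qed.
Fact qscale1 : left_id 1 qscale.
Proof. by move=> u; rewrite -[u]rpiK !piZ scale1r. Qed.
Fact qscaleDr : right_distributive qscale +%R.
Proof. by move=> a u v; rewrite -[u]rpiK -[v]rpiK -piD !piZ scalerDr piD. Qed.
Fact qscaleDl u : {morph qscale^~ u : a b / a + b}.
Proof. by move=> a b; rewrite -[u]rpiK !piZ scalerDl piD. Qed.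

HB.instance Definition _ := GRing.Zmodule_isLmodule.Build R qmod
  qscaleA qscale1 qscaleDr qscaleDl.

Let pi_lin : linear pi.
Proof. by move=> a x y; rewrite piD -piZ. Qed.

Lemma qmodP : exists p : {linear U -> qmod},
  surj p /\ forall x, p x = 0 <-> x \in S.
Proof.
exists (mklin pi_lin); split=> [u|x]; first by exists (repr (u : Quotient.quot zS)).
have <- : pi 0 = 0 by exact: raddf0.
by rewrite piP subr0.
Qed.

End QuotientModule.

Section Submodule.
Variables (R : pzRingType) (U : lmodType R) (S : {pred U}).
Hypothesis S_submod : submod_closed S.

Let mS : submodClosed U :=
  HB.pack S (GRing.isSubmodClosed.Build R U S S_submod).

Definition smod : Type := {x : U | x \in mS}.
HB.instance Definition _ := SubChoice.on smod.
HB.instance Definition _ := [SubChoice_isSubLmodule of smod by <:].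

Lemma smodP : exists m : {linear smod -> U},
  injective m /\ forall x, x \in S <-> exists y, m y = x.
Proof.
exists (val : {linear smod -> U}); split=> [|x]; first exact: val_inj.
split=> [xS|[y <-]]; last exact: (valP y).
by exists (Sub x (xS : x \in mS)).
Qed.

End Submodule.

Section Factor.
Variable R : pzRingType.
Implicit Types (U V W X Y Z : lmodType R).

(** The [Prop]-valued counterpart of [submod_closed]: kernels, images and existential conditions are
    submodules in this form directly, and classical reflection converts between the two. *)
Definition submod_prop U (P : U -> Prop) : Prop :=
  P 0 /\ forall a x y, P x -> P y -> P (a *: x + y).

Lemma submod_prop_closed U (P : U -> Prop) : submod_prop P ->
  submod_closed [pred x | `[< P x >]].
Proof.
case=> P0 Pl; split=> [|a x y]; first by rewrite inE; apply/asboolP.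
by rewrite !inE => /asboolP Px /asboolP Py; apply/asboolP/Pl.
Qed.

Lemma closed_submod_prop U (S : {pred U}) : submod_closed S ->
  submod_prop (fun x => x \in S).
Proof. by case=> S0 Sl; split=> // a x y xS yS; apply: Sl. Qed.

Lemma exists_sub U (P : U -> Prop) : submod_prop P ->
  exists (K : lmodType R) (m : {linear K -> U}),
    injective m /\ forall x, P x <-> exists y, m y = x.
Proof.
move=> Pm; have [m [mi mP]] := smodP (submod_prop_closed Pm).
exists (smod (submod_prop_closed Pm)), m; split=> // x.
by rewrite -mP inE; split=> /asboolP.
Qed.

Lemma exists_quo U (P : U -> Prop) : submod_prop P ->
  exists (Q : lmodType R) (p : {linear U -> Q}),
    surj p /\ forall x, p x = 0 <-> P x.
Proof.
move=> Pm; have [p [ps pP]] := qmodP (submod_prop_closed Pm).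
exists (qmod (submod_prop_closed Pm)), p; split=> // x.
by rewrite pP inE; split=> /asboolP.
Qed.

Lemma ker_submod U V (f : {linear U -> V}) : submod_prop (fun x => f x = 0).
Proof.
by split=> [|a x y fx fy]; rewrite ?linear0 // linearP fx fy scaler0 addr0.
Qed.

Lemma im_submod U V (f : {linear U -> V}) :
  submod_prop (fun y => exists x, f x = y).
Proof.
split=> [|a _ _ [x <-] [y <-]]; first by exists 0; rewrite linear0.
by exists (a *: x + y); rewrite linearP.
Qed.

Lemma preim_submod U V (f : {linear U -> V}) (P : V -> Prop) :
  submod_prop P -> submod_prop (fun x => P (f x)).
Proof.
by case=> P0 Pl; split=> [|a x y]; rewrite ?linear0 // linearP; apply: Pl.
Qed.

Lemma image_submod U V (f : {linear U -> V}) (P : U -> Prop) :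
  submod_prop P -> submod_prop (fun y => exists2 x, P x & f x = y).
Proof.
case=> P0 Pl; split=> [|a _ _ [x Px <-] [y Py <-]].
  by exists 0; rewrite ?linear0.
by exists (a *: x + y); rewrite ?linearP //; apply: Pl.
Qed.

Section SubmodTheory.
Variables (U : lmodType R) (P : U -> Prop).
Hypothesis Pm : submod_prop P.
Lemma submod0 : P 0. Proof. by case: Pm. Qed.
Lemma submodZ a x : P x -> P (a *: x).
Proof. by move=> Px; rewrite -[_ *: _]addr0; apply: Pm.2 => //; apply: submod0. Qed.
Lemma submodD x y : P x -> P y -> P (x + y).
Proof. by move=> Px Py; rewrite -[x]scale1r; apply: Pm.2. Qed.
Lemma submodN x : P x -> P (- x).
Proof. by move=> Px; rewrite -scaleN1r; apply: submodZ. Qed.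
Lemma submodB x y : P x -> P y -> P (x - y).
Proof. by move=> Px Py; apply: submodD => //; apply: submodN. Qed.
Lemma submod_sum I (r : seq I) (Q : pred I) (F : I -> U) :
  (forall i, Q i -> P (F i)) -> P (\sum_(i <- r | Q i) F i).
Proof. by move=> PF; elim/big_ind: _ => //; [exact: submod0|exact: submodD]. Qed.
End SubmodTheory.

Lemma inj_ker U V (f : {linear U -> V}) :
  (forall x, f x = 0 -> x = 0) -> injective f.
Proof.
move=> f0 x y fxy; apply/eqP; rewrite -subr_eq0; apply/eqP/f0.
by rewrite linearB fxy subrr.
Qed.

Lemma inj0 U V (f : {linear U -> V}) x : injective f -> f x = 0 -> x = 0.
Proof. by move=> fi fx; apply: fi; rewrite linear0. Qed.

Lemma factor_inj U V X (m : {linear U -> V}) (f : {linear X -> V}) :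
  injective m -> (forall x, exists y, m y = f x) ->
  exists g : {linear X -> U}, forall x, m (g x) = f x.
Proof.
move=> mi /choice[g gP].
have gl : linear g by move=> a x y; apply: mi; rewrite linearP !gP linearP.
by exists (mklin gl).
Qed.

Lemma factor_surj U V X (e : {linear U -> V}) (f : {linear U -> X}) :
  surj e -> (forall x, e x = 0 -> f x = 0) ->
  exists g : {linear V -> X}, forall x, g (e x) = f x.
Proof.
move=> /choice[s sP] ef.
have fs x : f (s (e x)) = f x.
  apply/eqP; rewrite -subr_eq0 -linearB; apply/eqP/ef.
  by rewrite linearB sP subrr.
have gl : linear (fun v => f (s v)).
  by move=> a x y; rewrite -{1}[x]sP -{1}[y]sP -linearP fs linearP.
by exists (mklin gl).
Qed.

Lemma bij_inverse U V (f : {linear U -> V}) : injective f -> surj f ->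
  exists2 g : {linear V -> U}, cancel f g & cancel g f.
Proof.
move=> fi fs; have [g gP] := @factor_surj _ _ _ f idfun fs (fun x => inj0 fi).
exists g => // y; have [x <-] := fs y.
by rewrite gP.
Qed.

Lemma bij_isomorphic U V (f : {linear U -> V}) :
  injective f -> surj f -> isomorphic U V.
Proof.
by move=> fi /(bij_inverse fi)[g fg gf]; exists f; exists g.
Qed.

Lemma isomorphic_inverse U V : isomorphic U V ->
  exists (f : {linear U -> V}) (g : {linear V -> U}), cancel f g /\ cancel g f.
Proof.
case=> f [g fg gf]; have [|y|h fh hf] := @bij_inverse _ _ f.
- exact: can_inj fg.
- by exists (g y).
by exists f, h.
Qed.

Lemma isomorphic_refl U : isomorphic U U.
Proof. by exists idfun; exists idfun. Qed.

Lemma isomorphic_sym U V : isomorphic U V -> isomorphic V U.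
Proof. by case/isomorphic_inverse=> f [g [fg gf]]; exists g; exists f. Qed.

(** * Short exact sequences *)

Definition ses X Y Z (i : {linear X -> Y}) (p : {linear Y -> Z}) : Prop :=
  [/\ injective i, exact_at i p & surj p].

Section SesTheory.
Variables (X Y Z : lmodType R) (i : {linear X -> Y}) (p : {linear Y -> Z}).
Hypothesis ip : ses i p.

Lemma ses_inj : injective i. Proof. by case: ip. Qed.
Lemma ses_surj : surj p. Proof. by case: ip. Qed.
Lemma ses_comp0 x : p (i x) = 0.
Proof. by case: ip => _ ex _; apply/ex; exists x. Qed.
Lemma ses_ex y : p y = 0 -> exists x, i x = y.
Proof. by case: ip => _ ex _ /ex. Qed.

Lemma ses_factor W (f : {linear W -> Y}) : (forall w, p (f w) = 0) ->
  exists g : {linear W -> X}, forall w, i (g w) = f w.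
Proof. by move=> pf; apply: factor_inj; [exact: ses_inj | move=> w; apply: ses_ex]. Qed.

Lemma ses_cofactor W (f : {linear Y -> W}) : (forall x, f (i x) = 0) ->
  exists g : {linear Z -> W}, forall y, g (p y) = f y.
Proof.
move=> fi; apply: factor_surj; first exact: ses_surj.
by move=> y /ses_ex[x <-].
Qed.
End SesTheory.

Lemma exists_ker Y Z (p : {linear Y -> Z}) : surj p ->
  exists X (i : {linear X -> Y}), ses i p.
Proof.
move=> ps; have [X [i [ii iP]]] := exists_sub (ker_submod p).
by exists X, i; split.
Qed.

Lemma exists_coker X Y (i : {linear X -> Y}) : injective i ->
  exists Z (p : {linear Y -> Z}), ses i p.
Proof.
move=> ii; have [Z [p [ps pP]]] := exists_quo (im_submod i).
by exists Z, p; split.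
Qed.

Lemma exists_image X Y (f : {linear X -> Y}) :
  exists Z (e : {linear X -> Z}) (m : {linear Z -> Y}),
    [/\ surj e, injective m & forall x, m (e x) = f x].
Proof.
have [Z [m [mi mP]]] := exists_sub (im_submod f).
have [e eP] : exists e : {linear X -> Z}, forall x, m (e x) = f x.
  by apply: factor_inj => // x; apply/mP; exists x.
exists Z, e, m; split=> // z.
by have /mP[x xz] : exists y, m y = m z by [exists z]; exists x; apply: mi; rewrite eP.
Qed.

(** * Finite generation *)

Section Span.
Variables (U : lmodType R) (m : nat) (g : 'I_m -> U).
Definition lincomb (c : {ffun 'I_m -> R^o}) : U := \sum_i (c i : R) *: g i.
Fact lincomb_linear : linear lincomb.
Proof.
move=> a x y; rewrite /lincomb scaler_sumr -big_split /=; apply: eq_bigr => i _.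
by rewrite !ffunE scalerDl scalerA.
Qed.
HB.instance Definition _ := GRing.isLinear.Build R {ffun 'I_m -> R^o} U *:%R lincomb
  lincomb_linear.
End Span.

Definition lspan U m (g : 'I_m -> U) (x : U) : Prop :=
  exists c : 'I_m -> R, x = \sum_i c i *: g i.

Lemma lspanP U m (g : 'I_m -> U) x : lspan g x <-> exists c, lincomb g c = x.
Proof.
split=> [[c ->]|[c <-]]; last by exists c.
by exists [ffun i => c i]; apply: eq_bigr => i _; rewrite ffunE.
Qed.

Lemma lspan_submod U m (g : 'I_m -> U) : submod_prop (lspan g).
Proof.
have [P0 Pl] := im_submod (lincomb g); split; first exact/lspanP.
by move=> a x y /lspanP Px /lspanP Py; apply/lspanP/Pl.
Qed.

Lemma lspan_gen U m (g : 'I_m -> U) i : lspan g (g i).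
Proof.
exists (fun j => (j == i)%:R); rewrite (bigD1 i) //= eqxx scale1r big1 ?addr0 //.
by move=> j /negPf ->; rewrite scale0r.
Qed.

Lemma fg_surj U V (f : {linear U -> V}) :
  surj f -> finitely_generated U -> finitely_generated V.
Proof.
move=> fs [m [g gP]]; exists m, (fun i => f (g i)) => y.
have [x <-] := fs y; have [c ->] := gP x; exists c.
by rewrite linear_sum; apply: eq_bigr => i _; rewrite linearZ.
Qed.

Lemma fg_free m : finitely_generated ({ffun 'I_m -> R^o} : lmodType R).
Proof.
exists m, (fun i => [ffun j => (j == i)%:R]) => x; exists x.
apply/ffunP=> j; rewrite sum_ffunE (bigD1 j) //= !ffunE eqxx.
rewrite big1 ?addr0 => [|i ij]; first by rewrite /GRing.scale /= mulr1.
by rewrite !ffunE eq_sym (negPf ij) /GRing.scale /= mulr0.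
Qed.

Lemma fg_cover U : finitely_generated U ->
  exists m (e : {linear {ffun 'I_m -> R^o} -> U}), surj e.
Proof.
move=> [m [g gP]]; exists m, (lincomb g) => x.
by have /lspanP := gP x.
Qed.

Lemma fg_ext X Y Z (i : {linear X -> Y}) (p : {linear Y -> Z}) : ses i p ->
  finitely_generated X -> finitely_generated Z -> finitely_generated Y.
Proof.
move=> ip [m [g gP]] [n [h hP]].
have [h' h'P] := choice (fun j => ses_surj ip (h j)).
pose G (k : 'I_(m + n)) := match split k with inl a => i (g a) | inr b => h' b end.
exists (m + n)%N, G => y.
have Gsum c : \sum_k c k *: G k
    = \sum_a c (lshift n a) *: i (g a) + \sum_b c (rshift m b) *: h' b.
  rewrite big_split_ord /G /=; congr (_ + _); apply: eq_bigr => k _.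
    by rewrite (unsplitK (inl k)).
  by rewrite (unsplitK (inr k)).
have [d pd] := hP (p y).
have [|x xE] := ses_ex ip (y := y - \sum_b d b *: h' b).
  rewrite linearB linear_sum pd; apply/eqP; rewrite subr_eq0; apply/eqP.
  by apply: eq_bigr => b _; rewrite linearZ h'P.
have [c cE] := gP x.
exists (fun k => match split k with inl a => c a | inr b => d b end).
rewrite Gsum -[LHS](subrK (\sum_b d b *: h' b)) -xE cE linear_sum.
congr (_ + _); apply: eq_bigr => k _.
  by rewrite (unsplitK (inl k)) linearZ.
by rewrite (unsplitK (inr k)).
Qed.

End Factor.

(** * Finite length *)

Lemma bounded_nat_attains (c : nat -> nat) b : (forall l, (c l <= b)%N) ->
  exists l, forall m, (c m <= c l)%N.
Proof.
move=> cb; pose P v := `[< exists l, c l = v >].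
have exP : exists v, P v by exists (c 0%N); apply/asboolP; exists 0%N.
have Pb v : P v -> (v <= b)%N by move=> /asboolP[l <-].
case: (ex_maxnP exP Pb) => v /asboolP[l <-] vmax; exists l => m.
by apply: vmax; apply/asboolP; exists m.
Qed.

Section FiniteLength.
Variable R : pzRingType.
Implicit Types (U V W X Y Z : lmodType R).

(* [blen b U] says that the length of [U] is at most [b]. *)
Definition blen (b : nat) U : Prop :=
  forall S : nat -> U -> Prop,
    (forall i, submod_prop (S i)) -> (forall i x, S i x -> S i.+1 x) ->
    forall l, (\sum_(i < l) `[< ~ forall x, S i.+1 x -> S i x >] <= b)%N.

Definition finlen U : Prop := exists b, blen b U.

Definition simple U : Prop :=
  ~ trivial_module U /\
  forall P : U -> Prop, submod_prop P -> (forall x, P x -> x = 0) \/ forall x, P x.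

Lemma strict0 (P Q : Prop) : (P -> Q) -> (`[< ~ Q >] <= `[< ~ P >])%N.
Proof.
by move=> PQ; case: asboolP => // nQ; rewrite asboolT // => /PQ.
Qed.

(** By the modular law, a strict step of a chain in [Y] is strict in its trace on [X] or in its
    image in [Z]. *)
Lemma blen_ext X Y Z (i : {linear X -> Y}) (p : {linear Y -> Z}) a b :
  ses i p -> blen a X -> blen b Z -> blen (a + b) Y.
Proof.
move=> ip aX bZ S Sm Si l.
apply: leq_trans (leq_add (aX (fun j x => S j (i x)) _ _ l)
   (bZ (fun j z => exists2 y, S j y & p y = z) _ _ l)).
- rewrite -big_split /=; apply: leq_sum => j _.
  case: asboolP => //= Sj; rewrite addn_gt0 !lt0b.
  have [SX|?] := pselect (forall x, S j.+1 (i x) -> S j (i x)); last first.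
    by apply/orP; left; apply/asboolP.
  have [SZ|?] := pselect (forall z, (exists2 y, S j.+1 y & p y = z) ->
      exists2 y, S j y & p y = z); last by apply/orP; right; apply/asboolP.
  exfalso.
  apply: Sj => y Sy; have [|y' Sy' yy'] := SZ (p y); first by exists y.
  have [|x xE] := ses_ex ip (y := y - y'); first by rewrite linearB yy' subrr.
  rewrite -[y](subrK y') -xE; apply: submodD => //; apply: SX.
  by rewrite xE; apply: submodB => //; apply: Si.
- by move=> j; apply: preim_submod.
- by move=> j x; apply: Si.
- by move=> j; apply: image_submod.
- by move=> j _ [y Sy <-]; exists y => //; apply: Si.
Qed.

Lemma blen_inj U V (f : {linear U -> V}) b : injective f -> blen b V -> blen b U.
Proof.
move=> fi bV S Sm Si l.
apply: leq_trans (bV (fun j y => exists2 x, S j x & f x = y) _ _ l).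
- apply: leq_sum => j _; apply: strict0 => SS x Sx.
  by have [|y Sy /fi <-] := SS (f x); first by exists x.
- by move=> j; apply: image_submod.
- by move=> j _ [y Sy <-]; exists y => //; apply: Si.
Qed.

Lemma blen_surj U V (f : {linear U -> V}) b : surj f -> blen b U -> blen b V.
Proof.
move=> fs bU S Sm Si l.
apply: leq_trans (bU (fun j x => S j (f x)) _ _ l).
- apply: leq_sum => j _; apply: strict0 => SS y Sy.
  by have [x xy] := fs y; rewrite -xy; apply: SS; rewrite xy.
- by move=> j; apply: preim_submod.
- by move=> j x; apply: Si.
Qed.

Lemma finlen_inj U V (f : {linear U -> V}) : injective f -> finlen V -> finlen U.
Proof. by move=> fi [b bV]; exists b; apply: blen_inj fi bV. Qed.

Lemma finlen_surj U V (f : {linear U -> V}) : surj f -> finlen U -> finlen V.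
Proof. by move=> fs [b bV]; exists b; apply: blen_surj fs bV. Qed.

Lemma finlen_ext X Y Z (i : {linear X -> Y}) (p : {linear Y -> Z}) :
  ses i p -> finlen X -> finlen Z -> finlen Y.
Proof. by move=> ip [a aX] [b bZ]; exists (a + b)%N; apply: blen_ext ip _ _. Qed.

Lemma blen_trivial U : trivial_module U -> blen 0 U.
Proof.
move=> U0 S Sm _ l; rewrite big1 // => i _; rewrite asboolF //.
by case=> x _; rewrite (U0 x); apply: submod0.
Qed.

Lemma blen_simple U : simple U -> blen 1 U.
Proof.
move=> [U0 Us] S Sm Si l.
(* Strengthened for the induction: as long as [S l] is zero no strict step has occurred, and once it
   is nonzero it is everything. *)
suff le : (\sum_(i < l) `[< ~ forall x, S i.+1 x -> S i x >]
           <= `[< ~ forall x, S l x -> x = 0%R >])%N.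
  by apply: leq_trans le _; case: asboolP.
elim: l => [|l IH]; first by rewrite big_ord0.
rewrite big_ord_recr /=.
have [St|nSt] := asboolP (~ forall x, S l.+1 x -> S l x).
  have Sl0 : forall x, S l x -> x = 0.
    by case: (Us _ (Sm l)) => // Sl; case: St => x _; apply: Sl.
  have SSl : ~ forall x, S l.+1 x -> x = 0.
    by move=> Sl; apply: St => x /Sl ->; apply: submod0.
  by rewrite (asboolT SSl) -[X in (_ <= X)%N]add0n leq_add2r; apply: leq_trans IH _; rewrite asboolF.
rewrite addn0; apply: leq_trans IH _; apply: strict0 => S0 x Sx.
by apply: S0; apply: Si.
Qed.

Lemma blen0_trivial U : blen 0 U -> trivial_module U.
Proof.
(* The chain is zero at index 0 and the whole module afterwards, so it has a strict step unless [U]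
   is trivial. *)
move=> b0 x; pose S (i : nat) (y : U) := i = 0%N -> y = 0.
have Sm i : submod_prop (S i).
  by split=> // a u v u0 v0 i0; rewrite u0 // v0 // scaler0 addr0.
have := b0 S Sm _ 1%N; rewrite big_ord1 leqn0 eqb0 => S01.
by have /asboolPn/contrapT/(_ x) := S01 (fun i y _ e => False_ind _ (O_S i (esym e))); apply.
Qed.

(** The images of the first terms are followed by the whole of [Y]: the guard [j <= l] makes every
    later term everything, and the step after [l] is strict because [i] is not onto. *)
Lemma chain_extend X Y (i : {linear X -> Y}) (S : nat -> X -> Prop) l :
  (forall j, submod_prop (S j)) -> (forall j x, S j x -> S j.+1 x) ->
  injective i -> ~ surj i ->
  exists S' : nat -> Y -> Prop,
    [/\ forall j, submod_prop (S' j), forall j x, S' j x -> S' j.+1 x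
      & (\sum_(j < l) `[< ~ forall x, S j.+1 x -> S j x >]
         < \sum_(j < l.+1) `[< ~ forall x, S' j.+1 x -> S' j x >])%N].
Proof.
move=> Sm Si ii ni; pose S' j y := (j <= l)%N -> exists2 x, S j x & i x = y.
exists S'; split=> [j|j y Sy jl|].
- have [T0 Tl] := image_submod i (Sm j).
  by split=> // a x y Tx Ty jl; apply: Tl; [apply: Tx|apply: Ty].
- have [|x Sx <-] := Sy; first exact: ltnW.
  by exists x => //; apply: Si.
rewrite big_ord_recr /= asboolT ?addn1 ?ltnS => [|SS].
  apply: leq_sum => j _; apply: strict0 => SS x Sx.
  have [_||x' Sx' /ii <- //] := SS (i x); last exact: ltnW.
  by exists x.
apply: ni => y; have [|//|x _ <-] := SS y; last by exists x.
by rewrite /S' ltnn.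
Qed.

Lemma blen_sub X Y Z (i : {linear X -> Y}) (p : {linear Y -> Z}) b :
  ses i p -> ~ trivial_module Z -> blen b.+1 Y -> blen b X.
Proof.
move=> ip Z0 bY S Sm Si l.
have [|S' [Sm' Si' lt]] := chain_extend l Sm Si (ses_inj ip).
  move=> iS; apply: Z0 => z; have [y <-] := ses_surj ip z; have [x <-] := iS y.
  exact: ses_comp0 ip x.
by rewrite -ltnS; apply: leq_trans lt (bY _ Sm' Si' _).
Qed.

Lemma blen_quo X Y Z (i : {linear X -> Y}) (p : {linear Y -> Z}) b :
  ses i p -> ~ trivial_module X -> blen b.+1 Y -> blen b Z.
Proof.
move=> ip X0 bY S Sm Si l.
pose S' j y := if j is j'.+1 then S j' (p y) else y = 0.
have := bY S' _ _ l.+1; rewrite big_ord_recl /= asboolT ?add1n ?ltnS => [h|SS].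
  apply: leq_trans (h _ _).
  - apply: leq_sum => j _; apply: strict0 => SS z Sz.
    by have [y yz] := ses_surj ip z; rewrite -yz; apply: SS; rewrite /= yz.
  - case=> [|j] /=; last exact: preim_submod.
    by split=> // a _ _ -> ->; rewrite scaler0 addr0.
  - by case=> [_ -> | j x] /=; [rewrite linear0; apply: submod0 | apply: Si].
apply: X0 => x; apply: (inj0 (ses_inj ip)); apply: SS.
by rewrite (ses_comp0 ip); apply: submod0.
Qed.

(** Induction on a length bound, which drops for both a proper nonzero submodule and its quotient;
    no composition series has to be chosen. *)
Lemma finlen_ind (Q : lmodType R -> Prop) :
  (forall U, trivial_module U -> Q U) -> (forall U, simple U -> Q U) ->
  (forall X Y Z (i : {linear X -> Y}) (p : {linear Y -> Z}),
     ses i p -> Q X -> Q Z -> Q Y) ->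
  forall U, finlen U -> Q U.
Proof.
move=> Q0 Q1 Qe U [b]; elim: b U => [|b IH] U bU.
  exact/Q0/blen0_trivial.
have [|U0] := pselect (trivial_module U); first exact: Q0.
have [|Us] := pselect (simple U); first exact: Q1.
have [P Pm [P0 PT]] : exists2 P : U -> Prop, submod_prop P &
    ~ (forall x, P x -> x = 0) /\ ~ forall x, P x.
  apply: contrapT => nP; apply: Us; split=> // P Pm; apply: contrapT => nPx.
  by apply: nP; exists P => //; split=> h; apply: nPx; [left|right].
have [X [i [ii iP]]] := exists_sub Pm; have [Z [p ip]] := exists_coker ii.
apply: (Qe _ _ _ _ _ ip); apply: IH.
- apply: (blen_sub ip) bU => Z0; apply: PT => x; apply/iP.
  exact: ses_ex ip _ (Z0 _).
- apply: (blen_quo ip) bU => X0; apply: P0 => x /iP[y <-].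
  by rewrite (X0 y) linear0.
Qed.

Definition dcc U : Prop :=
  forall S : nat -> U -> Prop,
    (forall i, submod_prop (S i)) -> (forall i x, S i.+1 x -> S i x) ->
    exists n, forall m, (n <= m)%N -> forall x, S n x -> S m x.

Definition acc U : Prop :=
  forall S : nat -> U -> Prop,
    (forall i, submod_prop (S i)) -> (forall i x, S i x -> S i.+1 x) ->
    exists n, forall m, (n <= m)%N -> forall x, S m x -> S n x.

(** The number of strict steps is bounded, hence attains its maximum at some index, and no step
    beyond that index is strict. *)
Lemma finlen_acc U : finlen U -> acc U.
Proof.
move=> [b bU] S Sm Si.
pose c l := (\sum_(i < l) `[< ~ forall x, S i.+1 x -> S i x >])%N.
have [n nmax] := bounded_nat_attains (bU S Sm Si : forall l, (c l <= b)%N).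
exists n; elim=> [|m IH]; first by rewrite leqn0 => /eqP ->.
rewrite leq_eqVlt => /predU1P[->//|nm] x Sx; apply: IH => //.
have : (c m.+1 <= c m)%N.
  apply: leq_trans (nmax _) _.
  by rewrite /c -(subnKC (nm : (n <= m)%N)) big_split_ord /=; exact: leq_addr.
rewrite /c big_ord_recr /= -[X in (_ <= X)%N]addn0 leq_add2l leqn0 eqb0.
by move=> /asboolPn/contrapT; apply.
Qed.

Lemma finlen_dcc U : finlen U -> dcc U.
Proof.
move=> [b bU] S Sm Sd.
pose c l := (\sum_(i < l) `[< ~ forall x, S i x -> S i.+1 x >])%N.
have cb l : (c l <= b)%N.
  (* The descending chain is read backwards from height [l]; truncated subtraction makes the
     reversed chain constant from index [l] on. *)
  apply: leq_trans (bU (fun i => S (l - i)%N) _ _ l) => [|//|i x]; last first.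
    case: (ltnP i l) => il; first by rewrite -subSS subSn //; apply: Sd.
    by rewrite (eqP il : l - i = 0)%N (_ : l - i.+1 = 0)%N //; apply/eqP/leqW.
  rewrite /c (reindex_inj rev_ord_inj); apply: leq_sum => i _ /=.
  by rewrite subnSK.
have [n nmax] := bounded_nat_attains cb.
exists n; elim=> [|m IH]; first by rewrite leqn0 => /eqP ->.
rewrite leq_eqVlt => /predU1P[<-//|nm] x /(IH nm) Sx.
have : (c m.+1 <= c m)%N.
  apply: leq_trans (nmax _) _.
  by rewrite /c -(subnKC (nm : (n <= m)%N)) big_split_ord /=; exact: leq_addr.
rewrite /c big_ord_recr /= -[X in (_ <= X)%N]addn0 leq_add2l leqn0 eqb0.
by move=> /asboolPn/contrapT; apply.
Qed.

Lemma dcc_minimal U (Q : (U -> Prop) -> Prop) : dcc U ->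
  (forall P, Q P -> submod_prop P) -> (exists P, Q P) ->
  exists2 P, Q P & forall P', Q P' -> (forall x, P' x -> P x) -> forall x, P x -> P' x.
Proof.
move=> Ud Qm [P0 QP0]; apply: contrapT => nmin.
have step (P : {P | Q P}) : exists P' : {P | Q P},
    (forall x, sval P' x -> sval P x) /\ ~ forall x, sval P x -> sval P' x.
  apply: contrapT => nP; apply: nmin; exists (sval P); first exact: (svalP P).
  move=> P' QP' P'P; apply: contrapT => nPP'; apply: nP.
  by exists (exist _ P' QP').
have [f fP] := choice step.
pose S i := iter i f (exist _ P0 QP0).
have [||n nP] := Ud (fun i => sval (S i)).
- by move=> i; apply: Qm; exact: (svalP (S i)).
- by move=> i x; have [h _] := fP (S i); apply: h.
- by have [_ []] := fP (S n); exact: (nP n.+1 (leqnSn n)).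
Qed.

Lemma acc_maximal U (Q : (U -> Prop) -> Prop) : acc U ->
  (forall P, Q P -> submod_prop P) -> (exists P, Q P) ->
  exists2 P, Q P & forall P', Q P' -> (forall x, P x -> P' x) -> forall x, P' x -> P x.
Proof.
move=> Ud Qm [P0 QP0]; apply: contrapT => nmin.
have step (P : {P | Q P}) : exists P' : {P | Q P},
    (forall x, sval P x -> sval P' x) /\ ~ forall x, sval P' x -> sval P x.
  apply: contrapT => nP; apply: nmin; exists (sval P); first exact: (svalP P).
  move=> P' QP' P'P; apply: contrapT => nPP'; apply: nP.
  by exists (exist _ P' QP').
have [f fP] := choice step.
pose S i := iter i f (exist _ P0 QP0).
have [||n nP] := Ud (fun i => sval (S i)).
- by move=> i; apply: Qm; exact: (svalP (S i)).
- by move=> i x; have [h _] := fP (S i); apply: h.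
- by have [_ []] := fP (S n); exact: (nP n.+1 (leqnSn n)).
Qed.

(** A maximal finitely generated submodule contains every element, since adjoining one more
    generator keeps it finitely generated. *)
Lemma finlen_fg U : finlen U -> finitely_generated U.
Proof.
move=> /finlen_acc Ua.
pose Q (P : U -> Prop) := exists m (g : 'I_m -> U), forall x, P x <-> lspan g x.
have [||P [m [g gP]] Pmax] := @acc_maximal U Q Ua.
- move=> P [m [g gP]]; have [s0 sl] := lspan_submod g.
  by split=> [|a x y]; rewrite !gP //; apply: sl.
- by exists (lspan (fun i : 'I_0 => 0 : U)), 0%N, (fun=> 0).
exists m, g => x; apply/gP.
pose h (i : 'I_m.+1) := if unlift ord0 i is Some j then g j else x.
have hl j : h (lift ord0 j) = g j by rewrite /h liftK.
apply: (Pmax (lspan h)); first by exists m.+1, h.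
  move=> y /gP[c ->]; apply: submod_sum; first exact: lspan_submod.
  move=> i _; apply: submodZ; first exact: lspan_submod.
  by rewrite -hl; apply: lspan_gen.
by have := lspan_gen h ord0; rewrite {2}/h unlift_none.
Qed.

Lemma finlen_trivial U : trivial_module U -> finlen U.
Proof. by move=> U0; exists 0%N; apply: blen_trivial. Qed.

Section PowerSes.
Variables (U : lmodType R) (m : nat).
Definition ffun_cons0 (x : {ffun 'I_m -> U}) : {ffun 'I_m.+1 -> U} :=
  [ffun j => if unlift ord0 j is Some j' then x j' else 0].
Fact ffun_cons0_linear : linear ffun_cons0.
Proof.
move=> a x y; apply/ffunP=> j; rewrite !ffunE.
by case: (unlift ord0 j) => [i|]; rewrite ?ffunE // scaler0 addr0.
Qed.
Fact ffun_head_linear : linear (fun x : {ffun 'I_m.+1 -> U} => x ord0).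
Proof. by move=> a x y; rewrite !ffunE. Qed.
Lemma ffun_ses : ses (mklin ffun_cons0_linear) (mklin ffun_head_linear).
Proof.
split=> [x y /ffunP xy|x|u]; last by exists [ffun=> u]; rewrite /= ffunE.
  by apply/ffunP=> j; have := xy (lift ord0 j); rewrite !ffunE liftK.
split=> [/= x0|[y <-]] /=; last by rewrite ffunE unlift_none.
exists [ffun j => x (lift ord0 j)]; apply/ffunP=> j; rewrite ffunE.
by case: unliftP => [i ->|->]; rewrite ?ffunE.
Qed.
End PowerSes.

Lemma finlen_ffun U m : finlen U -> finlen ({ffun 'I_m -> U} : lmodType R).
Proof.
move=> Uf; elim: m => [|m IH]; last exact: finlen_ext (@ffun_ses U m) IH Uf.
by apply: finlen_trivial => x; apply/ffunP=> -[].
Qed.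

Lemma fg_finlen U : finlen (R^o : lmodType R) -> finitely_generated U -> finlen U.
Proof.
by move=> Rf /fg_cover[m [e es]]; apply: finlen_surj es _; apply: finlen_ffun.
Qed.

(** * Endomorphisms of modules of finite length *)

Definition iterl U (f : {linear U -> U}) : nat -> {linear U -> U} :=
  fix F i := if i is j.+1 then f \o F j else idfun.

Lemma iterlE U (f : {linear U -> U}) i x : iterl f i x = iter i f x.
Proof. by elim: i => //= i ->. Qed.

Lemma surj_endo_inj U (f : {linear U -> U}) : finlen U -> surj f -> injective f.
Proof.
move=> Uf fs.
have [||n nP] := finlen_acc Uf (S := fun i x => iterl f i x = 0).
- by move=> i; apply: ker_submod.
- by move=> i x /= ->; rewrite linear0.
have fns y : exists x, iter n f x = y.
  by elim: n y {nP} => [|n IH] y; [exists y | have [x <-] := fs y;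
     have [z <-] := IH x; exists z].
apply: inj_ker => x fx; have [y yx] := fns x.
by have := nP n.+1 (leqnSn n) y; rewrite !iterlE /= yx; apply.
Qed.

Lemma inj_endo_surj U (f : {linear U -> U}) : finlen U -> injective f -> surj f.
Proof.
move=> Uf fi.
have [||n nP] := finlen_dcc Uf (S := fun i y => exists x, iterl f i x = y).
- by move=> i; apply: im_submod.
- by move=> i _ [x <-]; exists (f x); rewrite !iterlE -iterSr.
have fni : injective (iter n f) by elim: n {nP} => //= n IH x y /fi/IH.
move=> y; have [|x xE] := nP n.+1 (leqnSn n) (iterl f n y); first by exists y.
by exists x; apply: fni; rewrite -iterSr -!iterlE.
Qed.

(* Fitting's lemma: the endomorphism ring is local. *)
Lemma indecomposable_local U (f g : {linear U -> U}) :
  finlen U -> indecomposable U -> (forall x, f x + g x = x) -> surj f \/ surj g.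
Proof.
move=> Uf [_ Ui] fg.
have [||n nP] := finlen_acc Uf (S := fun i x => iterl f i x = 0).
- by move=> i; apply: ker_submod.
- by move=> i x /= ->; rewrite linear0.
have [||m mP] := finlen_dcc Uf (S := fun i y => exists x, iterl f i x = y).
- by move=> i; apply: im_submod.
- by move=> i _ [x <-]; exists (f x); rewrite !iterlE -iterSr.
(* Beyond both stabilization indices, so that [U] is the direct sum of the kernel and the image of
   [f^N]. The successor ensures that [f^N] kills the kernel of [f]. *)
pose N := (n + m).+1.
have kerN x : iter (N + N) f x = 0 -> iter N f x = 0.
  move=> x0; have: iter n f x = 0.
    have := nP (N + N)%N _ x; rewrite !iterlE; apply => //.
    by apply: leq_trans (leq_addl _ _); apply/leqW/leq_addr.
  by rewrite /N -addnS addnC iterD => ->; rewrite -iterlE linear0.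
have imN x : exists y, iter N f x = iter (N + N) f y.
  have [||y yE] := mP (N + N)%N _ (iter N f x).
  - by apply: leq_trans (leq_addl _ _); apply/leqW/leq_addl.
  - by exists (iter n.+1 f x); rewrite iterlE -iterD addnS addnC.
  by exists y; rewrite -yE iterlE.
have [K [i [ii iP]]] := exists_sub (ker_submod (iterl f N)).
have [I [j [ji jP]]] := exists_sub (im_submod (iterl f N)).
have addl : linear (fun u : K * I => i u.1 + j u.2).
  by move=> a u v /=; rewrite !linearP scalerDr addrACA.
case: (Ui K I).
- apply: isomorphic_sym; apply: (@bij_isomorphic _ _ _ (mklin addl)).
    apply: inj_ker => -[x y] /= xy0.
    have [z zE] : exists z, iterl f N z = j y by apply/jP; exists y.
    have x0 : iterl f N (i x) = 0 by apply/iP; exists x.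
    have : iter (N + N) f z = 0.
      rewrite iterD -!iterlE zE; have := congr1 (iterl f N) xy0.
      by rewrite linearD x0 add0r linear0.
    move=> /kerN; rewrite -iterlE zE => y0; move: xy0; rewrite y0 addr0.
    by move=> /(inj0 ii) ->; rewrite (inj0 ji y0).
  move=> x; have [y xy] := imN x.
  have [a aE] : exists a, i a = x - iterl f N y.
    by apply/iP; rewrite linearB !iterlE -iterD xy subrr.
  have [b bE] : exists b, j b = iterl f N y by apply/jP; exists y.
  by exists (a, b); rewrite /= aE bE subrK.
- move=> K0; left; apply: inj_endo_surj => //; apply: inj_ker => x fx.
  have [y <-] : exists y, i y = x; last by rewrite (K0 y) linear0.
  by apply/iP; rewrite iterlE /N iterSr fx -iterlE linear0.
- move=> I0; right; apply: inj_endo_surj => //; apply: inj_ker => x gx.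
  have fx : f x = x by rewrite -{2}(fg x) gx addr0.
  have [y yE] : exists y, j y = iterl f N x by apply/jP; exists x.
  have := yE; rewrite (I0 y) linear0 iterlE => ->.
  by elim: (N) => //= k <-.
Qed.

End FiniteLength.

(** * Projective modules and minimal resolutions *)

Section Projective.
Variable R : pzRingType.
Implicit Types (U V W X Y Z P : lmodType R).

Lemma proj_fg P : projective P -> finitely_generated P.
Proof. by case. Qed.

Lemma proj_lift P X Y (g : {linear X -> Y}) (f : {linear P -> Y}) :
  projective P -> finitely_generated X -> surj g ->
  exists h : {linear P -> X}, forall x, g (h x) = f x.
Proof. by move=> [_ Pp] Xf gs; apply: Pp => //; apply: fg_surj Xf. Qed.

Lemma delta_lincomb m (x : {ffun 'I_m -> R^o}) :
  x = \sum_j (x j : R) *: ([ffun i => (i == j)%:R] : {ffun 'I_m -> R^o}).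
Proof.
apply/ffunP=> i; rewrite sum_ffunE (bigD1 i) //= !ffunE eqxx.
rewrite big1 ?addr0 => [|j ij]; first by rewrite /GRing.scale /= mulr1.
by rewrite !ffunE eq_sym (negPf ij) /GRing.scale /= mulr0.
Qed.

Lemma free_projective m : projective ({ffun 'I_m -> R^o} : lmodType R).
Proof.
split=> [|X Y g f _ _ gs]; first exact: fg_free.
pose b j : {ffun 'I_m -> R^o} := [ffun i => (i == j)%:R].
have [y yP] := choice (fun j => gs (f (b j))).
exists (lincomb y) => x; rewrite {2}(delta_lincomb x) !linear_sum.
by apply: eq_bigr => j _; rewrite !linearZ yP.
Qed.

Lemma retract_projective P (Q : lmodType R) (s : {linear Q -> P}) (r : {linear P -> Q}) :
  projective P -> (forall x, r (s x) = x) -> projective Q.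
Proof.
move=> Pp rs; split=> [|X Y g f Xf Yf gs].
  by apply: (@fg_surj _ _ _ r _ (proj_fg Pp)) => y; exists (s y).
have [h hP] := proj_lift (f \o r) Pp Xf gs.
by exists (h \o s) => x /=; rewrite hP /= rs.
Qed.

Lemma projective_prod P (Q : lmodType R) : projective P -> projective Q -> projective (P * Q)%type.
Proof.
move=> Pp Qp; split=> [|X Y g f Xf Yf gs].
  have inl_lin : linear (fun x : P => (x, 0) : (P * Q)%type).
    by move=> a x y; congr (_, _); rewrite /= scaler0 addr0.
  have ip : ses (mklin inl_lin) (snd : {linear (P * Q)%type -> Q}).
    split=> [x y [] //|[x y]|y]; last by exists (0, y).
    by split=> [/= ->|[z [_ <-]] //]; exists x.
  exact: fg_ext ip (proj_fg Pp) (proj_fg Qp).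
have fl : linear (fun x : P => f (x, 0)).
  move=> a x y; rewrite -linearP; congr (f _); congr (_, _).
  by rewrite /= scaler0 addr0.
have fr : linear (fun y : Q => f (0, y)).
  move=> a x y; rewrite -linearP; congr (f _); congr (_, _).
  by rewrite /= scaler0 addr0.
have [h hP] := proj_lift (mklin fl) Pp Xf gs.
have [k kP] := proj_lift (mklin fr) Qp Xf gs.
have hk : linear (fun u : P * Q => h u.1 + k u.2).
  by move=> a u v /=; rewrite !linearP scalerDr addrACA.
exists (mklin hk) => -[x y] /=; rewrite linearD hP kP /= -linearD.
by congr (f (_, _)); rewrite /= ?addr0 ?add0r.
Qed.

Lemma dual_basis P : projective P ->
  exists (m : nat) (q : 'I_m -> P) (e : 'I_m -> {linear P -> R^o}),
    forall x, x = \sum_j (e j x : R) *: q j.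
Proof.
move=> Pp; have [m [g gs]] := fg_cover (proj_fg Pp).
have [h hP] := proj_lift idfun Pp (fg_free R m) gs.
have el j : linear (fun x : P => h x j : R^o) by move=> a x y; rewrite linearP !ffunE.
exists m, (fun j => g [ffun i => (i == j)%:R]), (fun j => mklin (el j)) => x.
rewrite -[LHS](hP x) [in LHS](delta_lincomb (h x)) linear_sum.
by apply: eq_bigr => j _; rewrite linearZ.
Qed.

Lemma exists_projective_cover X : finlen (R^o : lmodType R) ->
  finitely_generated X -> exists P (e : {linear P -> X}), projective_cover e.
Proof.
move=> Rf Xf; have [m [e es]] := fg_cover Xf.
have Ff : finlen ({ffun 'I_m -> R^o} : lmodType R) by apply: finlen_ffun.
pose Q (S : {ffun 'I_m -> R^o} -> Prop) :=
  submod_prop S /\ forall x, exists2 y, S y & e y = x.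
have [||S [Sm Ss] Smin] := @dcc_minimal _ _ Q (finlen_dcc Ff).
- by move=> P [].
- by exists (fun=> True); split=> // x; have [y <-] := es x; exists y.
have [K [i [ii iP]]] := exists_sub Sm.
have Kf : finlen K := finlen_inj ii Ff.
pose ei : {linear K -> X} := e \o i.
have eis : surj ei.
  by move=> x; have [y /iP[z <-] <-] := Ss x; exists z.
have [h hP] := proj_lift e (free_projective m) (finlen_fg Kf) eis.
have full (T : K -> Prop) : submod_prop T ->
    (forall x, exists2 y, T y & ei y = x) -> forall y, T y.
  move=> Tm Ts y; have [|||y0 Ty /ii <- //] :=
    Smin (fun z => exists2 y, T y & i y = z) _ _ (i y).
  - split; first exact: image_submod.
    by move=> x; have [z Tz <-] := Ts x; exists (i z) => //; exists z.
  - by move=> _ [z _ <-]; apply/iP; exists z.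
  - by apply/iP; exists y.
have his : surj (h \o i).
  apply: full; first exact: im_submod.
  move=> x; have [y <-] := eis x; exists (h (i y)); first by exists y.
  exact: hP.
have [g gK Kg] := bij_inverse (surj_endo_inj Kf his) his.
exists K, ei; split=> // [|T Tm Tadd].
  by apply: (retract_projective (s := i) (r := g \o h)) => //; exact: free_projective.
apply: (full (fun y => y \in T)); first exact: closed_submod_prop.
move=> x; have [y <-] := eis x; have [u [v [uT v0 ->]]] := Tadd y.
by exists u; rewrite // linearD v0 addr0.
Qed.

(** * Lifting and extension problems *)

Definition lifts Z X Y (p : {linear X -> Y}) : Prop :=
  forall f : {linear Z -> Y}, exists g : {linear Z -> X}, forall z, p (g z) = f z.

Definition extends X Y (i : {linear X -> Y}) Z : Prop :=
  forall f : {linear X -> Z}, exists g : {linear Y -> Z}, forall x, g (i x) = f x.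

(* [extends m X] says [Ext^1(Z, X) = 0]; the next four lemmas are the pieces of
   the long exact sequence of [Ext(Z, -)]. *)
Section ExtSequence.
Variables (Z' P Z X' X X'' : lmodType R).
Variables (m : {linear Z' -> P}) (c : {linear P -> Z}).
Variables (i : {linear X' -> X}) (p : {linear X -> X''}).
Hypotheses (mc : ses m c) (ip : ses i p).
Hypotheses (Pp : projective P) (Xf : finitely_generated X).

Lemma extends_lifts : extends m X' -> lifts Z p.
Proof.
move=> mX' f; have [u uP] := proj_lift (f \o c) Pp Xf (ses_surj ip).
have [|v vP] := ses_factor ip (f := u \o m).
  by move=> z; rewrite /= uP /= (ses_comp0 mc) linear0.
have [w wP] := mX' v.
have [|s sP] := ses_cofactor mc (f := u \- (i \o w)).
  by move=> z; rewrite /= wP vP subrr.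
exists s => z; have [y <-] := ses_surj mc z.
by rewrite sP /= linearB uP (ses_comp0 ip) subr0.
Qed.

Lemma extends_sub : lifts Z p -> extends m X -> extends m X'.
Proof.
move=> Zp mX f; have [u uP] := mX (i \o f).
have [|s sP] := ses_cofactor mc (f := p \o u).
  by move=> z; rewrite /= uP (ses_comp0 ip).
have [s' s'P] := Zp s.
have [|g gP] := ses_factor ip (f := u \- (s' \o c)).
  by move=> x; rewrite /= linearB /= s'P sP subrr.
exists g => z; apply: (ses_inj ip).
by rewrite gP /= (ses_comp0 mc) linear0 subr0 uP.
Qed.

Lemma extends_syz_lifts : extends m X'' -> lifts Z' p.
Proof.
move=> mX f; have [g gP] := mX f.
have [h hP] := proj_lift g Pp Xf (ses_surj ip).
by exists (h \o m) => z; rewrite /= hP gP.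
Qed.

Lemma extends_quo : lifts Z' p -> extends m X -> extends m X''.
Proof.
move=> Zp mX f; have [g gP] := Zp f; have [h hP] := mX g.
by exists (p \o h) => z; rewrite /= hP gP.
Qed.

End ExtSequence.

(** The family [Z] starts at the first syzygy, so [Z j] is the (j+1)-st one; [syz] shifts the index
    and puts [N] in degree 0. *)
Definition syz N (Z : nat -> lmodType R) (j : nat) : lmodType R :=
  if j is j'.+1 then Z j' else N.

Definition min_res N (Z P : nat -> lmodType R)
    (m : forall j, {linear Z j -> P j}) (c : forall j, {linear P j -> syz N Z j}) :=
  forall j, projective_cover (c j) /\ ses (m j) (c j).

Lemma min_res_exists N : finlen (R^o : lmodType R) -> finitely_generated N ->
  exists (Z P : nat -> lmodType R) (m : forall j, {linear Z j -> P j})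
    (c : forall j, {linear P j -> syz N Z j}), min_res m c.
Proof.
move=> Rf Nf.
(* Finite generation is carried along with each syzygy, since the next projective cover requires
   it. *)
have step (X : {X : lmodType R | finitely_generated X}) :
    exists Y : {X : lmodType R | finitely_generated X},
    exists P (c : {linear P -> sval X}) (m : {linear sval Y -> P}),
      projective_cover c /\ ses m c.
  have [P [e ec]] := exists_projective_cover Rf (svalP X).
  have [|Y [i ie]] := exists_ker (p := e); first by case: ec.
  have Yf : finitely_generated Y.
    apply/finlen_fg/(finlen_inj (ses_inj ie))/fg_finlen => //.
    by case: ec => /proj_fg.
  by exists (exist _ Y Yf), P, e, i.
have [st stP] := choice step.
pose W j := iter j st (exist _ N Nf); pose Z j := sval (W j.+1).
have res j : exists P (c : {linear P -> syz N Z j}) (m : {linear Z j -> P}),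
    projective_cover c /\ ses m c.
  by case: j => [|j]; [exact: (stP (W 0%N)) | exact: (stP (W j.+1))].
pose P j := sval (cid (res j)).
have resP j : exists (c : {linear P j -> syz N Z j}) (m : {linear Z j -> P j}),
  projective_cover c /\ ses m c by exact: (svalP (cid (res j))).
pose c j := sval (cid (resP j)).
have resc j : exists m : {linear Z j -> P j}, projective_cover (c j) /\ ses m (c j).
  exact: (svalP (cid (resP j))).
by exists Z, P, (fun j => sval (cid (resc j))), c => j; apply: (svalP (cid (resc j))).
Qed.

Section MinRes.
Variables (N : lmodType R) (Z P : nat -> lmodType R).
Variables (m : forall j, {linear Z j -> P j}) (c : forall j, {linear P j -> syz N Z j}).
Hypothesis res : min_res m c.

Lemma res_ses j : ses (m j) (c j). Proof. by case: (res j). Qed.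
Lemma res_cover j : projective_cover (c j). Proof. by case: (res j). Qed.
Lemma res_proj j : projective (P j). Proof. by case: (res_cover j). Qed.
Lemma res_fg j : finitely_generated (syz N Z j).
Proof. exact: fg_surj (ses_surj (res_ses j)) (proj_fg (res_proj j)). Qed.

Lemma syz_is_syzygy j : is_syzygy (syz N Z j) (Z j).
Proof.
by exists (P j), (c j), (m j); case: (res_ses j) => ? ? ?; split=> //; apply: res_cover.
Qed.

Lemma res_exact j : exact_at (m j \o c j.+1) (c j).
Proof.
move=> y; split=> [/(ses_ex (res_ses j))[z <-]|[x <-]]; last exact: (ses_comp0 (res_ses j)).
by have [x <-] := ses_surj (res_ses j.+1) z; exists x.
Qed.

Lemma res_resolution :
  projective_resolution (fun j => m j \o c j.+1 : {linear P j.+1 -> P j}) (c 0%N).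
Proof.
split=> [j|||j y]; [exact: res_proj|exact: (ses_surj (res_ses 0))|exact: res_exact|].
split=> [/(inj0 (ses_inj (res_ses j))) cy|[x <-]]; first exact: (res_exact y).1 cy.
by rewrite /= (ses_comp0 (res_ses j.+1)) linear0.
Qed.

Lemma Ext_zero_extends j X : Ext_zero j.+1 N X -> extends (m j) X.
Proof.
move=> E f; have [|g gP] := E _ _ _ res_resolution (f \o c j.+1).
  by move=> x; rewrite /= (ses_comp0 (res_ses j.+1)) linear0.
exists g => z; have [x <-] := ses_surj (res_ses j.+1) z.
by have := gP x.
Qed.

End MinRes.

Lemma iterated_chain (Om : lmodType R -> lmodType R -> Prop) (W : nat -> lmodType R) :
  (forall j, Om (W j) (W j.+1)) -> forall k a, iterated Om k (W a) (W (a + k)%N).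
Proof.
move=> OmW; elim=> [|k IH] a /=; first by rewrite addn0; apply: isomorphic_refl.
by exists (W a.+1) => //; rewrite addnS -addSn; apply: IH.
Qed.

End Projective.

(** * Commutative artinian rings *)

Lemma artinian_dcc (R : pzRingType) (U : lmodType R) : artinian U -> dcc U.
Proof.
move=> Ua S Sm Sd; have [||n nP] := Ua (fun i => [pred x | `[< S i x >]]).
- by move=> i; apply: submod_prop_closed.
- by move=> i x Sx; apply/asboolP; apply: Sd; apply/asboolP.
exists n => m nm x /asboolP Sx; apply/asboolP; rewrite -[asbool _]/(x \in [pred y | `[< S m y >]]).
by rewrite (nP m nm).
Qed.

Section SubmoduleAvoiding.
Import classical_sets.
Variables (R : pzRingType) (U : lmodType R) (x : U).

Lemma maximal_avoiding : x <> 0 ->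
  exists P : U -> Prop, [/\ submod_prop P, ~ P x
    & forall P', submod_prop P' -> (forall y, P y -> P' y) -> ~ P' x ->
        forall y, P' y -> P y].
Proof.
(* Zorn's lemma is applied to sets that become submodules once 0 is added, because the union of the
   empty chain is empty. *)
move=> x0; pose hull (S : set U) y := y = 0 \/ S y.
pose Q (S : set U) := submod_prop (hull S) /\ ~ S x.
have [F FQ Ftot|A [[Am Ax] Amax]] := @Zorn_bigcup U Q.
  split; last by case=> S FS Sx; have [_] := FQ S FS.
  split; first by left.
  move=> a y z [->|[S FS Sy]]; first case=> [->|[S' FS' Sz]].
  - by rewrite scaler0 addr0; left.
  - by rewrite scaler0 add0r; right; exists S'.
  have scl (T : set U) (c : R) u : F T -> T u -> hull T (c *: u).
    by move=> /FQ[[T0 Tl] _] Tu; rewrite -[_ *: _]addr0; apply: Tl; [right|left].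
  have up (T : set U) u : F T -> hull T u -> hull (bigcup F id) u.
    by move=> FT [->|Tu]; [left | right; exists T].
  case=> [->|[S' FS' Sz]]; first by rewrite addr0; apply: (up S) => //; apply: scl.
  have [SS|SS] := Ftot _ _ FS FS'.
    by apply: (up S') => //; have [[_ Tl] _] := FQ _ FS'; apply: Tl; right; auto.
  by apply: (up S) => //; have [[_ Tl] _] := FQ _ FS; apply: Tl; right; auto.
exists (hull A); split=> [//|[/x0|]//|P' P'm AP' P'x y P'y].
apply: contrapT => Ay; apply: (Amax P').
  split; first by move=> z Az; apply: AP'; right.
  by move=> P'A; apply: Ay; right; apply: P'A.
split=> //; have [P0 Pl] := P'm.
have hP z : hull P' z -> P' z by case=> [->|].
by split=> [|a u v /hP ? /hP ?]; [left | right; apply: Pl].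
Qed.
End SubmoduleAvoiding.

Section Homothety.
Variables (k : comNzRingType) (U V : lmodType k).

Fact homothety_linear (a : k) : linear (fun x : U => a *: x).
Proof. by move=> b x y; rewrite scalerDr !scalerA mulrC. Qed.

(** A separate name, because [lhom U V] already carries the module structure over the opposite
    endomorphism ring of its source. *)
Definition khom : Type := lhom U V.
HB.instance Definition _ := GRing.Zmodule.on khom.

Section Scale.
Variables (a : k) (f : khom).
Definition khom_fun (x : U) : V := a *: f x.
Fact khom_fun_linear : linear khom_fun.
Proof. by move=> b x y; rewrite /khom_fun linearP scalerDr !scalerA mulrC. Qed.
HB.instance Definition _ := GRing.isLinear.Build k U V *:%R khom_fun khom_fun_linear.
Definition khom_scale : khom := khom_fun.
End Scale.

Fact khom_scaleA a b f : khom_scale a (khom_scale b f) = khom_scale (a * b) f.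
Proof. by apply: lhomP => x; rewrite /= /khom_fun /= /khom_fun scalerA. Qed.
Fact khom_scale1 : left_id 1 khom_scale.
Proof. by move=> f; apply: lhomP => x; rewrite /= /khom_fun scale1r. Qed.
Fact khom_scaleDr : right_distributive khom_scale +%R.
Proof. by move=> a f g; apply: lhomP => x; rewrite /= /khom_fun scalerDr. Qed.
Fact khom_scaleDl f : {morph khom_scale^~ f : a b / a + b}.
Proof. by move=> a b; apply: lhomP => x; rewrite /= /khom_fun scalerDl. Qed.

HB.instance Definition _ := GRing.Zmodule_isLmodule.Build k khom
  khom_scaleA khom_scale1 khom_scaleDr khom_scaleDl.

Lemma khom_scaleE a (f : khom) x : (a *: f) x = a *: f x. Proof. by []. Qed.
End Homothety.

Section KhomMaps.
Variables (k : comNzRingType) (U V W : lmodType k) (f : {linear U -> V}).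
Fact khom_pre_linear : linear (fun g : khom V W => (g \o f : {linear U -> W}) : khom U W).
Proof. by move=> a g h; apply: lhomP. Qed.
Definition khom_pre : {linear khom V W -> khom U W} := mklin khom_pre_linear.
Lemma khom_preE g x : khom_pre g x = g (f x). Proof. by []. Qed.
End KhomMaps.

Section CommArtin.
Variable k : comNzRingType.
Implicit Types (U V W X Y Z N E : lmodType k).
Local Notation kk := (k^o : lmodType k).

(** Let [K] be minimal among the ideals without finite length; its proper submodules all have finite
    length. Every scalar then acts on [K] as zero or invertibly, so [K] is a vector space over a
    field. A hyperplane in it has finite length and a simple quotient, which contradicts the choice
    of [K]. *)
Lemma artinian_finlen : artinian kk -> finlen kk.
Proof.
move=> /artinian_dcc kd; apply: contrapT => nfl.
pose Q (I : kk -> Prop) := submod_prop I /\ exists (K : lmodType k) (m : {linear K -> kk}),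
  [/\ injective m, forall x, I x <-> exists y, m y = x & ~ finlen K].
have [||I [Im [K [m [mi mP Kn]]]] Imin] := @dcc_minimal _ _ Q kd.
- by move=> P [].
- exists (fun=> True); split=> //; exists kk, idfun; split=> // x.
  by split=> // _; exists x.
have sub (L : lmodType k) (j : {linear L -> K}) : injective j -> ~ surj j -> finlen L.
  move=> ji js; apply: contrapT => Ln; apply: js => x.
  have [|_ [y <-]||y /mi <-] := Imin (fun z => exists y, (m \o j) y = z) _ _ (m x).
  - split; first exact: im_submod.
    by exists L, (m \o j); split=> //; apply: inj_comp.
  - by apply/mP; exists (j y).
  - by apply/mP; exists x.
  - by exists y.
(* If [a] acted neither as zero nor onto, its kernel and image would both be proper, and [K] would
   be an extension of two modules of finite length. *)
have mul_or a : (forall x : K, a *: x = 0) \/ forall x : K, exists y, a *: y = x.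
  pose h := mklin (@homothety_linear k K a).
  have [|nz] := pselect (forall x : K, a *: x = 0); first by left.
  have [|ns] := pselect (forall x : K, exists y, a *: y = x); first by right.
  exfalso; apply: Kn.
  have [L [j [ji jP]]] := exists_sub (ker_submod h).
  have [L' [e [j' [es j'i ej']]]] := exists_image h.
  apply: (@finlen_ext _ _ _ _ j e).
  - split=> // y; rewrite -jP /= -[a *: y]/(h y) -ej'.
    by split=> [->|/(inj0 j'i)//]; rewrite linear0.
  - apply: (sub _ j ji) => js; apply: nz => x; apply/(jP x)/js.
  - by apply: (sub _ j' j'i) => js; apply: ns => x; have [z <-] := js x;
       have [y <-] := es z; exists y; rewrite ej'.
(* The chain of ideals generated by the powers of [a] stabilizes, giving [a^n = a^(n+1) b]. Since
   [a^n] maps [K] onto itself, [b a] acts as the identity. *)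
have inv a : ~ (forall x : K, a *: x = 0) -> exists b, forall x : K, (b * a) *: x = x.
  move=> na; have as_ : forall x : K, exists y, a *: y = x by case: (mul_or a).
  have [||n nP] := kd (fun i x => exists c : k, x = a ^+ i * c).
  - move=> i; split=> [|b x y [c ->] [d ->]]; first by exists 0; rewrite mulr0.
    by exists (b * c + d); rewrite mulrDr /GRing.scale /= mulrCA.
  - by move=> i _ [c ->]; exists (a * c); rewrite mulrA -exprSr.
  have [|b bE] := nP n.+1 (leqnSn n) (a ^+ n); first by exists 1; rewrite mulr1.
  have an : forall x : K, exists y, a ^+ n *: y = x.
    elim: (n) => [|j IH] x; first by exists x; rewrite expr0 scale1r.
    have [y <-] := as_ x; have [z <-] := IH y; exists z.
    by rewrite scalerA exprS.
  exists b => x; have [y <-] := an x; rewrite scalerA [in RHS]bE.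
  by rewrite -mulrA -exprS mulrC.
have [x x0] : exists x : K, x <> 0.
  apply: contrapT => K0; apply/Kn/finlen_trivial => x.
  by apply: contrapT => x0; apply: K0; exists x.
(* The hyperplane: by maximality any [y] outside [P] generates [x] modulo [P], and invertibility of
   the scalars turns this into generating all of [K] modulo [P]. *)
have [P [Pm Px Pmax]] := maximal_avoiding x0.
have [L [j [ji jP]]] := exists_sub Pm; have [C [p jp]] := exists_coker ji.
apply: Kn; apply: (finlen_ext jp).
  by apply: (sub _ j ji) => js; apply/Px/jP/js.
have gen1 y : ~ P y -> exists c d, P (x - c *: y) /\ forall u : K, (d * c) *: u = u.
  move=> Py; have [c Pxc] : exists c, P (x - c *: y).
    apply: contrapT => nc; apply: Py.
    apply: (Pmax (fun u => exists c, P (u - c *: y))) => [|u Pu|//|].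
    - split=> [|a u v [c Pc] [d Pd]].
        by exists 0; rewrite scale0r subr0; apply: submod0 Pm.
      exists (a * c + d); rewrite scalerDl -scalerA opprD addrACA -scalerBr.
      by apply: Pm.2.
    - by exists 0; rewrite scale0r subr0.
    - by exists 1; rewrite scale1r subrr; apply: submod0 Pm.
  have [d dP] : exists d, forall u : K, (d * c) *: u = u.
    by apply: inv => c0; apply: Px; rewrite -[x]subr0 -(c0 y).
  by exists c, d.
have gen y : ~ P y -> forall z, exists c, P (z - c *: y).
  move=> Py z; have [c [d [Pc dc]]] := gen1 y Py.
  have [Pz|/gen1[c' [d' [Pc' dc']]]] := pselect (P z).
    by exists 0; rewrite scale0r subr0.
  exists (d' * c).
  rewrite -[z](dc' z) -!scalerA -scalerBr; apply: (submodZ Pm).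
  rewrite (_ : c' *: z - c *: y = (x - c *: y) - (x - c' *: z)); first exact: submodB.
  by rewrite opprB [RHS]addrC subrKA.
exists 1%N; apply: blen_simple; split=> [C0|T Tm].
  apply: Px; apply/jP; apply: (ses_ex jp); exact: C0.
have [T0|T0] := pselect (forall y, T y -> y = 0); [by left | right => z].
have [y [Ty y0]] : exists y, T y /\ y <> 0.
  by apply: contrapT => ny; apply: T0 => y Ty; apply: contrapT => y0; apply: ny; exists y.
have [u uE] := ses_surj jp y; have [w wE] := ses_surj jp z.
have Pu : ~ P u by move=> /jP[v vu]; apply: y0; rewrite -uE -vu (ses_comp0 jp).
have [c /jP[v vE]] := gen u Pu w.
have := ses_comp0 jp v; rewrite vE linearB linearZ uE wE => /eqP.
by rewrite subr_eq0 => /eqP ->; apply: submodZ.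
Qed.
End CommArtin.

(** * The dualizing module *)

Section Dualizing.
Variable k : comNzRingType.
Implicit Types (U V W X Y Z N E J : lmodType k).
Local Notation kk := (k^o : lmodType k).
Hypothesis k_finlen : finlen kk.

(** Maximality stated as: the quotient by [I] is a field. *)
Definition maxideal (I : kk -> Prop) : Prop :=
  [/\ submod_prop I, ~ I 1 & forall a : k, ~ I a -> exists b : k, I (1 - a * b)].

Section MaxIdeal.
Variable I : kk -> Prop.
Hypothesis Imax : maxideal I.

Lemma maxideal_submod : submod_prop I. Proof. by case: Imax. Qed.

Lemma maxidealM (a b : k) : I b -> I (a * b).
Proof. exact: (@submodZ _ _ _ maxideal_submod a b). Qed.

Lemma maxideal_prime (a b : k) : I (a * b) -> I a \/ I b.
Proof.
move=> Iab; have [|na] := pselect (I a); [by left | right].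
case: Imax => Im _ /(_ a na)[c Ic].
rewrite -[b]mul1r -(subrK (a * c) 1) mulrDl; apply: (submodD Im).
  by rewrite mulrC; apply: maxidealM.
by rewrite mulrAC mulrC; apply: maxidealM.
Qed.

Lemma maxideal_eq (I' : kk -> Prop) : maxideal I' -> (forall a, I a -> I' a) ->
  forall a, I' a -> I a.
Proof.
move=> [Im' I'1 _] II' a I'a; apply: contrapT => na.
case: Imax => _ _ /(_ a na)[b /II' I'b]; apply: I'1.
rewrite -(subrK (a * b) 1); apply: (submodD Im') => //.
by rewrite mulrC; apply: (submodZ Im').
Qed.
End MaxIdeal.

Lemma exists_maxideal (P : kk -> Prop) : submod_prop P -> ~ P 1 ->
  exists2 I, maxideal I & forall a, P a -> I a.
Proof.
move=> Pm P1.
pose Q (I : kk -> Prop) := [/\ submod_prop I, ~ I 1 & forall a, P a -> I a].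
have [||I [Im I1 PI] Imax] := @acc_maximal _ _ Q (finlen_acc k_finlen).
- by move=> I [].
- by exists P.
exists I => //; split=> // a na; apply: contrapT => nb; apply: na.
pose I' (x : kk) := exists b : k, I (x - a * b).
have II' x : I x -> I' x by exists 0; rewrite mulr0 subr0.
apply: (Imax I') => //; last by exists 1; rewrite mulr1 subrr; apply: submod0 Im.
split=> // [|b /PI/II' //].
split=> [|c x y [d Id] [e Ie]]; first by apply: II'; apply: submod0 Im.
exists (c * d + e); rewrite mulrDr opprD addrACA mulrCA.
rewrite -[c *: x - _]/(c * x - _) -mulrBr.
exact: Im.2.
Qed.

Lemma radicalP (x : kk) : in_radical x <-> forall I, maxideal I -> I x.
Proof.
split=> [xr I Imax|xI S [Sm [y yS] Smax]].
  have [Im I1 _] := Imax.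
  have /xr : maximal_submodule [pred x | `[< I x >]]; last by move/asboolP.
  split; first exact: submod_prop_closed.
    by exists 1; apply/asboolP.
  move=> T /closed_submod_prop Tm IT.
  have IT' a : I a -> a \in T by move=> Ia; apply: IT; apply/asboolP.
  have [TI|nTI] := pselect (forall a, a \in T -> I a); [left | right].
    by move=> a; apply/idP/asboolP => [/TI|/IT'].
  move=> a; apply: contrapT => nTa; apply: nTI => b Tb; apply: contrapT => nIb.
  have [_ _ /(_ b nIb)[c /IT' Tc]] := Imax; apply: nTa.
  have T1 : (1 : kk) \in T.
    rewrite -(subrK (b * c) 1); apply: (submodD Tm) => //.
    by rewrite mulrC; apply: (submodZ Tm).
  by rewrite -[a]mulr1; apply: (submodZ Tm a T1).
apply: (xI (fun z => z \in S)); have Sm' := closed_submod_prop Sm.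
have nS1 : ~ (1 : kk) \in S.
  by move=> S1; move: yS; rewrite -[y]mulr1 (submodZ Sm' y S1).
split=> // a naS.
have [||ST|ST] := Smax [pred x | `[< exists b : k, x - a * b \in S >]].
- apply: submod_prop_closed; split=> [|c u v [d Sd] [e Se]].
    by exists 0; rewrite mulr0 subr0; apply: submod0 Sm'.
  exists (c * d + e); rewrite mulrDr opprD addrACA mulrCA.
  by rewrite -[c *: u - _]/(c * u - _) -mulrBr; apply: Sm'.2.
- by move=> u uS; apply/asboolP; exists 0; rewrite mulr0 subr0.
- exfalso; apply: naS; rewrite -(ST a).
  by apply/asboolP; exists 1; rewrite mulr1 subrr; apply: submod0 Sm'.
- by have /asboolP := ST 1.
Qed.

Lemma radical_submod : submod_prop (fun x : kk => in_radical x).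
Proof.
split=> [|a x y /radicalP xr /radicalP yr]; apply/radicalP => I Imax.
  exact: submod0 (maxideal_submod Imax).
by have Im := maxideal_submod Imax; apply: Im.2; [exact: xr|exact: yr].
Qed.

(** If [u] were in [I], take another maximal ideal [I'] and [a] in [I] but not in [I']. Then [a u]
    is in the radical, so [u] is in [I']; thus [u] would lie in every maximal ideal. *)
Lemma top_annihilator I (u : kk) : maxideal I -> (forall a : k, I a -> in_radical (a * u : kk)) ->
  ~ in_radical u -> ~ I u.
Proof.
move=> Imax Iu nu Iu'; apply: nu; apply/radicalP => I' Imax'.
apply: contrapT => nI'u.
have [a Ia nI'a] : exists2 a, I a & ~ I' a.
  apply: contrapT => na; apply: nI'u.
  have II' a : I a -> I' a by move=> Ia; apply: contrapT => nI'a; apply: na; exists a.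
  exact: II'.
by have /radicalP/(_ I' Imax')/(maxideal_prime Imax')[] := Iu a Ia.
Qed.

Section Essential.
Variables (S E : lmodType k) (q : {linear kk -> S}) (m : {linear S -> E}).
Hypotheses (qs : surj q) (qP : forall x, q x = 0 <-> in_radical x).
Hypothesis mi : injective m.
Hypothesis ess : forall P : E -> Prop, submod_prop P ->
  (forall x, P (m x) -> x = 0) -> forall y, P y -> y = 0.

(** A nonzero element killed by [I] spans a simple submodule, which meets [S] by essentiality and so
    lies in it. In the top of [k] the elements killed by [I] form a space of dimension at most one
    over the quotient field. *)
Lemma socle_simple I (y z : E) : maxideal I -> y <> 0 ->
  (forall a : k, I a -> a *: y = 0) -> (forall a : k, I a -> a *: z = 0) ->
  exists c : k, z = c *: y.
Proof.
move=> Imax.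
have inS w : w <> 0 -> (forall a : k, I a -> a *: w = 0) -> exists u : kk, m (q u) = w.
  move=> w0 Iw.
  pose P v := exists c : k, v = c *: w.
  have Pm : submod_prop P.
    split=> [|a u v [c ->] [d ->]]; first by exists 0; rewrite scale0r.
    by exists (a * c + d); rewrite scalerDl scalerA.
  have [s [c cE] s0] : exists2 s, P (m s) & s <> 0.
    apply: contrapT => ns; apply: w0; apply: (ess Pm); last by exists 1; rewrite scale1r.
    by move=> s Ps; apply: contrapT => s0; apply: ns; exists s.
  have nc : ~ I c by move=> /Iw cw; apply: s0; apply: (inj0 mi); rewrite cE.
  have [_ _ /(_ c nc)[b Ib]] := Imax; have [u uE] := qs (b *: s).
  exists u; rewrite uE linearZ /= cE scalerA mulrC.
  by apply/eqP; rewrite eq_sym -subr_eq0 -{1}[w]scale1r -scalerBl Iw.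
move=> y0 Iy Iz.
have [->|z0] := pselect (z = 0); first by exists 0; rewrite scale0r.
have [u uE] := inS y y0 Iy; have [v vE] := inS z z0 Iz.
have Iq w a : (forall a : k, I a -> a *: m (q w) = 0) -> I a -> in_radical (a * w : kk).
  move=> h Ia; apply/qP; apply: (inj0 mi); rewrite -(h a Ia) -!linearZ; congr (m (q _)).
have nu : ~ I u.
  apply: top_annihilator => // [a Ia|/qP u0]; first by apply: Iq => //; rewrite uE.
  by apply: y0; rewrite -uE u0 linear0.
(* Here [c] inverts [u] modulo [I], and [I] kills the class of [v], so [v] and [v c u] agree modulo
   the radical. *)
have [_ _ /(_ u nu)[c Ic]] := Imax; exists (v * c).
have := Iq v (1 - u * c); rewrite vE => /(_ Iz Ic)/qP q0.
rewrite -vE -uE -!linearZ; congr (m _); apply/eqP.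
rewrite -subr_eq0 -linearB; apply/eqP; rewrite -[RHS]q0; congr (q _).
by rewrite mulrBl mul1r; congr (_ - _); rewrite -[LHS]/(v * c * u) mulrC mulrA mulrAC.
Qed.
End Essential.

Lemma simple_gen N (x : N) : simple N -> x <> 0 -> forall y, exists c : k, y = c *: x.
Proof.
move=> [N0 Ns] x0 y.
case: (Ns (fun y => exists c : k, y = c *: x)) => [|N0'|//].
  split=> [|a u v [c ->] [d ->]]; first by exists 0; rewrite scale0r.
  by exists (a * c + d); rewrite scalerDl scalerA.
by exfalso; apply/x0/N0'; exists 1; rewrite scale1r.
Qed.

Lemma simple_annihilator N (x : N) : simple N -> x <> 0 ->
  maxideal (fun a : kk => (a : k) *: x = 0).
Proof.
move=> Ns x0; split=> [||a ax].
- split=> [|a b c bx cx]; first by rewrite scale0r.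
  by rewrite scalerDl -[a *: b]/(a * b) -scalerA bx cx scaler0 addr0.
- by rewrite scale1r.
- have [b bE] := simple_gen Ns ax x; exists b.
  by rewrite scalerBl scale1r {1}bE scalerA mulrC subrr.
Qed.

End Dualizing.

Section Injective.
Variable R : pzRingType.
Implicit Types (U V W X Y Z N E J : lmodType R).

Definition essential U V (m : {linear U -> V}) : Prop :=
  forall P : V -> Prop, submod_prop P ->
    (forall x, P (m x) -> x = 0) -> forall y, P y -> y = 0.

Lemma essentialP U V (m : {linear U -> V}) : essential m <->
  forall S : {pred V}, submod_closed S ->
    (forall x, m x \in S -> x = 0) -> forall y, y \in S -> y = 0.
Proof.
split=> [me S /closed_submod_prop|me P Pm P0 y Py]; first exact: me.
apply: (me _ (submod_prop_closed Pm)); last exact/asboolP.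
by move=> x /asboolP; apply: P0.
Qed.

Lemma blen_leq a b U : (a <= b)%N -> blen a U -> blen b U.
Proof. by move=> ab aU S Sm Si l; apply: leq_trans (aU S Sm Si l) ab. Qed.

(* Pushout: a module which is a direct summand of every finitely generated
   overmodule is injective. *)
Lemma split_injective E : finitely_generated E ->
  (forall E' (j : {linear E -> E'}), finitely_generated E' -> injective j ->
     exists r : {linear E' -> E}, forall x, r (j x) = x) ->
  injective_module E.
Proof.
move=> Ef split_; split=> // X Y g f Xf Yf gi.
pose P (u : E * Y) := exists x, u = (f x, - g x).
have Pm : submod_prop P.
  split=> [|a _ _ [x ->] [y ->]]; first by exists 0; rewrite !linear0 ?oppr0.
  by exists (a *: x + y); rewrite [f (_ + _)]linearP [g (_ + _)]linearP opprD -scalerN.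
have [Q [p [ps pP]]] := exists_quo Pm.
have inl_lin : linear (fun x : E => p (x, 0)).
  by move=> a x y; rewrite -linearP; congr (p (_, _)); rewrite /= scaler0 addr0.
have inr_lin : linear (fun y : Y => p (0, y)).
  by move=> a x y; rewrite -linearP; congr (p (_, _)); rewrite /= scaler0 addr0.
have [||r rP] := split_ Q (mklin inl_lin).
- apply: (fg_surj ps).
  have l1 : linear (fun x : E => (x, 0) : (E * Y)%type).
    by move=> a x y; congr (_, _); rewrite /= scaler0 addr0.
  apply: (@fg_ext _ _ _ _ (mklin l1) (snd : {linear (E * Y)%type -> Y})) => //.
  split=> [x y [] //|[x y]|y]; last by exists (0, y).
  by split=> [/= ->|[z [_ <-]] //]; exists x.
- apply: inj_ker => x /= /pP[y [-> /eqP]].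
  rewrite eq_sym oppr_eq0 => /eqP/(inj0 gi) ->; exact: linear0.
exists (r \o mklin inr_lin) => x /=.
rewrite -[RHS]rP /=; congr (r _); apply/eqP; rewrite -subr_eq0 -linearB.
apply/eqP/pP; exists (- x); congr (_, _); rewrite /= linearN.
  by rewrite sub0r.
by rewrite subr0 opprK.
Qed.

End Injective.

Section DualizingExists.
Variable k : comNzRingType.
Implicit Types (U V W X Y Z N E J : lmodType k).
Local Notation kk := (k^o : lmodType k).
Hypothesis k_finlen : finlen kk.

Lemma fg_finlen_k N : finitely_generated N -> finlen N.
Proof. exact: fg_finlen. Qed.

Section Bound.
Variables (S : lmodType k) (q : {linear kk -> S}).
Hypotheses (qs : surj q) (qP : forall x, q x = 0 <-> in_radical x).

Lemma khom_simple N E (m : {linear S -> E}) (phi psi : khom N E) :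
  injective m -> essential m -> simple N -> phi != 0 ->
  exists c : k, psi = c *: phi.
Proof.
move=> mi me Ns phi0.
have [x xphi] : exists x, phi x <> 0.
  by apply: contrapT => nx; case/eqP: phi0; apply: lhomP => x; apply: contrapT => ?;
     apply: nx; exists x.
have x0 : x <> 0 by move=> x0; apply: xphi; rewrite x0 linear0.
have Imax := simple_annihilator Ns x0.
have [||c cE] := socle_simple qs qP mi me (z := psi x) Imax xphi.
- by move=> a ax; rewrite -linearZ /= ax linear0.
- by move=> a ax; rewrite -linearZ /= ax linear0.
exists c; apply: lhomP => y; have [d ->] := simple_gen Ns x0 y.
by rewrite khom_scaleE !linearZ /= cE !scalerA mulrC.
Qed.

(** The bound is uniform in the essential extension [E]. Applied to [k] itself, it bounds the length
    of all essential extensions of [S] at once, so that a longest one can be taken. *)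
Lemma khom_bound N : finlen N ->
  exists b, forall E (m : {linear S -> E}), injective m -> essential m -> blen b (khom N E).
Proof.
move: N; apply: finlen_ind.
- move=> U U0; exists 0%N => E m _ _; apply: blen_trivial => f.
  by apply: lhomP => x; rewrite (U0 x) linear0.
- move=> N Ns; exists 1%N => E m mi me.
  have [H0|nH] := pselect (trivial_module (khom N E)).
    exact: blen_leq (blen_trivial H0).
  apply: blen_simple; split=> // P Pm.
  have [P0|nP] := pselect (forall f, P f -> f = 0); [by left | right => psi].
  have [phi Pphi phi0] : exists2 phi, P phi & phi <> 0.
    by apply: contrapT => np; apply: nP => f Pf; apply: contrapT => ?; apply: np; exists f.
  have [|c ->] := @khom_simple N E m phi psi mi me Ns; first exact/eqP.
  exact: submodZ.
- move=> X Y Z i p ip [a aP] [b bP]; exists (b + a)%N => E m mi me.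
  (* Since [E] is not assumed injective, [Hom(-, E)] is only left exact; the right-hand term is
     therefore the image of restriction to [X]. *)
  have [I [e [j [es ji ej]]]] := exists_image (khom_pre E i).
  apply: (@blen_ext _ _ _ _ (khom_pre E p) e _ _ _ (bP E m mi me)); last first.
    exact: blen_inj ji (aP E m mi me).
  split=> // [|f].
    apply: inj_ker => f f0; apply: lhomP => z; have [y <-] := ses_surj ip z.
    by rewrite -khom_preE f0.
  split=> [ef|[g <-]]; last first.
    apply: ji; rewrite ej linear0; apply: lhomP => x.
    by rewrite !khom_preE (ses_comp0 ip) linear0.
  have [|g gP] := ses_cofactor ip (f := f).
    by move=> x; rewrite -khom_preE -ej ef linear0.
  by exists (g : khom Z E); apply: lhomP.
Qed.

Lemma essential_bound :
  exists b, forall E (m : {linear S -> E}), injective m -> essential m -> blen b E.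
Proof.
have [b bP] := khom_bound k_finlen; exists b => E m mi me.
have lx (x : E) : linear (fun a : kk => (a : k) *: x).
  by move=> a u v; rewrite scalerDl scalerA.
have ll : linear (fun x : E => mklin (lx x) : khom kk E).
  move=> a x y; apply: lhomP => c; rewrite lhom_addE khom_scaleE /=.
  by rewrite scalerDr !scalerA mulrC.
apply: (blen_inj (f := mklin ll) _ (bP E m mi me)).
by move=> x y /(congr1 (fun f : khom kk E => f 1)) /=; rewrite !scale1r.
Qed.

(** Among the finitely generated essential extensions of [S], one carrying a chain with the most
    strict steps is injective: any overmodule, cut down by a submodule maximal with zero
    intersection, would be a longer essential extension if it were still bigger. *)
Lemma injective_envelope_top : finitely_generated S ->
  exists J (m : {linear S -> J}), injective_envelope m.
Proof.
move=> Sf; have [b bP] := essential_bound.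
pose Q v := `[< exists E (m : {linear S -> E}) (C : nat -> E -> Prop) l,
  [/\ finitely_generated E, injective m /\ essential m,
      forall i, submod_prop (C i), forall i x, C i x -> C i.+1 x
    & \sum_(i < l) `[< ~ forall x, C i.+1 x -> C i x >] = v] >]%N.
have exQ : exists v, Q v.
  exists 0%N; apply/asboolP; exists S, idfun, (fun _ x => x = 0), 0%N.
  split=> //; last by rewrite big_ord0.
    by split=> // P Pm P0 y Py; apply: P0.
  by move=> i; split=> // a _ _ -> ->; rewrite scaler0 addr0.
have Qb v : Q v -> (v <= b)%N.
  by move=> /asboolP[E [m [C [l [_ [mi me] Cm Ci <-]]]]]; apply: (bP E m mi me).
case: (ex_maxnP exQ Qb) => v /asboolP[E [m [C [l [Ef [mi me] Cm Ci lv]]]]] vmax.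
exists E, m; suff Ei : injective_module E by split=> //; exact: (essentialP m).1 me.
apply: split_injective => // E' j E'f ji.
pose disj (P : E' -> Prop) := submod_prop P /\ forall x, P (j x) -> x = 0.
have [||P [Pm Pj] Pmax] := @acc_maximal _ _ disj (finlen_acc (fg_finlen_k E'f)).
- by move=> P [].
- exists (fun x => x = 0); split=> [|x /(inj0 ji) //].
  by split=> // a _ _ -> ->; rewrite scaler0 addr0.
(* By maximality of [P], the module [S] stays essential in the quotient [F]. If [E] did not fill
   [F], [chain_extend] would beat [vmax]; so [E -> F] is bijective and its inverse gives the
   retraction. *)
have [F [p [ps pP]]] := exists_quo Pm.
have pji : injective (p \o j) by apply: inj_ker => x /= /pP/Pj.
have pjme : essential (p \o j \o m).
  move=> T Tm T0 y Ty.
  have TE x : T (p (j x)) -> x = 0.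
    exact: (me _ (preim_submod (p \o j) Tm)).
  have [z zy] := ps y; rewrite -zy; apply/pP.
  apply: (Pmax (fun z => T (p z))) => [|x Px|]; last by rewrite zy.
    by split; [exact: preim_submod | exact: TE].
  by have /pP -> := Px; apply: submod0 Tm.
have pjs : surj (p \o j).
  apply: contrapT => nps.
  have [C' [C'm C'i lt]] := chain_extend l Cm Ci pji nps.
  have /vmax : Q (\sum_(i < l.+1) `[< ~ forall x, C' i.+1 x -> C' i x >])%N.
    apply/asboolP; exists F, (p \o j \o m), C', l.+1; split=> //.
      exact: fg_surj ps E'f.
    by split=> //; apply: inj_comp pji mi.
  by rewrite leqNgt -lv lt.
have [r rK Kr] := bij_inverse pji pjs.
by exists (r \o p) => x; exact: rK.
Qed.

End Bound.

Lemma dualizing_exists : exists J, is_dualizing J.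
Proof.
have [S [q [qs qP]]] := exists_quo (@radical_submod k).
have kf : finitely_generated kk by exact: finlen_fg.
have [J [m me]] := injective_envelope_top qs qP (fg_surj qs kf).
by exists J, S, m; split=> //; exists q.
Qed.

End DualizingExists.

(** * Duality over the base ring *)

Section DualizingTheory.
Variable k : comNzRingType.
Implicit Types (U V W X Y Z N E : lmodType k).
Local Notation kk := (k^o : lmodType k).
Hypothesis k_finlen : finlen kk.
Variables (J : lmodType k).
Hypothesis J_dual : is_dualizing J.

Lemma dualizing_inj : injective_module J.
Proof. by case: J_dual => S [m [_ []]]. Qed.

Lemma dualizing_socle (I : kk -> Prop) (y z : J) : maxideal I -> y <> 0 ->
  (forall a : k, I a -> a *: y = 0) -> (forall a : k, I a -> a *: z = 0) ->
  exists c : k, z = c *: y.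
Proof.
case: J_dual => S [m [[q qs qP] [_ mi /essentialP me]]].
exact: (socle_simple qs qP mi me).
Qed.

(** Let [L] be minimal among the ideals not contained in [I]. For another maximal ideal [I'] and [b]
    in [I'] but not in [I], the ideal [b L] is still not in [I], so [b L = L] and [L] lies in [I'].
    An element of [L] outside [I] thus has a nonzero class in the top of [k], killed by [I]. *)
Lemma dualizing_nonzero (I : kk -> Prop) : maxideal I ->
  exists2 y : J, y <> 0 & forall a : k, I a -> a *: y = 0.
Proof.
case: J_dual => S [m [[q qs qP] [_ mi _]]] Imax; have [Im I1 _] := Imax.
pose Q (L : kk -> Prop) := submod_prop L /\ exists2 s, L s & ~ I s.
have [||L [Lm [s Ls Is]] Lmin] := @dcc_minimal _ _ Q (finlen_dcc k_finlen).
- by move=> P [].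
- by exists (fun=> True); split=> //; exists 1.
exists (m (q s)) => [/(inj0 mi)/qP/radicalP sr|a Ia].
  by apply: Is; apply: sr.
rewrite -!linearZ (_ : q _ = 0) ?linear0 //; apply/qP/radicalP => // I' Imax'.
have [II'|nII'] := pselect (forall a, I' a -> I a).
  apply: (maxideal_eq Imax' Imax) => //.
  by rewrite -[_ *: _]/(a * s) mulrC; apply: (maxidealM Imax).
have [b I'b nIb] : exists2 b, I' b & ~ I b.
  by apply: contrapT => nb; apply: nII' => b I'b; apply: contrapT => ?; apply: nb; exists b.
apply: (maxidealM Imax').
have [||t _ <-] := Lmin (fun x => exists2 t, L t & (b : k) *: t = x) _ _ s Ls.
- split; first exact: (image_submod (mklin (@homothety_linear k kk b)) Lm).
  exists ((b : k) *: s : kk); first by exists s.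
  by move=> /(maxideal_prime Imax)[].
- by move=> _ [t Lt <-]; apply: submodZ.
by rewrite -[_ *: _]/(b * t) mulrC; apply: (maxidealM Imax').
Qed.

(** The cyclic submodule generated by the class of [x] modulo [P] maps onto the quotient of [k] by
    some maximal ideal, which embeds in [J]; injectivity of [J] extends this map. *)
Lemma dualizing_cogen N (P : N -> Prop) x : finitely_generated N ->
  submod_prop P -> ~ P x ->
  exists f : {linear N -> J}, (forall y, P y -> f y = 0) /\ f x <> 0.
Proof.
move=> Nf Pm Px; have [Q [p [ps pP]]] := exists_quo Pm.
have lx : linear (fun a : kk => (a : k) *: p x).
  by move=> a u v; rewrite scalerDl scalerA.
have [C [e [j [es ji ej]]]] := exists_image (mklin lx).
have [|I Imax annI] := exists_maxideal k_finlen (ker_submod (mklin lx)).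
  by rewrite /= scale1r => /pP.
have [y y0 Iy] := dualizing_nonzero Imax.
have ly : linear (fun a : kk => (a : k) *: y).
  by move=> a u v; rewrite scalerDl scalerA.
have [|g gP] := factor_surj (f := mklin ly) es.
  by move=> a ea; apply: Iy; apply: annI; rewrite -ej ea linear0.
have Qf : finitely_generated Q := fg_surj ps Nf.
have [|h hP] := dualizing_inj.2 _ _ j g _ Qf ji.
  apply: fg_surj es _; exact: finlen_fg.
exists (h \o p); split=> [z /pP pz|/=]; first by rewrite /= pz linear0.
have := ej 1; rewrite /= scale1r => <-; rewrite hP gP /= scale1r.
exact: y0.
Qed.

Lemma dualizing_reflexive N : finlen N ->
  forall theta : {linear khom N J -> J}, exists x, forall f : khom N J, theta f = f x.
Proof.
(* Finite length is part of the statement proved by induction: the induction hypotheses must supply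
   it, since injectivity of [J] concerns finitely generated modules. *)
move=> Nfl; suff [] : finlen N /\
   forall theta : {linear khom N J -> J}, exists x, forall f : khom N J, theta f = f x by [].
move: N Nfl; apply: finlen_ind.
- move=> U U0; split=> [|th]; first exact: finlen_trivial.
  exists 0 => f; rewrite (_ : f = 0) ?linear0 //.
  by apply: lhomP => x; rewrite (U0 x) linear0.
- move=> N Ns; have Nfl : finlen N by exists 1%N; apply: blen_simple.
  split=> // th.
  have [x x0] : exists x : N, x <> 0.
    by apply: contrapT => nx; apply: Ns.1 => x; apply: contrapT => ?; apply: nx; exists x.
  have Imax := simple_annihilator Ns x0.
  have [phi [_ phix]] := dualizing_cogen (finlen_fg Nfl) (ker_submod (idfun : {linear N -> N})) x0.
  have kill (f : khom N J) a : a *: x = 0 -> a *: f = 0.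
    move=> ax; apply: lhomP => y; have [c ->] := simple_gen Ns x0 y.
    by rewrite khom_scaleE -linearZ /= scalerA mulrC -scalerA ax scaler0 linear0.
  have [||c cE] := dualizing_socle (z := th (phi : khom N J)) Imax phix.
  - by move=> a ax; rewrite -linearZ /= ax linear0.
  - by move=> a ax; rewrite -linearZ /= kill // linear0.
  exists (c *: x) => f.
  have [||d dE] := dualizing_socle (z := f x) Imax phix.
  - by move=> a ax; rewrite -linearZ /= ax linear0.
  - by move=> a ax; rewrite -linearZ /= ax linear0.
  have -> : f = d *: (phi : khom N J).
    apply: lhomP => y; have [a ->] := simple_gen Ns x0 y.
    by rewrite khom_scaleE !linearZ /= dE !scalerA mulrC.
  by rewrite linearZ /= cE khom_scaleE [phi (c *: _)]linearZ.
- move=> X Y Z i p ip [Xfl Xr] [Zfl Zr]; have Yfl := finlen_ext ip Xfl Zfl.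
  split=> // th.
  (* On maps factoring through [p], [th] is evaluation at [z], hence at any preimage [y0]. After
     subtracting that evaluation, [th] descends to the dual of [X]. *)
  have [z zP] := Zr (th \o khom_pre J p); have [y0 y0z] := ses_surj ip z.
  have evl : linear (fun f : khom Y J => f y0) by [].
  pose th' := th \- mklin evl.
  have pres : surj (khom_pre J i).
    move=> f; have [g gP] := dualizing_inj.2 _ _ i f (finlen_fg Xfl) (finlen_fg Yfl) (ses_inj ip).
    by exists (g : khom Y J); apply: lhomP.
  have [|tX tXP] := factor_surj (f := th') pres.
    move=> f f0; have [|g gP] := ses_cofactor ip (f := f).
      by move=> x; rewrite -khom_preE f0.
    have -> : f = khom_pre J p (g : khom Z J) by apply: lhomP => y; rewrite khom_preE gP.
    by have := zP (g : khom Z J); rewrite /th' /= => ->; rewrite y0z subrr.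
  have [x xP] := Xr tX; exists (i x + y0) => f.
  have := tXP f; rewrite xP khom_preE /th' /= => fx.
  by rewrite linearD fx subrK.
Qed.

End DualizingTheory.

(** * Modules over an algebra and the duality *)

Section Algebra.
Variables (k : comNzRingType) (B : algType k).
Implicit Types (X Y Z : lmodType B).
Local Notation base X := (restr (in_alg B) X).

Lemma alg_comm (a : k) (b : B) : b * a%:A = a%:A * b.
Proof. by rewrite -scalerAr -scalerAl mul1r mulr1. Qed.

Lemma alg_scale_comm X (a : k) (b : B) (x : X) :
  a%:A *: (b *: x) = b *: (a%:A *: x).
Proof. by rewrite !scalerA alg_comm. Qed.

Fact base_map_linear X Y (f : {linear X -> Y}) : linear (f : base X -> base Y).
Proof. by move=> a x y; rewrite !restr_scaleE linearP. Qed.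
Definition base_map X Y (f : {linear X -> Y}) : {linear base X -> base Y} :=
  mklin (base_map_linear f).

Lemma ses_base X Y Z (i : {linear X -> Y}) (p : {linear Y -> Z}) :
  ses i p -> ses (base_map i) (base_map p).
Proof. by case. Qed.

Lemma submod_base X (P : X -> Prop) : submod_prop P -> submod_prop (P : base X -> Prop).
Proof. by case=> P0 Pl; split=> // a x y; apply: Pl. Qed.

Lemma finlen_base X : finlen (base X : lmodType k) -> finlen X.
Proof.
case=> b bX; exists b => S Sm; apply: (bX S) => i.
exact: submod_base (Sm i).
Qed.

Lemma fg_from_base X : finitely_generated (base X : lmodType k) -> finitely_generated X.
Proof.
move=> [m [g gP]]; exists m, g => x; have [c cE] := gP x.
by exists (fun i => (c i)%:A); exact: cE.
Qed.

Hypothesis B_fg : finitely_generated (B : lmodType k).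

Lemma fg_base X : finitely_generated X -> finitely_generated (base X : lmodType k).
Proof.
move=> [m [g gP]]; have [n [h hP]] := B_fg.
pose G (u : 'I_m * 'I_n) : base X := h u.2 *: g u.1.
pose G' (j : 'I_#|{: 'I_m * 'I_n}|) : base X := G (enum_val j).
exists #|{: 'I_m * 'I_n}|, G' => x; rewrite -/(lspan G' (x : base X)).
have [c cE] := gP x; have [d dE] := choice (fun i => hP (c i)).
have Gm := lspan_submod G'.
rewrite cE; elim/big_ind: _ => [|u v|i _]; [exact: (submod0 Gm)|exact: (submodD Gm)|].
rewrite dE scaler_suml.
elim/big_ind: _ => [|u v|j _]; [exact: (submod0 Gm)|exact: (submodD Gm)|].
have -> : d i j *: h j *: g i = d i j *: G (i, j).
  by rewrite restr_scaleE /G /= scalerA -scalerAl mul1r.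
apply: (submodZ Gm); rewrite -(enum_rankK (i, j)); exact: (lspan_gen G').
Qed.

Hypothesis k_finlen : finlen (k^o : lmodType k).

Lemma finlen_fg_base X : finitely_generated X -> finlen (base X : lmodType k).
Proof. by move/fg_base/(fg_finlen k_finlen). Qed.

Lemma fg_finlen_alg X : finitely_generated X -> finlen X.
Proof. by move/finlen_fg_base/finlen_base. Qed.

Lemma regular_fg (R : pzRingType) : finitely_generated (R^o : lmodType R).
Proof.
exists 1%N, (fun=> 1) => x; exists (fun=> x).
by rewrite big_ord1 /GRing.scale /= mulr1.
Qed.

Lemma alg_finlen : finlen (B^o : lmodType B).
Proof. exact/fg_finlen_alg/regular_fg. Qed.

Lemma fg_sub X Y (i : {linear X -> Y}) : injective i ->
  finitely_generated Y -> finitely_generated X.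
Proof. by move=> ii /fg_finlen_alg/(finlen_inj ii)/finlen_fg. Qed.

End Algebra.

Lemma conv_fg (k : comNzRingType) (B : algType k) :
  finitely_generated (B : lmodType k) -> finitely_generated (B^c : lmodType k).
Proof. by []. Qed.

(** * The transpose and the lifting of maps *)

Section Transpose.
Variables (k : comNzRingType) (B : algType k) (J : lmodType k).
Hypothesis k_finlen : finlen (k^o : lmodType k).
Hypothesis J_dual : is_dualizing J.
Hypothesis B_fg : finitely_generated (B : lmodType k).
Implicit Types (X Y Z : lmodType B).
Local Notation base X := (restr (in_alg B) X).

Lemma transpose_exists (P1 P0 : lmodType B) (d : {linear P1 -> P0}) :
  exists (T : lmodType B^c) (p : {linear rdual P1 -> T}), surj p /\
   forall f : rdual P1, p f = 0 <-> exists g : rdual P0, forall x, f x = g (d x).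
Proof.
apply: (@exists_quo _ (rdual P1)); split=> [|b f h [f' fE] [h' hE]].
  by exists 0.
by exists (b *: f' + h') => x; rewrite !lhom_addE !rdual_scaleE fE hE.
Qed.

(* The cokernel of [Hom(P0, Y) -> Hom(P1, Y)] is [T (x) Y], and its [k]-dual is
   [Hom(Y, D T)].  So if all maps from [X'] to [D T] extend to [X], then
   [T (x) X' -> T (x) X] is injective, and the snake lemma lifts maps. *)
Section Lifts.
Variables (P1 P0 Z : lmodType B) (d : {linear P1 -> P0}) (c : {linear P0 -> Z}).
Variables (T : lmodType B^c) (p : {linear rdual P1 -> T}).
Hypotheses (P1p : projective P1) (P0p : projective P0).
Hypotheses (cs : surj c) (dc : exact_at d c) (ps : surj p).
Hypothesis pP : forall f : rdual P1,
  p f = 0 <-> exists g : rdual P0, forall x, f x = g (d x).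
Variables (X' X X'' : lmodType B) (i : {linear X' -> X}) (r : {linear X -> X''}).
Hypotheses (ir : ses i r) (Xf : finitely_generated X).
Hypothesis iT : extends i (restr (@conv2 k B) (kdual J T)).

(** The class of [g] in the cokernel of [Hom(P0, X') -> Hom(P1, X')] is an element of [T (x) X']
    whose image in [T (x) X] vanishes. If it were nonzero, a functional [la] would detect it; that
    functional is a map from [X'] to [D T], and its extension to [X] forces the value at [g] to be
    0. *)
Lemma transpose_cokernel_inj (g : {linear P1 -> X'}) (h : {linear P0 -> X}) :
  (forall x, i (g x) = h (d x)) -> exists h' : {linear P0 -> X'}, forall x, g x = h' (d x).
Proof.
move=> ig.
have [m [q [e qe]]] := dual_basis P1p; have [m0 [q0 [e0 qe0]]] := dual_basis P0p.
(* A map from [P1] is recorded by its values on the dual basis elements [q j], so that the duality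
   over [k] applies to a finite power of [X']. *)
pose N : lmodType k := {ffun 'I_m -> base X'}.
pose I (v : N) := exists h' : {linear P0 -> X'}, forall j, v j = h' (d (q j)).
have scl (a : k) (f : {linear P0 -> X'}) : linear (fun x => a%:A *: f x).
  by move=> b x y; rewrite linearP scalerDr alg_scale_comm.
have Im : submod_prop I.
  split=> [|a u v [h1 h1E] [h2 h2E]].
    by exists (0 : lhom P0 X') => j; rewrite ffunE.
  exists ((mklin (scl a h1) : lhom P0 X') + (h2 : lhom P0 X')) => j.
  by rewrite !ffunE lhom_addE -h2E /= -h1E.
pose v0 : N := [ffun j => g (q j)].
apply: contrapT => nh.
have Iv0 : ~ I v0.
  move=> [h' h'E]; apply: nh; exists h' => x.
  rewrite [x in LHS]qe [x in RHS]qe !linear_sum; apply: eq_bigr => j _.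
  by have := h'E j; rewrite ffunE !linearZ /= => ->.
have X'f : finitely_generated X' := fg_sub B_fg k_finlen (ses_inj ir) Xf.
have Nf : finitely_generated N.
  by apply/finlen_fg/finlen_ffun/(finlen_fg_base B_fg k_finlen).
have [la [laI lav]] := dualizing_cogen k_finlen J_dual Nf Im Iv0.
have Ll (x : X') : linear (fun f : restr (in_alg B^c) (rdual P1) =>
    la [ffun j => (f : rdual P1) (q j) *: x]).
  move=> a f1 f2; rewrite -linearP; congr (la _); apply/ffunP=> j; rewrite !ffunE.
  rewrite lhom_addE rdual_scaleE scalerDl; congr (_ + _).
  rewrite [RHS]restr_scaleE [RHS]scalerA.
  exact: (congr1 (fun b : B => b *: x) (alg_comm a (f1 (q j)))).
(* Evaluating [la] on the rank one maps [f (-) x] depends only on [p f]: if [p f = 0] then [f], and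
   with it this rank one map, factors through [d]. *)
have exphi (x : X') : exists th : kdual J T, forall f : rdual P1,
    th (p f) = la [ffun j => (f : rdual P1) (q j) *: x].
  have [|th thP] := factor_surj (e := base_map p) (f := mklin (Ll x)) ps.
    move=> f /= /pP[f' f'E]; apply: laI.
    have lh : linear (fun y => (f' y : B) *: x).
      by move=> b y z; rewrite linearP scalerDl scalerA.
    by exists (mklin lh) => j; rewrite ffunE f'E.
  by exists th => f; exact: thP.
have [phi phiP] := choice exphi.
have phil : linear (phi : X' -> restr (@conv2 k B) (kdual J T)).
  move=> b x y; apply: lhomP => t; have [f <-] := ps t.
  transitivity (phi x (p ((b : B^c) *: f)) + phi y (p f)); last first.
    by rewrite linearZ.
  rewrite !phiP -linearD; congr (la _); apply/ffunP=> j; rewrite !ffunE.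
  by rewrite rdual_scaleE scalerDr scalerA.
have [Phi PhiP] := iT (mklin phil).
apply: lav.
(* The dual basis writes [g] as the sum of the rank one maps [e j (-) g (q j)], on which [la] is
   given by [phi]. *)
have -> : v0 = \sum_j [ffun l => (e j (q l) : B) *: g (q j)].
  apply/ffunP=> l; rewrite sum_ffunE ffunE [q l in LHS]qe linear_sum.
  by apply: eq_bigr => j _; rewrite ffunE linearZ.
rewrite linear_sum.
have step j : la [ffun l => (e j (q l) : B) *: g (q j)]
    = \sum_l (Phi (h (q0 l)) : kdual J T) (p ((e0 l (d (q j)) : B^c) *: (e j : rdual P1))).
  rewrite -phiP -[phi _]/(mklin phil (g (q j))) -PhiP ig [d (q j) in LHS]qe0 !linear_sum.
  have sumE (s : seq 'I_m0) (F : 'I_m0 -> restr (@conv2 k B) (kdual J T)) t :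
      (\sum_(l <- s) F l : lhom _ _) t = \sum_(l <- s) (F l : kdual J T) t.
    by elim/big_rec2: _ => // l ? y _ <-.
  rewrite sumE; apply: eq_bigr => l _.
  by rewrite [h (_ *: _)]linearZ [Phi (_ *: _)]linearZ [p (_ *: _)]linearZ.
rewrite (eq_bigr _ (fun j _ => step j)) exchange_big big1 //= => l _.
(* For fixed [l], the sum over [j] of [e j] scaled by the [l]-th coordinate of [d (q j)] is [e0 l]
   composed with [d], hence zero in [T]. *)
rewrite -linear_sum -linear_sum (_ : p _ = 0) ?linear0 //.
apply/pP; exists (e0 l : rdual P0) => x.
transitivity (\sum_(j < m) (e j x : B) * (e0 l (d (q j)) : B)).
  by elim/big_rec2: _ => // j ? y _ <-.
rewrite [x in RHS]qe !linear_sum; apply: eq_bigr => j _.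
by rewrite [d (_ *: _)]linearZ [e0 l (_ *: _)]linearZ.
Qed.

Lemma transpose_lifts : lifts Z r.
Proof.
move=> u; have [h hP] := proj_lift (u \o c) P0p Xf (ses_surj ir).
have [|g gP] := ses_factor ir (f := h \o d).
  move=> x; rewrite /= hP /= (_ : c (d x) = 0) ?linear0 //.
  by apply/dc; exists x.
have [h' h'P] := transpose_cokernel_inj gP.
have [|s sP] := factor_surj (f := h \- (i \o h')) cs.
  by move=> y /dc[x <-]; rewrite /= -h'P gP subrr.
exists s => z; have [y <-] := cs z.
by rewrite sP /= linearB hP (ses_comp0 ir) subr0.
Qed.

End Lifts.
End Transpose.

(** * The base dual as an exact functor on modules *)

Section KDual.
Variables (k : comNzRingType) (B : algType k) (J : lmodType k).
Implicit Types (X Y Z : lmodType B).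
Local Notation base X := (restr (in_alg B) X).

Section Map.
Variables (X Y : lmodType B) (f : {linear X -> Y}).
Let kdual_pre (u : kdual J Y) : kdual J X := (u : {linear base Y -> J}) \o base_map f.
Fact kdual_map_linear : linear kdual_pre.
Proof. by move=> b u v; apply: lhomP => x; rewrite /= /kdual_fun /= linearZ. Qed.
Definition kdual_map : {linear kdual J Y -> kdual J X} := mklin kdual_map_linear.
Lemma kdual_mapE u x : kdual_map u x = u (f x). Proof. by []. Qed.
End Map.

Hypothesis k_finlen : finlen (k^o : lmodType k).
Hypothesis J_dual : is_dualizing J.
Hypothesis B_fg : finitely_generated (B : lmodType k).

Lemma kdual_separates X (P : X -> Prop) x : finitely_generated X ->
  submod_prop P -> ~ P x -> exists f : kdual J X, (forall y, P y -> f y = 0) /\ f x <> 0.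
Proof.
move=> Xf /submod_base Pm Px.
have [f fP] := dualizing_cogen k_finlen J_dual (fg_base B_fg Xf) Pm Px.
by exists f.
Qed.

Lemma kdual_sep X (x y : X) : finitely_generated X ->
  (forall f : kdual J X, f x = f y) -> x = y.
Proof.
move=> Xf fxy; apply: contrapT => xy.
have [||f [_ []]] := @kdual_separates X (fun z => z = 0) (x - y) Xf.
- by split=> // a _ _ -> ->; rewrite scaler0 addr0.
- by move/eqP; rewrite subr_eq0 => /eqP.
- by rewrite linearB fxy subrr.
Qed.

Lemma kdual_reflexive X (th : {linear restr (in_alg B^c) (kdual J X) -> J}) :
  finitely_generated X -> exists x, forall f : kdual J X, th f = f x.
Proof.
move=> Xf; have thl : linear (th : khom (base X) J -> J).
  move=> a u v; rewrite -[RHS](linearP th); congr (th _).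
  by apply: lhomP => x; rewrite lhom_addE khom_scaleE -linearZ.
have [x xP] := dualizing_reflexive k_finlen J_dual (finlen_fg_base B_fg k_finlen Xf) (mklin thl).
by exists x => f; exact: (xP f).
Qed.

Lemma kdual_ses X Y Z (i : {linear X -> Y}) (p : {linear Y -> Z}) :
  ses i p -> finitely_generated Y -> ses (kdual_map p) (kdual_map i).
Proof.
move=> ip Yf; split.
- apply: inj_ker => f f0; apply: lhomP => z; have [y <-] := ses_surj ip z.
  by rewrite -kdual_mapE f0.
- move=> f; split=> [f0|[g <-]]; last first.
    by apply: lhomP => x; rewrite !kdual_mapE (ses_comp0 ip) linear0.
  have [|g gP] := ses_cofactor (ses_base ip) (f := f).
    by move=> x; rewrite -[f _]/(kdual_map i f x) f0.
  by exists (g : kdual J Z); apply: lhomP.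
- move=> f; have [||g gP] := (dualizing_inj J_dual).2 _ _ (base_map i) f _ _ (ses_inj ip).
  + exact/fg_base/(fg_sub B_fg k_finlen (ses_inj ip)).
  + exact: fg_base.
  by exists (g : kdual J Y); apply: lhomP.
Qed.

Lemma kdual_fg X : finitely_generated X -> finitely_generated (kdual J X).
Proof.
move=> Xf; have [m [g gP]] := fg_base B_fg Xf.
pose ev (f : restr (in_alg B^c) (kdual J X)) : {ffun 'I_m -> J} := [ffun j => (f : kdual J X) (g j)].
have evl : linear ev.
  move=> a f h; apply/ffunP=> j; rewrite !ffunE lhom_addE -[X in _ = X + _]linearZ.
  by [].
apply/fg_from_base/finlen_fg/(finlen_inj (f := mklin evl)).
  apply: inj_ker => f /ffunP f0; apply: lhomP => x; have [c ->] := gP x.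
  rewrite linear_sum big1 // => j _; have := f0 j; rewrite !ffunE linearZ => ->.
  exact: scaler0.
apply/finlen_ffun/(fg_finlen k_finlen).
by case: (dualizing_inj J_dual).
Qed.

End KDual.

(** * Duality between left and right modules *)
Section Duality.
Variables (k : comNzRingType) (A : algType k) (J : lmodType k).
Hypothesis k_finlen : finlen (k^o : lmodType k).
Hypothesis J_dual : is_dualizing J.
Hypothesis A_fg : finitely_generated (A : lmodType k).
Implicit Types (X Y Z : lmodType A) (N P K : lmodType A^c).

Definition ddual N : lmodType A := restr (@conv2 k A) (kdual J N).

Lemma ddual_scaleE N (a : A) (f : ddual N) (x : N) :
  ((a *: f : ddual N) : kdual J N) x = (f : kdual J N) ((a : A^c) *: x).
Proof. by []. Qed.

Fact ddual_map_linear N N' (f : {linear N -> N'}) :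
  linear (kdual_map J f : ddual N' -> ddual N).
Proof. by move=> a u v; exact: (linearP (kdual_map J f) (conv2 a)). Qed.
Definition ddual_map N N' (f : {linear N -> N'}) : {linear ddual N' -> ddual N} :=
  mklin (ddual_map_linear f).

Lemma ddual_mapE N N' (f : {linear N -> N'}) (u : ddual N') x :
  (ddual_map f u : kdual J N) x = (u : kdual J N') (f x).
Proof. by []. Qed.

Lemma ddual_fg N : finitely_generated N -> finitely_generated (ddual N).
Proof. by move=> /(kdual_fg k_finlen J_dual (conv_fg A_fg)). Qed.

Lemma ddual_ses N N' N'' (i : {linear N -> N'}) (p : {linear N' -> N''}) :
  ses i p -> finitely_generated N' -> ses (ddual_map p) (ddual_map i).
Proof. by move=> ip Nf; case: (kdual_ses k_finlen J_dual (conv_fg A_fg) ip Nf). Qed.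

(** A balanced pairing of [X] and [N] with values in [J], read from either side: maps from [X] to
    [D N] correspond to maps from [N] to [D X]. With [swap_from] this turns extension problems over
    [A] into lifting problems over the opposite algebra. *)
Lemma swap_to X N (f : {linear X -> ddual N}) :
  exists g : {linear N -> kdual J X}, forall n x, g n x = (f x : kdual J N) n.
Proof.
have fl (n : N) : linear (fun x : restr (in_alg A) X => (f x : kdual J N) n).
  move=> a x y; rewrite restr_scaleE linearP lhom_addE ddual_scaleE.
  by rewrite -[X in _ = X + _]linearZ.
have gl : linear (fun n : N => mklin (fl n) : kdual J X).
  by move=> b n n'; apply: lhomP => x; rewrite lhom_addE kdual_scaleE /= linearD linearZ.
by exists (mklin gl).
Qed.

Lemma swap_from X N (g : {linear N -> kdual J X}) :
  exists f : {linear X -> ddual N}, forall n x, (f x : kdual J N) n = g n x.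
Proof.
have gl (x : X) : linear (fun n : restr (in_alg A^c) N => g n x).
  move=> a n n'; rewrite restr_scaleE linearP lhom_addE kdual_scaleE.
  by rewrite -[X in _ = X + _]linearZ.
have fl : linear (fun x : X => mklin (gl x) : ddual N).
  move=> a x y; apply: lhomP => n.
  by rewrite lhom_addE ddual_scaleE /= linearD linearZ.
by exists (mklin fl).
Qed.

Lemma ev_ddual X : finitely_generated X ->
  exists e : {linear X -> ddual (kdual J X)}, [/\ injective e, surj e &
    forall x f, (e x : @kdual k A^c J (kdual J X)) f = f x].
Proof.
move=> Xf; have [e eE] := swap_from (idfun : {linear kdual J X -> kdual J X}).
exists e; split=> // [x y exy|th].
  by apply: (kdual_sep k_finlen J_dual A_fg Xf) => f; rewrite -[LHS](eE f) exy eE.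
have [x xP] := kdual_reflexive k_finlen J_dual A_fg (th : @kdual k A^c J (kdual J X)) Xf.
by exists x; apply: lhomP => f; rewrite eE xP.
Qed.

Lemma ev_kdual N : finitely_generated N ->
  exists e : {linear N -> kdual J (ddual N)}, [/\ injective e, surj e &
    forall n (f : ddual N), e n f = (f : kdual J N) n].
Proof.
move=> Nf; have [e eE] := swap_to (idfun : {linear ddual N -> ddual N}).
exists e; split=> // [x y exy|th].
  apply: (kdual_sep k_finlen J_dual (conv_fg A_fg) Nf) => f.
  by rewrite -[LHS](eE _ (f : ddual N)) exy eE.
have thl : linear (th : restr (in_alg (A^c)^c) (kdual J N) -> J).
  by move=> a u v; exact: (linearP (th : {linear restr (in_alg A) (ddual N) -> J})).
have [x xP] := kdual_reflexive k_finlen J_dual (conv_fg A_fg) (mklin thl) Nf.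
by exists x; apply: lhomP => f; rewrite eE -xP.
Qed.

Section HomExact.
Variables (M X' X X'' : lmodType A) (i : {linear X' -> X}) (p : {linear X -> X''}).
Hypotheses (ip : ses i p) (Mf : finitely_generated M) (Xf : finitely_generated X).

Lemma extends_dual_lifts : extends i M -> lifts (kdual J M) (kdual_map J i).
Proof.
move=> iM g; have [f fE] := swap_from g.
have [e [ei es eE]] := ev_ddual Mf; have [e' eK Ke] := bij_inverse ei es.
have [h hP] := iM (e' \o f); have [G GE] := swap_to (e \o h).
by exists G => u; apply: lhomP => x; rewrite kdual_mapE GE /= hP /= Ke fE.
Qed.

Lemma dual_lifts_extends : lifts (kdual J M) (kdual_map J i) -> extends i M.
Proof.
move=> Mi f; have [G GP] := Mi (kdual_map J f); have [F FE] := swap_from G.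
have [e [ei es eE]] := ev_ddual Mf; have [e' eK Ke] := bij_inverse ei es.
exists (e' \o F) => x /=; apply: ei; rewrite Ke; apply: lhomP => u.
by rewrite FE -kdual_mapE GP kdual_mapE eE.
Qed.

Lemma lifts_dual_extends : lifts M p -> extends (kdual_map J p) (kdual J M).
Proof.
move=> Mp f; have [g gE] := swap_from f.
have Xf'' := fg_surj (ses_surj ip) Xf.
have [e [ei es eE]] := ev_ddual Xf''; have [e' eK Ke] := bij_inverse ei es.
have [h hP] := Mp (e' \o g); exists (kdual_map J h) => u; apply: lhomP => x.
by rewrite !kdual_mapE hP /= -eE Ke gE.
Qed.

End HomExact.

Lemma ddual_injective P : projective P -> injective_module (ddual P).
Proof.
move=> Pp; split=> [|X Y g f Xf Yf gi]; first exact/ddual_fg/proj_fg.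
have [Z [p gp]] := exists_coker gi.
have [h hE] := swap_to f.
have [H HP] := proj_lift h Pp (kdual_fg k_finlen J_dual A_fg Yf)
  (ses_surj (kdual_ses k_finlen J_dual A_fg gp Yf)).
have [F FE] := swap_from H; exists F => x; apply: lhomP => n.
by rewrite FE -kdual_mapE HP hE.
Qed.

Lemma ddual_envelope P N (c : {linear P -> N}) : projective_cover c ->
  injective_envelope (ddual_map c).
Proof.
move=> [Pp cs csup]; split; first exact: ddual_injective.
  apply: inj_ker => f f0; apply: lhomP => n; have [x <-] := cs n.
  by rewrite -[LHS](ddual_mapE c f x) f0.
apply: (essentialP _).1 => S Sm S0 s Ss.
have Pf := proj_fg Pp.
pose perp (x : P) := forall s : kdual J P, S s -> s x = 0.
have perpm : submod_prop perp.
  split=> [u _|b x y x0 y0 u Su]; first by rewrite linear0.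
  rewrite linearD y0 // addr0 -[LHS](ddual_scaleE (b : A) (u : ddual P) x).
  by apply: x0; apply: (submodZ Sm).
suff perpT x : perp x by apply: lhomP => x; apply: perpT.
suff : x \in [pred x | `[< perp x >]] by move/asboolP.
apply: csup x; first exact: submod_prop_closed.
move=> x; pose W (y : P) := exists u v : P, [/\ perp u, c v = 0 & y = u + v].
suff [u [v [pu v0 ->]]] : W x by exists u, v; split=> //; apply/asboolP.
have Wm : submod_prop W.
  split=> [|b _ _ [u [v [pu v0 ->]]] [u' [v' [pu' v0' ->]]]].
    by exists 0, 0; rewrite linear0 addr0; split=> //; apply: submod0 perpm.
  exists (b *: u + u'), (b *: v + v'); split; first exact: perpm.2.
    by rewrite linearP v0 v0' scaler0 addr0.
  by rewrite scalerDr addrACA.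
apply: contrapT => Wx.
have [f [fW fx]] := kdual_separates k_finlen J_dual (conv_fg A_fg) Pf Wm Wx.
apply: fx; have [K [j jc]] := exists_ker cs.
have [|phi phiE] := ses_cofactor (ses_base jc) (f := f).
  move=> y; apply: fW; exists 0, (j y); split; rewrite ?add0r //.
    exact: submod0 perpm.
  exact: (ses_comp0 jc).
have fE : ddual_map c (phi : kdual J N) = f by apply: lhomP => y; exact: phiE.
suff Sf : S (ddual_map c (phi : kdual J N)).
  by rewrite -fE (S0 _ Sf) linear0.
(* Double annihilator: a functional on [D P] separating [f] from [S] is, by reflexivity, evaluation
   at some [y]. This [y] lies in [perp], where [f] vanishes. *)
apply: contrapT => nSf.
have Df : finitely_generated (kdual J P) := kdual_fg k_finlen J_dual (conv_fg A_fg) Pf.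
have [th [thS thf]] := kdual_separates k_finlen J_dual (conv_fg (conv_fg A_fg)) Df
  (P := fun u : kdual J P => S u) Sm nSf.
have [y yP] := kdual_reflexive k_finlen J_dual (conv_fg A_fg) th Pf.
apply: thf; rewrite yP fE; apply: fW; exists y, 0; split; rewrite ?linear0 ?addr0 //.
by move=> u Su; rewrite -yP thS.
Qed.

(** The inverse translate of [ddual J N] is defined through the transpose of its dual; this carries
    a minimal presentation of [N] over to that double dual. *)
Lemma kdual_presentation P1 P0 N (d : {linear P1 -> P0}) (c : {linear P0 -> N})
    K (c1 : {linear P1 -> K}) (m : {linear K -> P0}) (e : {linear N -> kdual J (ddual N)}) :
  projective_cover c -> projective_cover c1 -> ses m c -> injective e -> surj e ->
  (forall x, d x = m (c1 x)) -> minimal_presentation d (e \o c).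
Proof.
move=> [P0p cs csup] c1p mc ei es dE; split.
  split=> // [y|S Sm SP]; first by have [x <-] := es y; have [z <-] := cs x; exists z.
  apply: csup => // x; have [u [v [uS v0 ->]]] := SP x; exists u, v; split=> //.
  exact: (inj0 ei).
exists K, c1, m; split=> //; first exact: (ses_inj mc).
move=> y; split=> [/(inj0 ei)/(ses_ex mc) //|[x <-] /=].
by rewrite (ses_comp0 mc) linear0.
Qed.

End Duality.

(** * Gorenstein projective resolutions and vanishing of Ext *)

Section ExtVanishing.
Variables (R : pzRingType) (L : lmodType R).
Implicit Types (U V W X Y Z N E G K P Q : lmodType R).

(* [ext_ex j N] and [ext_all j N] both say [Ext^(j + 1)(N, L) = 0], computed by
   some, respectively every, choice of syzygies. *)
Fixpoint ext_ex (j : nat) N : Prop :=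
  exists K P (m : {linear K -> P}) (c : {linear P -> N}),
    [/\ projective P, ses m c & if j is j'.+1 then ext_ex j' K else extends m L].

Fixpoint ext_all (j : nat) N : Prop :=
  forall K P (m : {linear K -> P}) (c : {linear P -> N}),
    projective P -> ses m c -> if j is j'.+1 then ext_all j' K else extends m L.

Lemma ext_ex_fg j N : ext_ex j N -> finitely_generated N.
Proof.
by case: j => [|j] [K [P [m [c [/proj_fg Pf /ses_surj cs _]]]]]; apply: fg_surj Pf.
Qed.

Lemma ses_iso X Y Z Z' (i : {linear X -> Y}) (p : {linear Y -> Z})
    (f : {linear Z -> Z'}) : ses i p -> injective f -> surj f -> ses i (f \o p).
Proof.
move=> [ii ex ps] fi fs; split=> // [y|z].
  by split=> [/= /(inj0 fi)/ex //|/ex /= ->]; rewrite linear0.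
by have [y <-] := fs z; have [x <-] := ps y; exists x.
Qed.

Lemma ext_ex_iso j N N' : isomorphic N N' -> ext_ex j N -> ext_ex j N'.
Proof.
case/isomorphic_inverse=> f [g [fg gf]].
have fi : injective f := can_inj fg.
have fs : surj f by move=> y; exists (g y).
case: j => [|j] [K [P [m [c [Pp mc H]]]]]; exists K, P, m, (f \o c);
  by split=> //; apply: ses_iso.
Qed.

Section Schanuel.
Variables (N K P K' P' : lmodType R).
Variables (m : {linear K -> P}) (c : {linear P -> N}).
Variables (m' : {linear K' -> P'}) (c' : {linear P' -> N}).
Hypotheses (Pp : projective P) (Pp' : projective P').
Hypotheses (mc : ses m c) (mc' : ses m' c').

Lemma schanuel : isomorphic (K * P')%type (K' * P)%type.
Proof.
have [a aE] := proj_lift c Pp (proj_fg Pp') (ses_surj mc').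
have [b bE] := proj_lift c' Pp' (proj_fg Pp) (ses_surj mc).
have xl : linear (fun u : K * P' => m u.1 - b u.2).
  by move=> r u v /=; rewrite [m _]linearP [b _]linearP opprD addrACA -scalerBr.
have gl : linear (fun u : K * P' => a (m u.1 - b u.2) + u.2).
  move=> r u v; rewrite -[m (r *: u + v).1 - _]/(mklin xl (r *: u + v)) linearP.
  by rewrite /= linearP scalerDr addrACA.
have [|g gE] := ses_factor mc' (f := mklin gl).
  by move=> u /=; rewrite linearD aE linearB (ses_comp0 mc) sub0r bE addNr.
have fl : linear (fun u : K * P' => (g u, m u.1 - b u.2) : (K' * P)%type).
  move=> r u v; congr (_, _); first exact: linearP.
  exact: (linearP (mklin xl)).
apply: (@bij_isomorphic _ _ _ (mklin fl)).
  apply: inj_ker => -[x y] [g0 x0]; have := gE (x, y).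
  rewrite g0 linear0 /= x0 linear0 add0r => y0; move: x0; rewrite -y0 linear0 subr0.
  by move=> /(inj0 (ses_inj mc)) ->.
move=> [x' y]; pose z := m' x' - a y.
have [|x xE] := ses_ex mc (y := y + b z).
  by rewrite linearD bE linearB (ses_comp0 mc') sub0r aE subrr.
exists (x, z); congr (_, _); last by rewrite /= xE addrK.
by apply: (ses_inj mc'); rewrite gE /= xE addrK addrC subrK.
Qed.

Lemma extends_indep : extends m L -> extends m' L.
Proof.
move=> mL f.
have [a aE] := proj_lift c Pp (proj_fg Pp') (ses_surj mc').
have [b bE] := proj_lift c' Pp' (proj_fg Pp) (ses_surj mc).
have [|k kE] := ses_factor mc' (f := a \o m).
  by move=> x; rewrite /= aE (ses_comp0 mc).
have [|l lE] := ses_factor mc' (f := idfun \- (a \o b)).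
  by move=> x; rewrite /= linearB aE bE subrr.
have [u uE] := mL (f \o k).
exists ((u \o b : lhom _ _) + (f \o l : {linear P' -> L}) : lhom _ _) => x.
have [|x' x'E] := ses_ex mc (y := b (m' x)); first by rewrite bE (ses_comp0 mc').
rewrite lhom_addE /= -x'E uE /= -linearD; congr (f _); apply: (ses_inj mc').
by rewrite linearD kE lE /= x'E subrKC.
Qed.

End Schanuel.

Lemma prod_in_lin X Y : linear (fun x : X => (x, 0) : (X * Y)%type).
Proof. by move=> a x y; congr (_, _); rewrite /= scaler0 addr0. Qed.

Definition prod_in X Y : {linear X -> (X * Y)%type} := mklin (@prod_in_lin X Y).

Lemma ses_prod N K Q P (m : {linear K -> Q}) (c : {linear Q -> N}) : ses m c ->
  exists c' : {linear (Q * P)%type -> (N * P)%type}, ses (prod_in Q P \o m) c'.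
Proof.
move=> mc; have cl : linear (fun u : Q * P => (c u.1, u.2) : (N * P)%type).
  by move=> a u v; congr (_, _); rewrite /= linearP.
exists (mklin cl); split.
- by move=> x y [] /(ses_inj mc).
- move=> [x y]; split=> [[/(ses_ex mc)[z <-] ->]|[z [<- <-]]]; first by exists z.
  by congr (_, _); apply: (ses_comp0 mc).
- by move=> [x y]; have [z <-] := ses_surj mc x; exists (z, y).
Qed.

Lemma ext_all_summand j N P : projective P -> ext_all j (N * P)%type -> ext_all j N.
Proof.
move=> Pp; case: j => [|j] H K Q m c Qp mc; have [c' mc'] := ses_prod P mc;
  have := H _ _ _ _ (projective_prod Qp Pp) mc' => //.
by move=> E f; have [g gE] := E f; exists (g \o prod_in Q P).
Qed.

Lemma ext_ex_prod j N P : projective P -> ext_ex j N -> ext_ex j (N * P)%type.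
Proof.
move=> Pp; case: j => [|j] [K [Q [m [c [Qp mc H]]]]]; have [c' mc'] := ses_prod P mc;
  exists K, (Q * P)%type, (prod_in Q P \o m), c'; split=> //.
- exact: projective_prod.
- by move=> f; have [g gE] := H f; exists (g \o fst) => x /=.
- exact: projective_prod.
Qed.

(** Two syzygies become isomorphic after adding projectives (Schanuel). The existential form
    survives adding a projective, and the universal form passes to the summand left after removing
    one. *)
Lemma ext_ex_all j N : ext_ex j N -> ext_all j N.
Proof.
elim: j N => [|j IH] N [K [P [m [c [Pp mc H]]]]] K' P' m' c' Pp' mc'.
  exact: (extends_indep Pp Pp' mc mc').
apply: (ext_all_summand Pp); apply: IH.
by apply: ext_ex_iso (schanuel Pp Pp' mc mc') _; apply: ext_ex_prod.
Qed.

Lemma horseshoe X' X X'' (i : {linear X' -> X}) (p : {linear X -> X''})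
    K' P' (m' : {linear K' -> P'}) (c' : {linear P' -> X'})
    K'' P'' (m'' : {linear K'' -> P''}) (c'' : {linear P'' -> X''}) :
  ses i p -> finitely_generated X -> projective P'' -> ses m' c' -> ses m'' c'' ->
  exists K (m : {linear K -> (P' * P'')%type}) (c : {linear (P' * P'')%type -> X})
    (u : {linear K' -> K}) (v : {linear K -> K''}),
    [/\ ses m c, ses u v, forall x, m (u x) = (m' x, 0) & forall x, (m x).2 = m'' (v x)].
Proof.
move=> ip Xf Pp'' mc' mc''.
have [s sE] := proj_lift c'' Pp'' Xf (ses_surj ip).
have cl : linear (fun u : P' * P'' => i (c' u.1) + s u.2).
  by move=> a u v /=; rewrite !linearP scalerDr addrACA.
have cs : surj (mklin cl).
  move=> x; have [y yE] := ses_surj mc'' (p x).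
  have [|x' x'E] := ses_ex ip (y := x - s y); first by rewrite linearB sE yE subrr.
  by have [z zE] := ses_surj mc' x'; exists (z, y); rewrite /= zE x'E subrK.
have [K [m mc]] := exists_ker cs.
have m0 x : i (c' (m x).1) + s (m x).2 = 0 := ses_comp0 mc x.
have [|v vE] := ses_factor mc'' (f := snd \o m).
  by move=> x; rewrite /= -sE -[RHS](linear0 p) -(m0 x) linearD (ses_comp0 ip) add0r.
have [|u uE] := ses_factor mc (f := prod_in P' P'' \o m').
  by move=> x; rewrite /= (ses_comp0 mc') !linear0 addr0.
exists K, m, (mklin cl), u, v; split=> [//||x|x]; [|by rewrite uE|by rewrite vE].
split.
- by move=> x y /(congr1 m); rewrite !uE => -[] /(ses_inj mc').
- move=> y; split=> [y0|[x <-]]; last first.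
    by apply: (ses_inj mc''); rewrite vE /= uE linear0.
  have y2 : (m y).2 = 0 by have := vE y; rewrite y0 linear0.
  have := m0 y; rewrite y2 linear0 addr0 => /(inj0 (ses_inj ip))/(ses_ex mc')[x xE].
  by exists x; apply: (ses_inj mc); rewrite uE /= xE -y2; case: (m y).
- move=> z; have [|x' x'E] := ses_ex ip (y := - s (m'' z)).
    by rewrite linearN sE (ses_comp0 mc'') oppr0.
  have [w wE] := ses_surj mc' x'.
  have [|y yE] := ses_ex mc (y := (w, m'' z)); first by rewrite /= wE x'E addNr.
  by exists y; apply: (ses_inj mc''); rewrite vE /= yE.
Qed.

Lemma ext_ex_ext j X' X X'' (i : {linear X' -> X}) (p : {linear X -> X''}) :
  ses i p -> ext_ex j X' -> ext_ex j X'' -> ext_ex j X.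
Proof.
elim: j X' X X'' i p => [|j IH] X' X X'' i p ip H' H'';
  have Xf := fg_ext ip (ext_ex_fg H') (ext_ex_fg H'');
  move: H' H'' => [K' [P' [m' [c' [Pp' mc' H']]]]] [K'' [P'' [m'' [c'' [Pp'' mc'' H'']]]]];
  have [K [m [c [u [v [mc uv mu mv]]]]]] := horseshoe ip Xf Pp'' mc' mc'';
  exists K, (P' * P'')%type, m, c; split=> //; try exact: projective_prod; last first.
  exact: IH uv H' H''.
move=> f; have [g gE] := H' (f \o u).
have [|h hE] := ses_cofactor uv (f := f \- (g \o fst \o m)).
  by move=> x; rewrite /= mu gE subrr.
have [l lE] := H'' h.
exists ((g \o fst : lhom _ _) + (l \o snd : {linear (P' * P'')%type -> L}) : lhom _ _) => x.
by rewrite lhom_addE /= mv lE hE /= addrC subrK.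
Qed.

(** Covering [N] through a cover of [G], the syzygy of [N] is an extension of [N'] by the syzygy of
    [G], so [ext_ex_ext] applies. *)
Lemma ext_ex_shift j N' G N (i : {linear N' -> G}) (p : {linear G -> N}) :
  ses i p -> ext_ex j N' -> ext_ex j.+1 G -> ext_ex j.+1 N.
Proof.
move=> ip H' [K [P [m [c [Pp mc HK]]]]].
have pcs : surj (p \o c).
  by move=> z; have [y <-] := ses_surj ip z; have [x <-] := ses_surj mc y; exists x.
have [KN [n nc]] := exists_ker pcs.
have [|v vE] := ses_factor ip (f := c \o n); first exact: (ses_comp0 nc).
have [|u uE] := ses_factor nc (f := m); first by move=> x; rewrite /= (ses_comp0 mc) linear0.
exists KN, P, n, (p \o c); split=> //; apply: (ext_ex_ext (i := u) (p := v)) => //.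
split.
- by move=> x y /(congr1 n); rewrite !uE => /(ses_inj mc).
- move=> y; split=> [y0|[x <-]].
    have [|x xE] := ses_ex mc (y := n y); first by rewrite -[c _]vE y0 linear0.
    by exists x; apply: (ses_inj nc); rewrite uE.
  by apply: (ses_inj ip); rewrite vE /= uE (ses_comp0 mc) linear0.
- move=> z; have [x xE] := ses_surj mc (i z).
  have [|y yE] := ses_ex nc (y := x); first by rewrite /= xE (ses_comp0 ip).
  by exists y; apply: (ses_inj ip); rewrite vE /= yE.
Qed.

End ExtVanishing.

(** * Gorenstein projective modules and their resolutions *)

Section Gorenstein.
Variable R : pzRingType.
Implicit Types (X Y Z N G : lmodType R).
Local Notation RR := (R^o : lmodType R).

(** The kernel of [P (i + 1) -> G] is again an image in the same complex, one place further left, so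
    the induction moves [i] along. In the last step a map from this kernel to [R], pulled back to
    [P (i + 1 + 1)], extends by exactness under [Hom(-, R)]. *)
Lemma gorenstein_ext_ex j G : gorenstein_projective G -> ext_ex RR j G.
Proof.
move=> [P [d [i [m [[Pp dex dR] mi mP]]]]].
have [c cE] : exists c : {linear P (i + 1) -> G}, forall x, m (c x) = d i x.
  by apply: factor_inj => // x; apply/mP; exists x.
have cs : surj c.
  move=> x; have /mP[y yE] : exists x', m x' = m x by exists x.
  by exists y; apply: mi; rewrite cE.
elim: j i G m mi mP c cE cs => [|j IH] i G m mi mP c cE cs;
  have [K [n nc]] := exists_ker cs; exists K, (P (i + 1)), n, c; split=> //;
  have [c' c'E] : exists c' : {linear P (i + 1 + 1) -> K}, forall x, n (c' x) = d (i + 1) x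
    by (apply: (ses_factor nc) => x; apply: (inj0 mi); rewrite cE; apply/dex; exists x).
all: have nP y : (exists x, n x = y) <-> (exists x, d (i + 1) x = y).
all: try by split=> [[x <-]|/dex dy]; [apply/dex; rewrite -cE (ses_comp0 nc) linear0
  | apply: (ses_ex nc); apply: (inj0 mi); rewrite cE].
all: have c's : surj c' by move=> x; have /nP[y yE] : exists x', n x' = n x by [exists x];
  exists y; apply: (ses_inj nc); rewrite c'E.
- move=> f; have [|g gE] := dR (i + 1) (f \o c').
    move=> x; rewrite /= (_ : c' _ = 0) ?linear0 //; apply: (inj0 (ses_inj nc)).
    by rewrite c'E; apply/dex; exists x.
  exists g => z; have [x <-] := c's z.
  by rewrite c'E -gE.
- exact: IH (ses_inj nc) nP c' c'E c's.
Qed.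

(** Dimension shifting: the kernel of the augmentation has a resolution one step shorter. As
    [ext_ex j] concerns degree [j + 1], the bound is [l <= j]. *)
Lemma gproj_resolution_ext_ex N l j : gproj_resolution N l -> (l <= j)%N -> ext_ex RR j N.
Proof.
elim: l j N => [|l IH] j N [G [d [e [Gp G0 es de dd]]]].
  move=> _; apply: ext_ex_iso (gorenstein_ext_ex j (Gp 0%N)).
  apply: (bij_isomorphic (f := e)) => //.
  by apply: inj_ker => x /de[y <-]; rewrite (G0 1%N _ y) // linear0.
case: j => // j lj; have [K [i ie]] := exists_ker es.
have [e' e'E] : exists e' : {linear G 1%N -> K}, forall x, i (e' x) = d 0%N x.
  by apply: (ses_factor ie) => x; apply/de; exists x.
apply: (ext_ex_shift ie); last exact: gorenstein_ext_ex.
apply: IH lj.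
exists (fun q => G q.+1), (fun q => d q.+1), e'; split=> // [q ql|x|x].
- by apply: G0.
- have [|y yE] := (de (i x)).1; first exact: (ses_comp0 ie).
  by exists y; apply: (ses_inj ie); rewrite e'E.
- rewrite -(dd 0%N) -e'E; split=> [->|/(inj0 (ses_inj ie)) //].
  exact: linear0.
Qed.

Lemma gproj_resolution_ses N' G N (i : {linear N' -> G}) (p : {linear G -> N}) l :
  ses i p -> gorenstein_projective G -> gproj_resolution N' l -> gproj_resolution N l.+1.
Proof.
move=> ip Gp [H [d [e [Hp H0 es de dd]]]].
pose G' q := if q is q'.+1 then H q' else G.
pose d' q : {linear G' q.+1 -> G' q} :=
  match q with 0%N => i \o e | q'.+1 => d q' end.
exists G', d', p; split=> [[]//|[|q]//|||[|q]].
- exact: H0.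
- exact: ses_surj ip.
- move=> y; split=> [/(ses_ex ip)[x <-]|[x <-]]; last exact: (ses_comp0 ip).
  by have [z <-] := es x; exists z.
- move=> y; split=> [/(inj0 (ses_inj ip))/de[x <-]|[x <-]]; first by exists x.
  by rewrite /= (_ : e _ = 0) ?linear0 //; apply/de; exists x.
- exact: dd.
Qed.

(** A resolution lists a Gorenstein projective module in every degree, so even length 0 requires a
    trivial one to fill the positive degrees. *)
Lemma gproj_resolution0 N Z : trivial_module Z -> gorenstein_projective Z ->
  gorenstein_projective N -> gproj_resolution N 0.
Proof.
move=> Z0 Zp Np; pose G q : lmodType R := if q is q'.+1 then Z else N.
pose z0 (U : lmodType R) : {linear Z -> U} := (0 : lhom Z U).
pose d q : {linear G q.+1 -> G q} := z0 (G q).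
exists G, d, idfun; split=> [[]//|[|q]//|y|y|q y].
- by exists y.
- by split=> [/= ->|[x <-] //]; exists 0.
- by split=> [_|_ //]; exists 0; rewrite (Z0 y).
Qed.

End Gorenstein.

(** * The functor [Hom(M, -)] *)

Section Summands.
Variables (R : pzRingType) (M : lmodType R).
Implicit Types (X Y Z N : lmodType R).

(* [Y] is a direct summand of a finite power of [M]. *)
Definition addp Y : Prop :=
  exists (m : nat) (s : 'I_m -> {linear M -> Y}) (t : 'I_m -> {linear Y -> M}),
    forall y, y = \sum_j s j (t j y).

Lemma lhom_sumE X Y I (r : seq I) (F : I -> lhom X Y) x :
  (\sum_(j <- r) F j) x = \sum_(j <- r) F j x.
Proof. by elim/big_rec2: _ => // j y f _ <-. Qed.

Fact ffun_single_linear m (j : 'I_m) :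
  linear (fun x : M => [ffun l => if l == j then x else 0] : {ffun 'I_m -> M}).
Proof.
move=> a x y; apply/ffunP=> l; rewrite !ffunE.
by case: (l == j); rewrite ?scaler0 ?addr0.
Qed.
Definition ffun_single m (j : 'I_m) : {linear M -> {ffun 'I_m -> M}} :=
  mklin (ffun_single_linear j).

Lemma ffun_singleE m (x : {ffun 'I_m -> M}) : x = \sum_j ffun_single j (x j).
Proof.
apply/ffunP=> l; rewrite sum_ffunE (bigD1 l) //= !ffunE eqxx big1 ?addr0 // => j jl.
by rewrite ffunE eq_sym (negPf jl).
Qed.

Lemma in_add_addp Y : in_add M Y -> addp Y.
Proof.
move=> [m [Z /isomorphic_inverse[f [g [fg gf]]]]].
have sl j : linear (fun x : M => (g (ffun_single j x)).1).
  by move=> a x y; rewrite linearP linearP.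
have tl j : linear (fun y : Y => f (y, 0) j).
  move=> a x y; rewrite (_ : (a *: x + y, 0) = a *: (x, 0 : Z) + (y, 0)).
    by rewrite linearP !ffunE.
  by congr (_, _); rewrite /= scaler0 addr0.
exists m, (fun j => mklin (sl j)), (fun j => mklin (tl j)) => y.
rewrite -[y in LHS]/((y, 0 : Z).1) -[(y, 0)]fg {1}[f _]ffun_singleE linear_sum.
by elim/big_rec2: _ => // j u v _ <-.
Qed.

Lemma ffun0_trivial : trivial_module ({ffun 'I_0 -> M} : lmodType R).
Proof. by move=> x; apply/ffunP=> -[]. Qed.

Lemma in_add_ffun m : in_add M ({ffun 'I_m -> M} : lmodType R).
Proof.
exists m, ({ffun 'I_0 -> M} : lmodType R).
apply: (bij_isomorphic (f := fst)) => [|x]; last by exists (x, 0).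
by apply: inj_ker => -[x y] /= ->; rewrite (ffun0_trivial y).
Qed.

Lemma in_add_iso X : isomorphic M X -> in_add M X.
Proof.
case/isomorphic_inverse=> f [g [fg gf]].
exists 1%N, ({ffun 'I_0 -> M} : lmodType R).
have hl : linear (fun u : X * {ffun 'I_0 -> M} => [ffun=> g u.1] : {ffun 'I_1 -> M}).
  by move=> a u v; apply/ffunP=> j; rewrite !ffunE linearP.
apply: (bij_isomorphic (f := mklin hl)) => [|y].
  apply: inj_ker => -[x y] /ffunP/(_ ord0); rewrite !ffunE /= => gx.
  by rewrite -[x]gf gx linear0 (ffun0_trivial y).
exists (f (y ord0), 0); apply/ffunP=> j; rewrite ffunE /= fg.
by rewrite (ord1 j).
Qed.

Lemma addp_fg Y : finitely_generated M -> addp Y -> finitely_generated Y.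
Proof.
move=> [q [g gP]] [m [s [t stE]]].
pose G (u : 'I_m * 'I_q) := s u.1 (g u.2).
pose G' (l : 'I_#|{: 'I_m * 'I_q}|) := G (enum_val l).
exists #|{: 'I_m * 'I_q}|, G' => y; rewrite -/(lspan G' y).
have Gm := lspan_submod G'.
rewrite [y]stE; apply: (submod_sum Gm) => j _; have [c ->] := gP (t j y).
rewrite linear_sum; apply: (submod_sum Gm) => l _; rewrite linearZ.
apply: (submodZ Gm); rewrite -[s j (g l)]/(G (j, l)) -(enum_rankK (j, l)).
exact: (lspan_gen G').
Qed.

Lemma lifts_addp X X'' (p : {linear X -> X''}) Y : addp Y -> lifts M p -> lifts Y p.
Proof.
move=> [m [s [t stE]]] Mp f; have [g gE] := choice (fun j => Mp (f \o s j)).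
exists (\sum_j ((g j \o t j : {linear Y -> X}) : lhom Y X) : lhom Y X) => y.
rewrite lhom_sumE linear_sum [y in RHS]stE linear_sum; apply: eq_bigr => j _.
exact: gE.
Qed.

Lemma extends_addp X' X (i : {linear X' -> X}) Y : addp Y -> extends i M -> extends i Y.
Proof.
move=> [m [s [t stE]]] iM f; have [g gE] := choice (fun j => iM (t j \o f)).
exists (\sum_j ((s j \o g j : {linear X -> Y}) : lhom X Y) : lhom X Y) => x.
rewrite lhom_sumE [RHS]stE; apply: eq_bigr => j _.
by rewrite /= gE.
Qed.

(** As [R] is a summand of a power of [M], every [x] is a finite sum of values of maps from [M],
    obtained by splitting 1. *)
Lemma generator_separates X N (f g : {linear X -> N}) : addp (R^o : lmodType R) ->
  (forall (h : {linear M -> X}) x, f (h x) = g (h x)) -> forall x, f x = g x.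
Proof.
move=> [m [s [t stE]]] fg x.
have xl : linear (fun a : R^o => (a : R) *: x).
  by move=> a u v; rewrite scalerDl scalerA.
have xE : x = \sum_j (mklin xl \o s j) (t j 1).
  by rewrite -[LHS]scale1r [1 in LHS]stE -[LHS]/(mklin xl _) linear_sum.
by rewrite xE !linear_sum; apply: eq_bigr => j _; apply: fg.
Qed.

End Summands.

Section HomFunctor.
Variables (R : pzRingType) (M : lmodType R).
Implicit Types (X Y Z N K : lmodType R).
Local Notation Lam := ((endo M)^c).
Local Notation F X := (lhom M X : lmodType Lam).
Local Notation LL := (Lam^o : lmodType Lam).

Section Map.
Variables (X Y : lmodType R) (f : {linear X -> Y}).
Fact hom_map_linear : linear (fun h : lhom M X => (f \o h : {linear M -> Y}) : lhom M Y).
Proof. by move=> a h h'; apply: lhomP => x; rewrite /= linearD. Qed.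
Definition hom_map : {linear F X -> F Y} := mklin hom_map_linear.
Lemma hom_mapE (h : lhom M X) x : hom_map h x = f (h x). Proof. by []. Qed.
End Map.

Lemma hom_map_inj X Y (f : {linear X -> Y}) : injective f -> injective (hom_map f).
Proof.
by move=> fi h h' /(congr1 (fun u : lhom M Y => u : M -> Y)) hh; apply: lhomP => x;
   apply: fi; rewrite -!hom_mapE [hom_map f h _](congr1 (@^~ x) hh).
Qed.

Lemma hom_ses X Y Z (i : {linear X -> Y}) (p : {linear Y -> Z}) :
  ses i p -> lifts M p -> ses (hom_map i) (hom_map p).
Proof.
move=> ip Mp; split; first exact/hom_map_inj/(ses_inj ip).
- move=> h; split=> [h0|[g <-]]; last first.
    by apply: lhomP => x; rewrite !hom_mapE (ses_comp0 ip).
  have [|g gE] := ses_factor ip (f := h); first by move=> x; rewrite -hom_mapE h0.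
  by exists (g : lhom M X); apply: lhomP.
- by move=> h; have [g gE] := Mp h; exists (g : lhom M Y); apply: lhomP.
Qed.

Lemma addp_hom_gen Y m (s : 'I_m -> {linear M -> Y}) (t : 'I_m -> {linear Y -> M}) :
  (forall y, y = \sum_j s j (t j y)) ->
  forall h : F Y, h = \sum_j ((t j \o h : {linear M -> M}) : Lam) *: (s j : F Y).
Proof.
move=> stE h; apply: lhomP => x; rewrite lhom_sumE [LHS]stE.
by apply: eq_bigr => j _; rewrite lhom_scaleE.
Qed.

Lemma hom_projective Y : addp M Y -> projective (F Y).
Proof.
move=> [m [s [t stE]]]; split.
  exists m, (fun j => s j : F Y) => h.
  by exists (fun j => (t j \o h : {linear M -> M}) : Lam); apply: addp_hom_gen.
move=> X Z g f _ _ gs; have [x xE] := choice (fun j => gs (f (s j : F Y))).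
have hl : linear (fun h : F Y => \sum_j ((t j \o h : {linear M -> M}) : Lam) *: x j).
  move=> a h h'; rewrite scaler_sumr -big_split /=; apply: eq_bigr => j _.
  rewrite scalerA -scalerDl; congr (_ *: _); apply: lhomP => y.
  by rewrite /= linearD.
exists (mklin hl) => h; rewrite [h in RHS](addp_hom_gen stE) /= !linear_sum.
by apply: eq_bigr => j _; rewrite !linearZ xE.
Qed.

(** The regular module is [F M], so this is the Yoneda lemma for [M], transferred to the summand [Y]
    by the maps [s] and [t]. *)
Lemma hom_yoneda Y (phi : {linear F Y -> LL}) : addp M Y ->
  exists g : {linear Y -> M}, forall (h : F Y) x, (phi h : endo M) x = g (h x).
Proof.
move=> [m [s [t stE]]].
exists (\sum_j (((phi (s j : F Y) : endo M) \o t j : {linear Y -> M}) : lhom Y M) : lhom Y M).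
move=> h x; rewrite [h in LHS](addp_hom_gen stE) linear_sum lhom_sumE.
elim/big_rec2: _ => // j u v _ <-.
by rewrite linearZ.
Qed.

(** Composition with [f] is a map from [F X] to the regular module. Its extension to [F Y] is
    composition with some [g] by Yoneda, and [g] extends [f] because [M] is a generator. *)
Lemma hom_extends X Y (i : {linear X -> Y}) : addp M (R^o : lmodType R) -> addp M Y ->
  extends (hom_map i) LL -> extends i M.
Proof.
move=> gen Ya iL f.
have fl : linear (fun h : F X => ((f \o h : {linear M -> M}) : endo M) : LL).
  by move=> a h h'; apply: lhomP => x; rewrite /= linearD.
have [phi phiE] := iL (mklin fl); have [g gE] := hom_yoneda phi Ya.
exists g; apply: (generator_separates (f := g \o i) gen) => h x /=.
by have := gE (hom_map i h) x; rewrite phiE => <-.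
Qed.

(* A short exact sequence [K' -> Y -> K] with [Y] in [add M] which stays exact
   under [Hom(M, -)] and [Hom(-, M)]. *)
Definition link K' K : Prop :=
  exists Y (i : {linear K' -> Y}) (p : {linear Y -> K}),
    [/\ ses i p, lifts M p, extends i M & addp M Y].

Section Gorenstein.
Hypothesis gen : addp M (R^o : lmodType R).

Lemma gorenstein_chain (K : int -> lmodType R) : (forall i, link (K (i + 1)) (K i)) ->
  forall i, gorenstein_projective (F (K (i + 1))).
Proof.
move=> lk.
pose Y i := sval (cid (lk i)).
have lk1 i : exists (m : {linear K (i + 1) -> Y i}) (e : {linear Y i -> K i}),
    [/\ ses m e, lifts M e, extends m M & addp M (Y i)] by exact: (svalP (cid (lk i))).
pose m i := sval (cid (lk1 i)).
have lk2 i : exists (e : {linear Y i -> K i}),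
    [/\ ses (m i) e, lifts M e, extends (m i) M & addp M (Y i)].
  exact: (svalP (cid (lk1 i))).
pose e i := sval (cid (lk2 i)).
have lk3 i : [/\ ses (m i) (e i), lifts M (e i), extends (m i) M & addp M (Y i)].
  exact: (svalP (cid (lk2 i))).
have fses i : ses (hom_map (m i)) (hom_map (e i)).
  by case: (lk3 i) => ? ? _ _; apply: hom_ses.
pose d i : {linear F (Y (i + 1)) -> F (Y i)} := hom_map (m i) \o hom_map (e (i + 1)).
move=> i; exists (fun i => F (Y i)), d, i, (hom_map (m i)); split.
- split=> {}i.
  + by case: (lk3 i) => _ _ _; apply: hom_projective.
  + move=> y; split=> [|[x <-]]; last first.
      rewrite -[LHS]/(hom_map (m i) (hom_map (e (i + 1))
        (hom_map (m (i + 1)) (hom_map (e (i + 1 + 1)) x)))).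
      by rewrite (ses_comp0 (fses (i + 1))) linear0.
    move=> /(inj0 (ses_inj (fses i)))/(ses_ex (fses (i + 1)))[z <-].
    by have [x <-] := ses_surj (fses (i + 1 + 1)) z; exists x.
  (* By Yoneda [f] is composition with some [g]. It vanishes on the image of [K (i + 1 + 1)], hence
     descends to [K (i + 1)], and extends from there along [m i]. *)
  + move=> f fd; have [ip1 _ _ Ya1] := lk3 (i + 1); have [_ _ mM _] := lk3 i.
    have [g gE] := hom_yoneda f Ya1.
    have [|g' g'E] := ses_cofactor ip1 (f := g).
      move=> x; have [ip2 _ _ _] := lk3 (i + 1 + 1); have [y <-] := ses_surj ip2 x.
      apply: (generator_separates (f := g \o m (i + 1) \o e (i + 1 + 1))
        (g := (0 : lhom _ _)) gen) => h z.
      by have := congr1 (fun u : endo M => u z) (fd h); rewrite gE.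
    have [g'' g''E] := mM g'.
    have gl : linear (fun h : F (Y i) => ((g'' \o h : {linear M -> M}) : endo M) : LL).
      by move=> a h h'; apply: lhomP => x; rewrite /= linearD.
    exists (mklin gl) => h; apply: lhomP => x.
    by rewrite gE /= g''E g'E.
- exact: (ses_inj (fses i)).
- move=> y; split=> [[x <-]|[x <-]]; last by eexists.
  by have [z <-] := ses_surj (fses (i + 1)) x; exists z.
Qed.

Lemma gorenstein_of_links (W : lmodType R -> Prop) :
  (forall K, W K -> exists2 K', W K' & link K' K) ->
  (forall K, W K -> exists2 K', W K' & link K K') ->
  forall K, W K -> gorenstein_projective (F K).
Proof.
move=> WL WR K WK.
have stepL (X : {X | W X}) : exists X' : {X | W X}, link (sval X') (sval X).
  by have [K' WK' lk] := WL _ (svalP X); exists (exist _ K' WK').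
have stepR (X : {X | W X}) : exists X' : {X | W X}, link (sval X) (sval X').
  by have [K' WK' lk] := WR _ (svalP X); exists (exist _ K' WK').
have [l lP] := choice stepL; have [r rP] := choice stepR.
pose X0 : {X | W X} := exist _ K WK.
(* Nonnegative indices iterate links to the left of [K]. [Negz q] is the integer [-(q + 1)], which
   is why it takes [q + 1] steps to the right. *)
pose C (i : int) := match i with Posz q => sval (iter q l X0)
  | Negz q => sval (iter q.+1 r X0) end.
have lk i : link (C (i + 1)) (C i).
  case: i => [q|[|q]].
  - by rewrite (_ : Posz q + 1 = Posz q.+1); [apply: lP | rewrite intS addrC].
  - exact: rP.
  - rewrite (_ : Negz q.+1 + 1 = Negz q); first exact: rP.
    by rewrite !NegzE intS opprD addrAC addNr add0r.
(* [K] sits at index 0, which has to be presented as [-1 + 1]. *)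
exact: (gorenstein_chain lk (Negz 0)).
Qed.

End Gorenstein.
End HomFunctor.

(** * Precluster tilting and relative Ext vanishing *)

Section RelativeExt.
Variables (R : pzRingType) (N : lmodType R) (Z P : nat -> lmodType R).
Variables (m : forall j, {linear Z j -> P j}) (c : forall j, {linear P j -> syz N Z j}).
Hypothesis res : min_res m c.
Variable n : nat.
(** The Auslander-Reiten argument is kept abstract so that the lemmas below apply both to [M] over
    [A] and to [D M] over the opposite algebra. *)
Hypothesis ar_lifts : forall (X' X X'' : lmodType R) (i : {linear X' -> X})
  (p : {linear X -> X''}),
  ses i p -> finitely_generated X -> extends i N -> lifts (syz N Z n) p.

Variables (X' X X'' : lmodType R) (i : {linear X' -> X}) (p : {linear X -> X''}).
Hypotheses (ip : ses i p) (Xf : finitely_generated X).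
Hypothesis Xgood : forall j, (j < n)%N -> extends (m j) X.

(** Below [n] the lifting comes from the vanishing of Ext^(j+1)(N, X'); at [n], where nothing is
    known about Ext, it is the Auslander-Reiten argument. *)
Lemma extends_lifts_syz a : extends i N ->
  (forall j, (a <= j < n)%N -> extends (m j) X') ->
  forall j, (a <= j <= n)%N -> lifts (syz N Z j) p.
Proof.
move=> iN X'good j /andP[aj]; rewrite leq_eqVlt => /predU1P[->|jn].
  exact: ar_lifts ip Xf iN.
apply: (extends_lifts (res_ses res j) ip (res_proj res j) Xf).
by apply: X'good; rewrite aj.
Qed.

(** Degree [j] for [X''] needs lifting from syzygy [j + 1]. That lifting is also available at [n],
    so the good range extends downwards by one without losing its upper end. *)
Lemma extends_good_quo a : extends i N ->
  (forall j, (a <= j < n)%N -> extends (m j) X') ->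
  forall j, (a.-1 <= j < n)%N -> extends (m j) X''.
Proof.
move=> iN X'good j /andP[aj jn].
have lj := extends_lifts_syz iN X'good (j := j.+1).
apply: extends_quo (lj _) (Xgood jn); rewrite jn andbT.
by case: (a) aj.
Qed.

Lemma lifts_good_sub q : lifts N p -> (forall j, (j < q)%N -> extends (m j) X'') ->
  forall j, (j <= q)%N -> (j < n)%N -> extends (m j) X'.
Proof.
move=> Np X''good [|j] jq jn.
  exact: (extends_sub (res_ses res 0) ip Np (Xgood jn)).
apply: (extends_sub (res_ses res j.+1) ip _ (Xgood jn)).
exact: (extends_syz_lifts ip (res_proj res j) Xf (X''good j jq)).
Qed.

End RelativeExt.

(** * Modules orthogonal to [M], with [n + 1] in the role of the tilting parameter *)

Section Precluster.
Variables (n : nat) (k : comNzRingType) (A : algType k) (M : lmodType A).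
Hypothesis A_artin : artin_algebra A.
Implicit Types (X Y E K : lmodType A).
Hypothesis M_fg : finitely_generated M.
Hypothesis M_pct : precluster_tilting n.+1 (in_add M).
Variables (J : lmodType k) (Z P : nat -> lmodType A) (Z' P' : nat -> lmodType A^c).
Variables (m : forall j, {linear Z j -> P j}) (c : forall j, {linear P j -> syz M Z j}).
Variables (m' : forall j, {linear Z' j -> P' j}).
Variables (c' : forall j, {linear P' j -> syz (kdual J M) Z' j}).
Hypothesis J_dual : is_dualizing J.
Hypotheses (res : min_res m c) (res' : min_res m' c').

Let k_finlen : finlen (k^o : lmodType k).
Proof. by case: A_artin => /artinian_finlen. Qed.
Let A_fg : finitely_generated (A : lmodType k). Proof. by case: A_artin. Qed.

Lemma in_add_self : in_add M M.
Proof. exact/in_add_iso/isomorphic_refl. Qed.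

Lemma in_add_projective X : projective X -> in_add M X.
Proof. by case: M_pct => _ [[Cp _] _ _ _]; apply: Cp. Qed.

Lemma in_add_injective X : injective_module X -> in_add M X.
Proof. by case: M_pct => _ [[_ Ci] _ _ _]; apply: Ci. Qed.

Lemma regular_projective : projective (A^o : lmodType A).
Proof.
split=> [|X Y g f _ _ gs]; first exact: regular_fg.
have [x xE] := gs (f 1).
have hl : linear (fun a : A^o => (a : A) *: x).
  by move=> a u v; rewrite scalerDl scalerA.
exists (mklin hl) => a; rewrite /= linearZ xE -linearZ; congr (f _).
exact: mulr1.
Qed.

Lemma addp_regular : addp M (A^o : lmodType A).
Proof. exact/in_add_addp/in_add_projective/regular_projective. Qed.

Lemma right_approx X : finitely_generated X ->
  exists Y (e : {linear Y -> X}), [/\ in_add M Y, surj e & lifts M e].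
Proof.
move=> Xf; have [_ [_ _ _ [Cc _]]] := M_pct.
have [Y [e [CY eP]]] := Cc X Xf; exists Y, e; split=> //.
  have [q [f fs]] := fg_cover Xf.
  have [|h hE] := eP _ f; first exact/in_add_projective/free_projective.
  by move=> x; have [z <-] := fs x; exists (h z).
by move=> f; have [|h hE] := eP _ f; [exact: in_add_self | exists h].
Qed.

Lemma embeds_injective X : finitely_generated X ->
  exists E (f : {linear X -> E}), injective_module E /\ injective f.
Proof.
move=> Xf; have [q [g gs]] := fg_cover (kdual_fg k_finlen J_dual A_fg Xf).
have [f fE] := swap_from g; exists (ddual J ({ffun 'I_q -> A^c^o} : lmodType A^c)), f; split.
  apply: (ddual_injective k_finlen J_dual A_fg); exact: free_projective.
move=> x y fxy; apply: (kdual_sep k_finlen J_dual A_fg Xf) => u.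
by have [z <-] := gs u; rewrite -!fE fxy.
Qed.

Lemma left_approx X : finitely_generated X ->
  exists Y (i : {linear X -> Y}), [/\ in_add M Y, injective i & extends i M].
Proof.
move=> Xf; have [_ [_ _ _ [_ Cc]]] := M_pct.
have [Y [i [CY iP]]] := Cc X Xf; exists Y, i; split=> //.
  have [E [f [Ei fi]]] := embeds_injective Xf.
  have [|h hE] := iP _ f; first exact: in_add_injective.
  by move=> x y /(congr1 h); rewrite !hE => /fi.
by move=> f; have [|h hE] := iP _ f; [exact: in_add_self | exists h].
Qed.

Lemma ar_lifts (X' X X'' : lmodType A) (i : {linear X' -> X}) (p : {linear X -> X''}) :
  ses i p -> finitely_generated X -> extends i M -> lifts (syz M Z n) p.
Proof.
move=> ip Xf iM.
pose d : {linear P n.+1 -> P n} := m n \o c n.+1.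
have [T [q [qs qP]]] := transpose_exists d.
have mp : minimal_presentation d (c n).
  split; first exact: res_cover.
  exists (Z n), (c n.+1), (m n); split=> //; first exact: (res_cover res n.+1).
    exact: (ses_inj (res_ses res n)).
  by case: (res_ses res n).
(* The parameter is [n.+1], so the translate takes exactly [n] minimal syzygies before [D Tr]; maps
   that extend to [M] therefore extend to this module too. *)
have tauC : in_add M (restr (@conv2 k A) (kdual J T)).
  have [_ [_ [Ct _] _ _]] := M_pct; apply: (Ct M); first exact: in_add_self.
  exists (syz M Z n); first exact: (iterated_chain (syz_is_syzygy res) n 0).
  exists J, T; split=> //; last exact: isomorphic_refl.
  by exists (P n.+1), (P n), d, (c n), q.
apply: (transpose_lifts k_finlen J_dual A_fg (res_proj res n.+1) (res_proj res n)
  (ses_surj (res_ses res n)) (res_exact (j := n) res) qs qP ip Xf).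
exact: extends_addp (in_add_addp tauC) iM.
Qed.

(** The cosyzygies of [M], obtained by dualizing the minimal resolution of [D M]; [V 0] is the
    double dual of [M]. *)
Let V j : lmodType A := ddual J (syz (kdual J M) Z' j).

Lemma V_cosyzygy j : is_cosyzygy (V j) (V j.+1).
Proof.
have [vi vex vs] := ddual_ses k_finlen J_dual A_fg (res_ses res' j)
  (proj_fg (res_proj res' j)).
exists (ddual J (P' j)), (ddual_map J (c' j)), (ddual_map J (m' j)); split=> //.
exact: (ddual_envelope k_finlen J_dual A_fg (res_cover res' j)).
Qed.

Lemma in_add_V0 : in_add M (V 0).
Proof.
have [e [ei es _]] := ev_ddual k_finlen J_dual A_fg M_fg.
exact/in_add_iso/(bij_isomorphic ei es).
Qed.

(* [T] is [tau_n^- M] and [D T] is [tau_n (D M)], so that [ar_lifts] also holds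
   for [D M] over the opposite algebra. *)
Lemma ar_lifts_dual (X' X X'' : lmodType A^c) (i : {linear X' -> X})
    (p : {linear X -> X''}) :
  ses i p -> finitely_generated X -> extends i (kdual J M) ->
  lifts (syz (kdual J M) Z' n) p.
Proof.
move=> ip Xf iM.
pose d : {linear P' n.+1 -> P' n} := m' n \o c' n.+1.
have [T [q [qs qP]]] := transpose_exists d.
have Nf : finitely_generated (syz (kdual J M) Z' n) := res_fg res' n.
have [e [ei es _]] := ev_kdual k_finlen J_dual A_fg Nf.
have mp : minimal_presentation d (e \o c' n).
  by apply: (kdual_presentation (res_cover res' n) (res_cover res' n.+1)
    (res_ses res' n) ei es).
have [r [s [t stE]]] : addp M (restr (@conv2 k A) T).
  have [_ [_ [_ Ct] _ _]] := M_pct; apply/in_add_addp.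
  apply: (Ct (V 0)); first exact: in_add_V0.
  exists (V n); first exact: (iterated_chain V_cosyzygy n 0).
  exists J, T; split=> //; last exact: isomorphic_refl.
  by exists (P' n.+1), (P' n), d, (e \o c' n), q.
apply: (transpose_lifts k_finlen J_dual (conv_fg A_fg) (res_proj res' n.+1) (res_proj res' n)
  (ses_surj (res_ses res' n)) (res_exact (j := n) res') qs qP ip Xf).
(* The maps [s] and [t] exhibiting [T] as a summand of a power of [M] are dualized, which puts [D T]
   in [add (D M)]. *)
apply: (extends_addp _ iM); pose TA : lmodType A := restr (@conv2 k A) T.
  have ul j (u : kdual J M) : linear (fun x : restr (in_alg (A^c)^c) T => u (t j x)).
    move=> a x y; rewrite -linearP; congr (u _).
    exact: (linearP (base_map (t j)) a (x : restr (in_alg A) TA) y).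
  have vl j (v : kdual J T) : linear (fun x : restr (in_alg A) M => v (s j x)).
    move=> a x y; rewrite -linearP; congr (v _); exact: (linearP (base_map (s j))).
  have sl j : linear (fun u : kdual J M => mklin (ul j u) : restr (@conv2 k A^c) (kdual J T)).
    by move=> b u v; apply: lhomP => x; rewrite /= /kdual_fun /= -linearZ.
  have tl j : linear (fun v : restr (@conv2 k A^c) (kdual J T) => mklin (vl j v) : kdual J M).
    by move=> b u v; apply: lhomP => x; rewrite /= /kdual_fun /= linearZ.
  exists r, (fun j => mklin (sl j)), (fun j => mklin (tl j)) => u.
  apply: lhomP => x; rewrite lhom_sumE.
  have us (l : seq 'I_r) : u (\sum_(j <- l) s j (t j x)) = \sum_(j <- l) u (s j (t j x)).
    elim: l => [|j l IH]; first by rewrite !big_nil; exact: (linear0 u).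
    by rewrite !big_cons -IH; exact: (linearD u).
  by rewrite [x in LHS]stE; exact: us.
Qed.

Lemma addp_Ext_zero j Y : addp M Y -> (j < n)%N -> extends (m j) Y.
Proof.
move=> Ya jn; apply: extends_addp Ya _; apply: (Ext_zero_extends res).
have [_ [_ _ Ce _]] := M_pct.
by apply: Ce; rewrite ?ltnS //; exact: in_add_self.
Qed.

(** The vanishing of Ext^(j+1)(M, M) is moved from the projective resolution to the injective
    coresolution by shifting along the [V q]. Dualized, it becomes the vanishing over the opposite
    algebra. *)
Lemma lifts_cosyzygy j : (j < n)%N -> lifts M (ddual_map J (m' j)).
Proof.
move=> jn.
have vses q := ddual_ses k_finlen J_dual A_fg (res_ses res' q) (proj_fg (res_proj res' q)).
have If q : injective_module (ddual J (P' q)).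
  exact: (ddual_injective k_finlen J_dual A_fg (res_proj res' q)).
have Vext q a : (q + a < n)%N -> extends (m a) (V q).
  elim: q a => [|q IH] a qa; first exact: addp_Ext_zero (in_add_addp in_add_V0) qa.
  apply: (@extends_quo _ _ _ _ _ _ (ddual_map J (m' q))).
    apply: (extends_lifts (res_ses res a.+1) (vses q) (res_proj res a.+1)).
      by case: (If q).
    by apply: IH; rewrite addnS.
  move=> f; apply: (If q).2 => //.
  - exact: (res_fg res a.+1).
  - exact: (proj_fg (res_proj res a)).
  - exact: (ses_inj (res_ses res a)).
apply: (extends_lifts (res_ses res 0) (vses j) (res_proj res 0)).
  by case: (If j).
by apply: Vext; rewrite addn0.
Qed.

Lemma addp_Ext_zero_dual j Y : addp M Y -> (j < n)%N -> extends (m' j) (kdual J Y).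
Proof.
move=> Ya jn f; have [g gE] := swap_from f.
have [h hE] := lifts_addp Ya (lifts_cosyzygy jn) g.
have [F FE] := swap_to h; exists F => z; apply: lhomP => y.
by rewrite FE -[LHS](ddual_mapE (m' j)) hE gE.
Qed.

(* Level [0] is the class of modules [X] with [Ext^j(M, X) = Ext^j(X, M) = 0] for
   [0 < j <= n]; the [q]-th [M]-syzygy of a module of level [q] has level [0]. *)
Definition level q X : Prop :=
  [/\ finitely_generated X, forall j, (j + q < n)%N -> extends (m j) X
    & forall j, (q <= j < n)%N -> extends (m' j) (kdual J X)].

Lemma addp_level Y : addp M Y -> level 0 Y.
Proof.
move=> Ya; split=> [|j|j]; first exact: addp_fg Ya.
  by rewrite addn0; apply: addp_Ext_zero.
by move=> jn; apply: addp_Ext_zero_dual.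
Qed.

Lemma fg_level X : finitely_generated X -> level n X.
Proof.
move=> Xf; split=> // j; first by rewrite ltnNge leq_addl.
by case/andP=> nj; rewrite ltnNge nj.
Qed.

Section Approx.
Variables (K Y X : lmodType A) (i : {linear K -> Y}) (p : {linear Y -> X}).
Hypotheses (ip : ses i p) (Ya : addp M Y).

Let Yf : finitely_generated Y. Proof. exact: addp_fg Ya. Qed.
Let Yg j : (j < n)%N -> extends (m j) Y. Proof. exact: addp_Ext_zero. Qed.
Let Yg' j : (j < n)%N -> extends (m' j) (kdual J Y).
Proof. exact: addp_Ext_zero_dual. Qed.
Let dip := kdual_ses k_finlen J_dual A_fg ip Yf.
Let dYf := kdual_fg k_finlen J_dual A_fg Yf.

(** An M-syzygy gains one degree in each condition: in the first by dimension shifting, in the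
    second by [extends_good_quo] for [D M]. The truncated predecessor also covers stability of level
    0. *)
Lemma right_level q : lifts M p -> level q X -> level q.-1 K.
Proof.
move=> Mp [Xf Xe Xe']; split=> [|j jq|j jq].
- exact: (fg_sub A_fg k_finlen (ses_inj ip) Yf).
(* At level 0 all [n] degrees are good for [X] already and have only to be kept; at level [q + 1]
   there are [n - (q + 1)] of them, and shifting yields one more. *)
- case: q Xe {Xe'} jq => [|q] Xe jq.
    apply: (lifts_good_sub res ip Yf Yg Mp (q := n)) => [l ln||]; rewrite ?addn0 in jq *.
    + by apply: Xe; rewrite addn0.
    + exact: ltnW.
    + exact: jq.
  apply: (lifts_good_sub res ip Yf Yg Mp (q := (n - q.+1)%N)) => [l ln||].
  + by apply: Xe; rewrite addnC -ltn_subRL.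
  + have qn : (q < n)%N := leq_ltn_trans (leq_addl _ _) jq.
    by rewrite leq_subRL // addSn addnC.
  + exact: leq_ltn_trans (leq_addr _ _) jq.
- have eM := lifts_dual_extends k_finlen J_dual A_fg ip Yf Mp.
  exact: (extends_good_quo res' ar_lifts_dual dip dYf Yg' eM Xe' jq).
Qed.

(** Lifting from [M] along [p] dualizes to extension into [D M]. Level 0 and the Auslander-Reiten
    argument for [D M] turn this into lifting from [D M], which dualizes back to extension into
    [M]. *)
Lemma right_extends : lifts M p -> level 0 X -> extends i M.
Proof.
move=> Mp [Xf Xe Xe'].
have eM := lifts_dual_extends k_finlen J_dual A_fg ip Yf Mp.
apply: (dual_lifts_extends k_finlen J_dual A_fg M_fg).
exact: (extends_lifts_syz res' ar_lifts_dual dip dYf eM Xe' (j := 0%N)).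
Qed.

Lemma left_lifts : extends i M -> level 0 K -> lifts M p.
Proof.
move=> iM [Kf Ke Ke'].
apply: (extends_lifts_syz res ar_lifts ip Yf iM (a := 0%N) _ (j := 0%N)) => // j jn.
by apply: Ke; rewrite addn0.
Qed.

Lemma left_level : extends i M -> level 0 K -> level 0 X.
Proof.
move=> iM [Kf Ke Ke']; split=> [|j|j jn]; first exact: fg_surj (ses_surj ip) Yf.
  rewrite addn0 => jn.
  apply: (extends_good_quo res ar_lifts ip Yf Yg iM (a := 0%N)) => // l ln.
  by apply: Ke; rewrite addn0.
have dM := extends_dual_lifts k_finlen J_dual A_fg M_fg iM.
by apply: (lifts_good_sub res' dip dYf Yg' dM (q := n)) => [l ln||]; [apply: Ke'|apply: ltnW|].
Qed.

End Approx.

Local Notation F X := (lhom M X : lmodType (endo M)^c).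
Local Notation LL := ((endo M)^c^o : lmodType (endo M)^c).

Lemma right_approx_ses X : finitely_generated X ->
  exists K Y (i : {linear K -> Y}) (p : {linear Y -> X}), [/\ ses i p, lifts M p & addp M Y].
Proof.
move=> /right_approx[Y [p [Ya ps Mp]]]; have [K [i ip]] := exists_ker ps.
by exists K, Y, i, p; split=> //; apply: in_add_addp.
Qed.

Lemma level_gorenstein K : level 0 K -> gorenstein_projective (F K).
Proof.
move: K; apply: (gorenstein_of_links addp_regular) => K K0; have [Kf _ _] := K0.
  have [K' [Y [i [p [ip Mp Ya]]]]] := right_approx_ses Kf; exists K'.
    exact: (right_level ip Ya Mp K0).
  by exists Y, i, p; split=> //; apply: (right_extends ip Ya Mp K0).
have [Y [i [Ya ii iM]]] := left_approx Kf; have [K' [p ip]] := exists_coker ii.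
move/in_add_addp: Ya => Ya; exists K'; first exact: (left_level ip Ya iM K0).
by exists Y, i, p; split=> //; apply: (left_lifts ip Ya iM K0).
Qed.

Lemma addp_gorenstein Y : addp M Y -> gorenstein_projective (F Y).
Proof. by move=> Ya; apply/level_gorenstein/addp_level. Qed.

Lemma level_resolution q X : level q X -> gproj_resolution (F X) q.
Proof.
elim: q X => [|q IH] X Xq.
  apply: (@gproj_resolution0 _ _ (F {ffun 'I_0 -> M})); last exact: level_gorenstein.
    by move=> f; apply: lhomP => x; rewrite (ffun0_trivial (f x)).
  exact/addp_gorenstein/in_add_addp/in_add_ffun.
have [Xf _ _] := Xq; have [K [Y [i [p [ip Mp Ya]]]]] := right_approx_ses Xf.
apply: (gproj_resolution_ses (hom_ses ip Mp)); first exact: addp_gorenstein.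
exact/IH/(right_level ip Ya Mp Xq).
Qed.

Lemma hom_resolution X : finitely_generated X -> gproj_resolution (F X) n.
Proof. by move=> Xf; apply/level_resolution/fg_level. Qed.

(** Passing to the M-syzygy [K] lowers the degree over the endomorphism ring and raises the degree
    [l] over [A], keeping [j + l + 1 = n]. At [j = 0] the degree over [A] is the top one, settled by
    the Auslander-Reiten argument. *)
Lemma ext_all_extends j l X : (j + l).+1 = n -> finitely_generated X ->
  ext_all LL j (F X) -> extends (m l) X.
Proof.
elim: j l X => [|j IH] l X jl Xf H;
  have [K [Y [i [p [ip Mp Ya]]]]] := right_approx_ses Xf;
  have ln : (l < n)%N by rewrite -jl ltnS leq_addl.
  have iM := hom_extends addp_regular Ya (H _ _ _ _ (hom_projective Ya) (hom_ses ip Mp)).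
  apply: (extends_quo (p := p) _ (addp_Ext_zero Ya ln)).
  have := ar_lifts ip (addp_fg M_fg Ya) iM.
  by rewrite -jl.
have HK := H _ _ _ _ (hom_projective Ya) (hom_ses ip Mp).
apply: (extends_quo (p := p) _ (addp_Ext_zero Ya ln)).
apply: (extends_lifts (res_ses res l.+1) ip (res_proj res l.+1) (addp_fg M_fg Ya)).
apply: (IH l.+1 K _ _ HK); first by rewrite addnS -addSn.
by apply: (fg_sub A_fg k_finlen (ses_inj ip)); apply: addp_fg Ya.
Qed.

(** It is meant for [T] the radical of [F X], where [F Y -> F X] is not known to be onto: exactness
    is required only up to [T], and surjectivity onto [F X] is what comes out. *)
Lemma ext_all_lifts K Y X (i : {linear K -> Y}) (p : {linear Y -> X})
    (T : lmodType (endo M)^c) (e : {linear F Y -> T}) :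
  ses i p -> addp M Y -> ses (hom_map M i) e -> ext_all LL n T -> lifts M p.
Proof.
move=> ip Ya ie; have Yf := addp_fg M_fg Ya.
have [n0|n0] := posnP n => HT.
  have := HT; rewrite n0 => H.
  have iM := hom_extends addp_regular Ya (H _ _ _ _ (hom_projective Ya) ie).
  by have := ar_lifts ip Yf iM; rewrite n0.
have := HT; rewrite -(prednK n0) => H.
apply: (extends_lifts (res_ses res 0) ip (res_proj res 0) Yf).
apply: (@ext_all_extends n.-1 0); first by rewrite addn0 prednK.
  exact: (fg_sub A_fg k_finlen (ses_inj ip) Yf).
exact: H (hom_projective Ya) ie.
Qed.

End Precluster.

(** * The radical of [Hom(M, N)] *)

Section Radical.
Variables (k : comNzRingType) (A : algType k).
Hypothesis k_finlen : finlen (k^o : lmodType k).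
Hypothesis A_fg : finitely_generated (A : lmodType k).
Variables (M N : lmodType A) (s0 : {linear N -> M}) (r0 : {linear M -> N}).
Hypotheses (rs0 : forall x, r0 (s0 x) = x) (Nind : indecomposable N).
Hypothesis Mf : finitely_generated M.
Local Notation Lam := ((endo M)^c).
Local Notation F X := (lhom M X : lmodType Lam).

Let Nf : finitely_generated N.
Proof. by apply: (fg_surj (f := r0) _ Mf) => x; exists (s0 x). Qed.

Let Nfl : finlen N. Proof. exact: (fg_finlen_alg A_fg k_finlen Nf). Qed.

Definition split_epi (h : lhom M N) : Prop :=
  exists s : {linear N -> M}, forall x, h (s x) = x.

Lemma split_epi_surj (h : {linear M -> N}) (u : {linear N -> M}) :
  surj (h \o u) -> split_epi h.
Proof.
move=> hs; have hi := surj_endo_inj Nfl hs; have [g gK Kg] := bij_inverse hi hs.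
by exists (u \o g) => x; rewrite -[RHS]Kg.
Qed.

Lemma split_epi_gen (h : F N) : split_epi h -> forall g : F N, exists a : Lam, g = a *: h.
Proof.
move=> [s sE] g; exists ((s \o g : {linear M -> M}) : endo M).
by apply: lhomP => x; rewrite lhom_scaleE /= sE.
Qed.

(** If [a *: h + h'] has a section [s], then [h a s + h' s] is the identity of [N]; locality of the
    endomorphism ring makes one summand onto, so [h] or [h'] splits. *)
Lemma nonsplit_submod : submod_prop (fun h : F N => ~ split_epi h).
Proof.
split=> [[s sE]|a h h' hn hn' [s sE]].
  by apply: Nind.1 => x; rewrite -(sE x).
case: (indecomposable_local (f := (h : {linear M -> N}) \o ((a : endo M) : {linear M -> M}) \o s)
  (g := (h' : {linear M -> N}) \o s) Nfl Nind) => [x|hs|hs].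
- by rewrite -[RHS]sE.
- by apply: hn; apply: (split_epi_surj (u := ((a : endo M) : {linear M -> M}) \o s)).
- by apply: hn'; apply: (split_epi_surj (u := s)).
Qed.

(** One split epimorphism generates all of [F N], so the non-split maps form the unique maximal
    submodule. *)
Lemma radical_homP (h : F N) : in_radical h <-> ~ split_epi h.
Proof.
split=> [hr|hn S [/closed_submod_prop Sm [g gS] Smax]].
  have /hr : maximal_submodule [pred h : F N | `[< ~ split_epi h >]]; last by move/asboolP.
  split; first exact: (submod_prop_closed nonsplit_submod).
    by exists (r0 : F N); apply/asboolP; apply; exists s0.
  move=> T /closed_submod_prop Tm nT.
  have [TI|nTI] := pselect (forall g, g \in T -> ~ split_epi g); [left | right].
    move=> g; apply/idP/asboolP => [/TI //|gn]; apply: nT; exact/asboolP.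
  move=> g; apply: contrapT => gT; apply: nTI => u uT us; apply: gT.
  by have [a ->] := split_epi_gen us g; apply: (submodZ Tm).
have Sn u : u \in S -> ~ split_epi u.
  move=> uS us; move/negP: gS; apply.
  by have [a ->] := split_epi_gen us g; apply: (submodZ Sm).
have [|||] := Smax [pred h : F N | `[< ~ split_epi h >]].
- exact: (submod_prop_closed nonsplit_submod).
- by move=> u /Sn un; apply/asboolP.
- by move=> <-; apply/asboolP.
- by move=> /(_ (r0 : F N))/asboolP[]; exists s0.
Qed.

(** Recorded by their values on generators of [M], the non-split maps form a [k]-submodule of a
    finite power of [N], hence are generated over [k] by finitely many [h l]; [r] is their sum. *)
Lemma radical_approx : exists m (r : {linear {ffun 'I_m -> M} -> N}),
  forall h : {linear M -> N},
    ~ split_epi h <-> exists g : {linear M -> {ffun 'I_m -> M}}, forall x, r (g x) = h x.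
Proof.
have [q [g gP]] := Mf.
pose V : lmodType k := {ffun 'I_q -> restr (in_alg A) N}.
pose I (v : V) := exists h : F N, ~ split_epi h /\ forall j, v j = h (g j).
have al (a : k) : linear (fun x : M => a%:A *: x).
  by move=> b x y; rewrite scalerDr alg_scale_comm.
have Im : submod_prop I.
  split=> [|a u v [h [hn hE]] [h' [hn' hE']]].
    exists 0; split; first exact: submod0 nonsplit_submod.
    by move=> j; rewrite ffunE.
  exists ((mklin (al a) : Lam) *: h + h'); split; first exact: nonsplit_submod.2.
  by move=> j; rewrite !ffunE lhom_addE lhom_scaleE /= linearZ -hE -hE'.
have [K [i [ii iP]]] := exists_sub Im.
have Kf : finitely_generated K.
  apply/finlen_fg/(finlen_inj ii)/finlen_ffun.
  exact: (finlen_fg_base A_fg k_finlen Nf).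
have [m [v vP]] := Kf.
have [h hP] := choice (fun l => (iP (i (v l))).2 (ex_intro _ (v l) erefl)).
have rl : linear (fun x : {ffun 'I_m -> M} => \sum_l (h l : {linear M -> N}) (x l)).
  move=> a x y; rewrite scaler_sumr -big_split /=; apply: eq_bigr => l _.
  by rewrite !ffunE linearP.
exists m, (mklin rl) => f; split=> [fn|[f' f'E]].
  pose w : V := [ffun j => f (g j)].
  have [y yw] : exists y, i y = w by apply/iP; exists f; split=> // j; rewrite ffunE.
  have [c cE] := vP y.
  (* The coefficients over [k] are central and act on [M] by endomorphisms, so a [k]-combination of
     the [h l] is a factorization through [r]. *)
  have gl : linear (fun x : M => [ffun l => (c l)%:A *: x] : {ffun 'I_m -> M}).
    by move=> a x x'; apply/ffunP=> l; rewrite !ffunE; apply: al.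
  exists (mklin gl) => x; have [d ->] := gP x; rewrite !linear_sum; apply: eq_bigr => j _.
  rewrite [mklin gl _]linearZ [mklin rl _]linearZ [f (_ *: _)]linearZ; congr (_ *: _).
  have := congr1 (fun u : V => u j) yw; rewrite ffunE => <-.
  rewrite cE linear_sum sum_ffunE /=; apply: eq_bigr => l _.
  rewrite ffunE !linearZ /= ffunE restr_scaleE; congr (_ *: _).
  by have [_ ->] := hP l.
have fl l : linear (fun x : M => f' x l) by move=> a x y; rewrite linearP !ffunE.
pose w l : F N := ((mklin (fl l) : endo M) : Lam) *: (h l : F N).
have wn l : ~ split_epi (w l).
  by apply: (submodZ nonsplit_submod); have [] := hP l.
have := @submod_sum _ _ _ nonsplit_submod _ (index_enum 'I_m) xpredT w (fun l _ => wn l).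
suff -> : \sum_l w l = f by [].
by apply: lhomP => x; rewrite -f'E lhom_sumE.
Qed.

End Radical.

(** * Gorenstein projective dimension of the simple tops *)

Section SimpleTop.
Variables (n : nat) (k : comNzRingType) (A : algType k) (M N : lmodType A).
Hypothesis A_artin : artin_algebra A.
Hypothesis M_fg : finitely_generated M.
Hypothesis M_pct : precluster_tilting n.+1 (in_add M).
Variables (s0 : {linear N -> M}) (r0 : {linear M -> N}).
Hypotheses (rs0 : forall x, r0 (s0 x) = x) (Nind : indecomposable N).
Variable S : lmodType (endo M)^c.
Hypothesis S_top : is_top (lhom M N) S.
Local Notation F X := (lhom M X : lmodType (endo M)^c).

Let k_finlen : finlen (k^o : lmodType k).
Proof. by case: A_artin => /artinian_finlen. Qed.
Let A_fg : finitely_generated (A : lmodType k). Proof. by case: A_artin. Qed.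

Let N_addp : addp M N.
Proof. by exists 1%N, (fun=> r0), (fun=> s0) => x; rewrite big_ord1 rs0. Qed.

Let Nf : finitely_generated N. Proof. exact: addp_fg N_addp. Qed.

Let gen : addp M (A^o : lmodType A). Proof. exact: addp_regular M_pct. Qed.

Let resolutions : exists (J : lmodType k) (Z P : nat -> lmodType A)
    (Z' P' : nat -> lmodType A^c)
    (m : forall j, {linear Z j -> P j}) (c : forall j, {linear P j -> syz M Z j})
    (m' : forall j, {linear Z' j -> P' j})
    (c' : forall j, {linear P' j -> syz (kdual J M) Z' j}),
  [/\ is_dualizing J, min_res m c & min_res m' c'].
Proof.
have [J Jd] := dualizing_exists k_finlen.
have [Z [P [m [c res]]]] := min_res_exists (alg_finlen A_fg k_finlen) M_fg.
have [Z' [P' [m' [c' res']]]] := min_res_exists (alg_finlen (conv_fg A_fg) k_finlen)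
  (kdual_fg k_finlen Jd A_fg M_fg).
by exists J, Z, P, Z', P', m, c, m', c'.
Qed.

Let hom_res X : finitely_generated X -> gproj_resolution (F X) n.
Proof.
have [J [Z [P [Z' [P' [m [c [m' [c' [Jd res res']]]]]]]]]] := resolutions.
exact: (hom_resolution A_artin M_fg M_pct Jd res res').
Qed.

Let hom_gproj Y : addp M Y -> gorenstein_projective (F Y).
Proof.
have [J [Z [P [Z' [P' [m [c [m' [c' [Jd res res']]]]]]]]]] := resolutions.
exact: (addp_gorenstein A_artin M_fg M_pct Jd res res').
Qed.

Lemma top_projective : projective N -> Gpd_le S n.+1.
Proof.
move=> Np; exists n.+1 => //.
have [q qs qP] := S_top.
have [m [r rP]] := radical_approx k_finlen A_fg rs0 Nind M_fg.
have [X [e [j [es ji ej]]]] := exists_image r.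
have jq : ses (hom_map M j) q.
  split=> //; first exact: hom_map_inj.
  move=> h; rewrite qP (radical_homP k_finlen A_fg rs0 Nind M_fg); split=> [/rP[g gE]|].
    exists ((e \o g : {linear M -> X}) : F X).
    by apply: lhomP => x; rewrite hom_mapE /= ej gE.
  (* If a map through the image of [r] were split, [r] would be onto, hence split by projectivity of
     [N]; then [r0], itself split, would factor through [r]. *)
  move=> [h' <-] [s sE].
  have js : surj j by move=> x; exists (h' (s x)); rewrite -[RHS]sE.
  have rs : surj r.
    by move=> x; have [y <-] := js x; have [z <-] := es y; exists z; rewrite ej.
  have [|v vE] := proj_lift idfun Np _ rs; first exact/(addp_fg M_fg)/in_add_addp/in_add_ffun.
  have /rP : exists g : {linear M -> {ffun 'I_m -> M}}, forall x, r (g x) = r0 x.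
    by exists (v \o r0) => x; rewrite /= vE.
  by apply; exists s0.
apply: (gproj_resolution_ses jq (hom_gproj N_addp)).
by apply: hom_res; exact: (fg_sub A_fg k_finlen ji Nf).
Qed.

Lemma top_nonprojective : ~ projective N -> Gpd_eq S n.+2.
Proof.
move=> Np; have [q qs qP] := S_top.
have [m [r rP]] := radical_approx k_finlen A_fg rs0 Nind M_fg.
have rs : surj r.
  move=> x; have xl : linear (fun a : A^o => (a : A) *: x).
    by move=> a u v; rewrite scalerDl scalerA.
  have [d [s [t stE]]] := gen.
  (* The element [x] is the image of 1 under a map from [A]. Composed with a map from [M] to [A], it
     cannot be a split epimorphism, since [N] would then be a summand of [A]; so the composite
     factors through [r]. *)
  have sub j : exists y, r y = (mklin xl \o s j) (t j 1).
    have /rP[g gE] : ~ split_epi (mklin xl \o s j : {linear M -> N}).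
      move=> [v vE]; apply: Np.
      by apply: (retract_projective (s := s j \o v) (r := mklin xl)) => //;
        exact: regular_projective.
    by exists (g (t j 1)); rewrite gE.
  have [y yE] := choice sub; exists (\sum_j y j).
  rewrite linear_sum (eq_bigr _ (fun j _ => yE j)) -linear_sum -stE.
  exact: scale1r.
have [K [i ir]] := exists_ker rs.
have Ya : addp M {ffun 'I_m -> M} := in_add_addp (in_add_ffun M m).
(* [T] is the radical of [F N], which is the image of [F r], and [F K] is the second syzygy of [S]
   for the resulting presentation. *)
have [T [j jq]] := exists_ker qs.
have rad h : q h = 0 <-> exists g, hom_map M r g = h.
  rewrite qP (radical_homP k_finlen A_fg rs0 Nind M_fg) rP.
  split=> [[g gE]|[g <-]]; last by exists g.
  by exists (g : F {ffun 'I_m -> M}); apply: lhomP.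
have [|e eE] := ses_factor jq (f := hom_map M r).
  by move=> h; apply/rad; exists h.
have ie : ses (hom_map M i) e.
  split; first exact/hom_map_inj/(ses_inj ir).
    move=> h; split=> [h0|[g <-]]; last first.
      apply: (ses_inj jq); rewrite eE linear0; apply: lhomP => x.
      by rewrite !hom_mapE (ses_comp0 ir).
    have [|g gE] := ses_factor ir (f := h).
      by move=> x; rewrite -hom_mapE -eE h0 linear0.
    by exists (g : F K); apply: lhomP.
  move=> u; have /rad[g gE] := ses_comp0 jq u.
  by exists g; apply: (ses_inj jq); rewrite eE.
split.
  apply: (gproj_resolution_ses jq (hom_gproj N_addp)).
  apply: (gproj_resolution_ses ie (hom_gproj Ya)); apply: hom_res.
  by apply: (fg_sub A_fg k_finlen (ses_inj ir)); apply: addp_fg Ya.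
move=> l Sl; rewrite leqNgt; apply/negP => ln.
(* A resolution of length at most [n + 1] kills Ext^(n+2)(S, -) into the regular module, hence
   Ext^(n+1) of the syzygy [T]. *)
have /ext_ex_all H := gproj_resolution_ext_ex Sl ln.
have HT := H _ _ _ _ (hom_projective N_addp) jq.
have [J [Z [P [Z' [P' [m' [c [m'' [c' [Jd res res']]]]]]]]]] := resolutions.
have Mr := ext_all_lifts A_artin M_fg M_pct Jd res ir Ya ie HT.
(* Now every map from [M] to [N] factors through [r], including the split epimorphism [r0], contrary
   to the choice of [r]. *)
have [g gE] := Mr r0.
by have /rP : exists g : {linear M -> {ffun 'I_m -> M}}, forall x, r (g x) = r0 x;
  [exists g | apply; exists s0].
Qed.

End SimpleTop.

Unset Implicit Arguments.

Theorem theorem1 (n : nat) (k : comNzRingType) (A : algType k)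
    (t : nat) (M : lmodType A) (Mi : 'I_t -> lmodType A)
    (S : 'I_t -> lmodType (endo M)^c) :
  (0 < n)%N ->
  artin_algebra A -> basic_algebra A ->
  finitely_generated M -> precluster_tilting n (in_add M) ->
  basic_decomposition M Mi ->
  (forall i, is_top (lhom M (Mi i)) (S i)) ->
  forall i,
    (projective (Mi i) -> Gpd_le (S i) n) /\
    (~ projective (Mi i) -> Gpd_eq (S i) n.+1).
Proof.
case: n => // n _ Aa _ Mf Mp [[inj [prj [prj_inj _ _]]] Mind _] Stop i.
split=> [|]; first exact: (top_projective Aa Mf Mp (prj_inj i) (Mind i) (Stop i)).
exact: (top_nonprojective Aa Mf Mp (prj_inj i) (Mind i) (Stop i)).
Qed.
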